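(* Let $\mathcal G$ be a connected noncompact metric graph satisfying Assumption (H), and consider the critical energy ($p=6$). Then $\mu_{\mathcal G}=\mu_{\mathbb R}$, and $\mathcal E_{\mathcal G}(\mu_{\mathbb R})=0$, this value being attained if and only if $\mathcal G$ is $\mathbb R$ or a bubble tower.
   Context: Metric graphs have finitely many edges and vertices, bounded edges identified with $[0,\ell_e]$ and halflines with $[0,\infty)$ (far endpoints: vertices at infinity); noncompact means at least one halfline. A trail is a path of adjacent edges traversing each edge exactly once. Assumption (H): every point of $\mathcal G$ lies on a trail containing two halflines (equivalently, after identifying all vertices at infinity, $\mathcal G$ admits a covering by cycles). A bubble tower is a graph obtained from $\mathbb R$ by identifying finitely many pairs of opposite points $x_j\sim-x_j$. $H^1_\mu(\mathcal G)$: continuous functions, $H^1$ on each edge, $\|u\|_2^2=\mu$. $E(u,\mathcal G)=\frac12\int|u'|^2-\frac16\int|u|^6$, $\mathcal E_{\mathcal G}(\mu)=\inf_{H^1_\mu(\mathcal G)}E(\cdot,\mathcal G)$. For a graph $X$, $K_X=\sup_{u\in H^1(X),u\ne0}\frac{\|u\|_6^6}{\|u\|_2^4\|u'\|_2^2}$ and $\mu_X=\sqrt{3/K_X}$; $\mu_{\mathbb R}=\pi\sqrt3/2$. *)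

(* Defs.v *)
From HB Require Import structures.
From mathcomp Require Import all_boot all_order all_algebra.
From mathcomp Require Import all_classical all_reals all_analysis.
Set Implicit Arguments. Unset Strict Implicit. Unset Printing Implicit Defensive.
Import Order.TTheory GRing.Theory Num.Theory.
Local Open Scope classical_set_scope.
Local Open Scope ring_scope.

(* ---------- Metric graphs ----------
   Finitely many vertices 'I_nV and edges 'I_nE.  Edge e starts at vertex
   [ghd e]; if [gtl e = Some w] it is a bounded edge [0, glen e] ending at w,
   if [gtl e = None] it is a halfline [0, +oo) (far end = vertex at infinity).
   Loops and multiple edges are allowed. *)
Record mgraph (R : realType) := MGraph {
  nV : nat;
  nE : nat;
  ghd : 'I_nE -> 'I_nV;
  gtl : 'I_nE -> option 'I_nV;
  glen : 'I_nE -> R;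
  glen_gt0 : forall e, 0 < glen e }.
Arguments nV {R} _.
Arguments nE {R} _.
Arguments ghd {R} _ _.
Arguments gtl {R} _ _.
Arguments glen {R} _ _.

Section Graphs.
Variable R : realType.
Implicit Types G : mgraph R.

Definition Rline : mgraph R :=
  @MGraph R 1 2 (fun _ => ord0) (fun _ => None) (fun _ => 1) (fun _ => ltr01).

Definition noncompact G : Prop := exists e, gtl G e = None.

Definition gpoint G := ('I_(nE G) * R)%type.

Definition in_dom G (p : gpoint G) : bool :=
  (0 <= p.2) && (if gtl G p.1 is Some _ then p.2 <= glen G p.1 else true).

Definition vtx_of G (p : gpoint G) : option 'I_(nV G) :=
  if p.2 == 0 then Some (ghd G p.1)
  else match gtl G p.1 with
       | Some w => if p.2 == glen G p.1 then Some w else None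
       | None => None end.

Definition same_pt G (p q : gpoint G) : bool :=
  (p == q) || ((vtx_of p != None) && (vtx_of p == vtx_of q)).

Definition gchain G (p q : gpoint G) (c0 : gpoint G * gpoint G)
  (cs : seq (gpoint G * gpoint G)) : Prop :=
  c0.1 = p /\ (last c0 cs).2 = q /\
  all (fun c => (c.1.1 == c.2.1) && in_dom c.1 && in_dom c.2) (c0 :: cs) /\
  path (fun a b => same_pt a.2 b.1) c0 cs.

Definition gcost G (cs : seq (gpoint G * gpoint G)) : R :=
  \sum_(c <- cs) `|c.1.2 - c.2.2|.

Definition gdist G (p q : gpoint G) : R :=
  inf [set r | exists c0 cs, gchain p q c0 cs /\ r = gcost (c0 :: cs)].

Definition gconnected G : Prop :=
  forall p q : gpoint G, in_dom p -> in_dom q -> exists c0 cs, gchain p q c0 cs.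

(* a step traverses edge e forwards (true) or backwards (false);
   its (entry, exit) vertices, None = vertex at infinity *)
Definition step_ends G (s : 'I_(nE G) * bool) : option 'I_(nV G) * option 'I_(nV G) :=
  if s.2 then (Some (ghd G s.1), gtl G s.1) else (gtl G s.1, Some (ghd G s.1)).

Definition trail2 G (s0 : 'I_(nE G) * bool) (ss : seq ('I_(nE G) * bool)) : bool :=
  [&& path (fun a b => ((step_ends a).2 == (step_ends b).1) && ((step_ends a).2 != None)) s0 ss,
      uniq (map fst (s0 :: ss)),
      (step_ends s0).1 == None &
      (step_ends (last s0 ss)).2 == None].

Definition on_trail G (p : gpoint G) s0 ss : Prop :=
  p.1 \in map fst (s0 :: ss) \/
  exists v, vtx_of p = Some v /\
    has (fun s => ((step_ends s).1 == Some v) || ((step_ends s).2 == Some v)) (s0 :: ss).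

Definition assumptionH G : Prop :=
  forall p : gpoint G, in_dom p -> exists s0 ss, trail2 s0 ss /\ on_trail p s0 ss.

Definition edom G (e : 'I_(nE G)) : set R :=
  if gtl G e is Some _ then `[0, glen G e] else `[0, +oo[.

Definition Leb := (@lebesgue_measure R).

(* u : function on the graph (edgewise), g : its (weak) derivative.
   H1 G u g: u, g in L^2 of each edge, u absolutely continuous on each edge
   with derivative g, and u continuous at the vertices. *)
Definition H1 G (u g : 'I_(nE G) -> R -> R) : Prop :=
  (forall e, Leb.-integrable (edom e) (fun x => ((u e x) ^+ 2)%:E)) /\
  (forall e, Leb.-integrable (edom e) (fun x => ((g e x) ^+ 2)%:E)) /\
  (forall e x, edom e x ->
     Leb.-integrable `[0, x] (fun t => (g e t)%:E) /\
     u e x = u e 0 + fine (\int[Leb]_(t in `[0, x]) (g e t)%:E)) /\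
  (exists phi : 'I_(nV G) -> R, forall e,
     u e 0 = phi (ghd G e) /\ forall w, gtl G e = Some w -> u e (glen G e) = phi w).

Definition normk G (k : nat) (f : 'I_(nE G) -> R -> R) : R :=
  \sum_(e < nE G) fine (\int[Leb]_(x in edom e) (`|f e x| ^+ k)%:E).

Definition energy G (u g : 'I_(nE G) -> R -> R) : R :=
  2^-1 * normk 2 g - 6^-1 * normk 6 u.

Definition Elevel G (m : R) : \bar R :=
  ereal_inf [set y | exists u g : 'I_(nE G) -> R -> R, H1 u g /\ normk 2 u = m /\ y = (energy u g)%:E].

Definition attained G (m : R) : Prop :=
  exists u g : 'I_(nE G) -> R -> R, H1 u g /\ normk 2 u = m /\ (energy u g)%:E = Elevel G m.

(* K_X and mu_X = sqrt(3 / K_X) (with 3/+oo read as 0) *)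
Definition Kconst G : \bar R :=
  ereal_sup [set y | exists u g : 'I_(nE G) -> R -> R, H1 u g /\ 0 < normk 2 u /\
     y = (normk 6 u / (normk 2 u ^+ 2 * normk 2 g))%:E].

Definition mucrit G : R := Num.sqrt (3 / fine (Kconst G)).

(* the quotient pseudo-distance on R obtained by identifying x ~ -x, x in xs *)
Definition glued (xs : seq R) (a b : R) : bool :=
  (a == b) || has (fun x => ((a == x) && (b == - x)) || ((a == - x) && (b == x))) xs.

Definition glue_dist (xs : seq R) (s t : R) : R :=
  inf [set r | exists c0 cs, c0.1 = s /\ (last c0 cs).2 = t /\
        path (fun a b => glued xs a.2 b.1) c0 cs /\
        r = \sum_(c <- c0 :: cs) `|c.1 - c.2|].

(* G is isometric (as a metric space, points identified at distance 0)
   to the pseudometric space (R, d) *)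
Definition isometric_to G (d : R -> R -> R) : Prop :=
  exists f : gpoint G -> R,
    (forall p q, in_dom p -> in_dom q -> d (f p) (f q) = gdist p q) /\
    (forall t, exists p, in_dom p /\ d (f p) t = 0).

Definition is_R G : Prop := isometric_to G (fun s t => `|s - t|).

Definition is_bubble_tower G : Prop :=
  exists xs : seq R, [/\ xs != [::], uniq xs, all (fun x => 0 < x) xs &
                        isometric_to G (glue_dist xs)].

End Graphs.

(* Main.v *)
(* Let M be the maximum of |u|, m the mass of u and c = pi / m.  Expanding
   the square in 0 <= \int_G (2 |u'| - c |u| sqrt (M ^ 4 - u ^ 4)) ^ 2, the
   cross term is controlled from below along a trail through a point where |u| = M:
   a primitive of s sqrt (M ^ 4 - s ^ 4), taken at |u|, climbs from 0 to its value at M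
   and comes back to 0, along edges used only once.  This is the sharp inequality
   pi ^ 2 |u|_6 ^ 6 <= 4 |u|_2 ^ 4 |u'|_2 ^ 2, whose constant is approached on
   any graph with a halfline by truncated solitons sech (x - T) ^ (1/2).

   In the equality case the square vanishes almost everywhere, so
   arcosh (M ^ 2 / u ^ 2) is a Lipschitz function vanishing at the maximum point.
   Along the trail u ^ 2 therefore dominates a soliton of the position, which
   already carries the whole mass: the trail covers G, and u ^ 2 equals the
   soliton.  Since the soliton is even and decreasing away from its maximum, the
   trail can meet itself only at opposite positions, and G is the line or a
   bubble tower.  Conversely, the soliton composed with the isometry from such
   a graph to the glued line has the norms of the soliton, because the isometry is
   piecewise isometric on the edges. *)
Require Import Defs.
From HB Require Import structures.
From mathcomp Require Import all_boot all_order all_algebra.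
From mathcomp Require Import all_classical all_reals all_analysis.
From mathcomp Require Import measurable_realfun.
From mathcomp Require Import ring lra.
Set Implicit Arguments. Unset Strict Implicit. Unset Printing Implicit Defensive.
Import Order.TTheory GRing.Theory Num.Theory.
Import numFieldNormedType.Exports.
Local Open Scope classical_set_scope.
Local Open Scope ring_scope.

(** * The chain rule for absolutely continuous functions *)

(** The choice c = pi / m makes two terms in M ^ 4 cancel, one coming from the mass and one from the
    trail, so the unknown maximum leaves the inequality. Completing the square takes the place of a
    rearrangement argument and keeps an explicit defect for the equality case. Three obstacles shape
    the rest. The functions are only absolutely continuous, so the chain rule is an inequality of
    variations, derived from a mean value inequality for the outer function. The function arcosh (M
    ^ 2 / s ^ 2) is singular at s = 0 and not Lipschitz at s = M, so it is regularised by n > 0 with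
    a bound uniform in n; the limit is taken in multiplied-out form, since at that stage u may still
    vanish. Finally, an isometry onto a glued line fixes positions only up to the gluing and may
    jump; what stays continuous are the even functions of the position, and the soliton is even. *)

Section Interval.
Context {R : realType}.
Notation mu := (@lebesgue_measure R).
Implicit Types (a b x y : R) (u g F A Phi psi : R -> R).

(** A mean value inequality without derivatives or compactness: the radius may depend on the point.
    The supremum [s] of the points up to which the bound holds has the bound itself, by the local
    estimate to its left, and the estimate to its right goes beyond [s] unless [s] is [b]. *)
Lemma local_dominated_variation F A a b : a <= b ->
  {in `[a, b] &, {homo A : x y / x <= y}} ->
  (forall x, a <= x <= b -> exists2 d, 0 < d & forall y, a <= y <= b ->
     `|y - x| < d -> `|F y - F x| <= `|A y - A x|) ->
  `|F b - F a| <= A b - A a.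
Proof.
move=> ab mA loc.
have mA' x y : a <= x -> x <= y -> y <= b -> A x <= A y.
  move=> ax xy yb; apply: mA => //; rewrite in_itv/= ?ax ?yb ?andbT.
    exact: le_trans xy yb.
  exact: le_trans ax xy.
pose S := [set x | a <= x <= b /\ `|F x - F a| <= A x - A a].
have Sa : S a by split; rewrite ?lexx ?ab// !subrr normr0.
have Sub : ubound S b by move=> x [/andP[]].
have hS : has_sup S by split; [exists a|exists b].
set s := sup S.
have as_ : a <= s by apply: ub_le_sup => //; exists b.
have sb : s <= b by apply: ge_sup => //; exists a.
have [|d d0 hd] := loc s; first by rewrite as_.
have Ss : S s.
  have [x [/andP[ax xb] Fx] xs] := sup_adherent d0 hS.
  have xs' : x <= s by apply: ub_le_sup; [exists b|split => //; rewrite ax].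
  split; first by rewrite as_.
  have axb : a <= x <= b by rewrite ax.
  have := hd x axb.
  have xsd : `|x - s| < d by rewrite ler0_norm; [rewrite -/s in xs|]; lra.
  have := mA' _ _ ax xs' sb.
  move=> ? /(_ xsd); rewrite (@ler0_norm _ (A x - A s)); last by lra.
  by move: Fx; rewrite !ler_norml; lra.
move: sb; rewrite le_eqVlt => /predU1P[sb|sb].
  by case: Ss => _; rewrite sb.
have [y [sy yb ysd]] : exists y, [/\ s < y, y <= b & y - s < d].
  exists (Num.min b (s + d / 2)); rewrite lt_min sb/= ge_min lexx; split=> //.
    by lra.
  by rewrite ltrBlDr gt_min; apply/orP; right; lra.
have ay : a <= y by lra.
suff : S y by move=> /(@ub_le_sup _ S)-/(_ (ex_intro _ b Sub)); rewrite -/s; lra.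
split; first by rewrite ay.
have ayb : a <= y <= b by rewrite ay.
have := hd y ayb.
rewrite gtr0_norm ?subr_gt0// => /(_ ysd).
have := mA' _ _ as_ (ltW sy) yb => ?; rewrite (@ger0_norm _ (A y - A s)); last by lra.
by case: Ss => _; rewrite !ler_norml; lra.
Qed.

Lemma Rintegral_itv_cat (a b c : R) (f : R -> R) : a <= b -> b <= c ->
  mu.-integrable `[a, c] (EFin \o f) ->
  \int[mu]_(t in `[a, c]) f t = \int[mu]_(t in `[a, b]) f t + \int[mu]_(t in `[b, c]) f t.
Proof.
move=> ab bc fac; apply/eqP; rewrite addrC -subr_eq Rintegral_itvB ?bnd_simp//; apply/eqP.
apply: Rintegral_itv_obnd_cbnd; apply: integrableS fac => //.
by apply: subset_itvr; rewrite bnd_simp.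
Qed.

Section chain.
Variables (a b : R) (u g : R -> R).
Hypothesis ab : a <= b.
Hypothesis ig : mu.-integrable `[a, b] (EFin \o g).
Hypothesis uE : forall x, a <= x <= b -> u x = u a + \int[mu]_(t in `[a, x]) g t.

Let igS x y : a <= x -> y <= b -> mu.-integrable `[x, y] (EFin \o g).
Proof. by move=> ax yb; apply: integrableS ig => //; apply: subset_itvScc; rewrite bnd_simp. Qed.

Lemma primitiveB x y : a <= x -> x <= y -> y <= b ->
  u y - u x = \int[mu]_(t in `[x, y]) g t.
Proof.
move=> ax xy yb.
have xab : a <= x <= b by rewrite ax (le_trans xy).
have yab : a <= y <= b by rewrite yb (le_trans ax).
rewrite (uE yab) (uE xab) (Rintegral_itv_cat ax xy); last exact: igS.
by ring.
Qed.

Lemma primitive_continuous : {within `[a, b], continuous u}.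
Proof.
apply: (@subspace_eq_continuous _ _ _ (fun x => u a + \int[mu]_(t in `[a, x]) g t)).
  by move=> x; rewrite inE/= in_itv/= => xab; rewrite -uE.
move=> x; apply: cvgD; first exact: cvg_cst.
exact: (parameterized_integral_continuous ab ig).
Qed.

End chain.

Lemma within_continuousP a b u : {within `[a, b], continuous u} <->
  forall x e, a <= x <= b -> 0 < e ->
  exists2 d, 0 < d & forall y, a <= y <= b -> `|y - x| < d -> `|u y - u x| < e.
Proof.
split=> [|H].
  move=> /subspace_continuousP cu x e xab e0.
  have /cvgrPdist_lt/(_ e e0) : u @ within `[a, b] (nbhs x) --> u x.
    by apply: cu; rewrite /= in_itv.
  rewrite near_withinE => -[d /= d0 hd]; exists d => // y yab yxd.
  rewrite distrC; apply: hd; last by rewrite /= in_itv.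
  by rewrite /ball_/= distrC.
apply/subspace_continuousP => x /=; rewrite in_itv/= => xab.
apply/cvgrPdist_lt => e e0; rewrite near_withinE.
have [d d0 hd] := H x e xab e0; exists d => // y /=; rewrite /ball_/= => yx.
by rewrite in_itv/= => yab; rewrite distrC; apply: hd => //; rewrite distrC.
Qed.

Lemma integrable_scale (D : set (measurableTypeR R)) g (C : R) : measurable D ->
  mu.-integrable D (EFin \o g) -> mu.-integrable D (EFin \o (fun x => C * g x)).
Proof. by move=> mD ig; exact: (integrableZl mD C ig). Qed.

Lemma integrable_add (D : set (measurableTypeR R)) f g : measurable D ->
  mu.-integrable D (EFin \o f) -> mu.-integrable D (EFin \o g) ->
  mu.-integrable D (EFin \o (fun x => f x + g x)).
Proof. by move=> mD if_ ig; exact: (integrableD mD if_ ig). Qed.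

Lemma integrable_mul_bounded (D : set (measurableTypeR R)) (f g : R -> R) (C : R) : measurable D ->
  measurable_fun D f -> (forall x, D x -> `|f x| <= C) ->
  mu.-integrable D (EFin \o g) -> mu.-integrable D (EFin \o (fun x => f x * g x)).
Proof.
move=> mD mf fC ig.
have mg : measurable_fun D g by apply/measurable_EFinP; exact: measurable_int ig.
apply: (@le_integrable _ _ _ mu D mD _ (EFin \o (fun x => C * g x))).
- by apply/measurable_EFinP; exact: measurable_funM.
- move=> x Dx /=; rewrite lee_fin !normrM ler_wpM2r//.
  by rewrite (le_trans (fC x Dx))// ler_norm.
- exact: integrable_scale.
Qed.

Lemma integrable_normr (D : set (measurableTypeR R)) g : measurable D ->
  mu.-integrable D (EFin \o g) -> mu.-integrable D (EFin \o (fun x => `|g x|)).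
Proof. by move=> mD ig; exact: (integrable_abse ig). Qed.

Lemma chain_rule_le Phi psi a b u g (M : R) : a <= b ->
  mu.-integrable `[a, b] (EFin \o g) ->
  (forall x, a <= x <= b -> u x = u a + \int[mu]_(t in `[a, x]) g t) ->
  (forall x, a <= x <= b -> `|u x| <= M) ->
  continuous psi -> (forall s, 0 <= psi s) ->
  (forall p q : R, - M <= p -> p < q -> q <= M ->
    exists2 s : R, p <= s <= q & `|Phi q - Phi p| <= psi s * (q - p)) ->
  mu.-integrable `[a, b] (EFin \o (fun x => psi (u x) * `|g x|)) /\
  `|Phi (u b) - Phi (u a)| <= \int[mu]_(x in `[a, b]) (psi (u x) * `|g x|).
Proof.
move=> ab ig uE uM cpsi psi0 mvt.
have cu := primitive_continuous ab ig uE.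
have mpsiu : {within `[a, b], continuous (psi \o u)}.
  by move=> x; apply: (@continuous_comp (subspace `[a, b]) _ _ u psi); [exact: cu|exact: cpsi].
have iag : mu.-integrable `[a, b] (EFin \o (fun x => `|g x|)) by exact: integrable_normr.
have [B psiB] : exists B, forall x, a <= x <= b -> psi (u x) <= B.
  have [c _ hc] := EVT_max ab mpsiu; exists (psi (u c)) => x xab.
  by apply: hc; rewrite in_itv.
have ipsi : mu.-integrable `[a, b] (EFin \o (fun x => psi (u x) * `|g x|)).
  apply: (@integrable_mul_bounded _ _ _ B) => //.
    by apply: subspace_continuous_measurable_fun.
  by move=> x /=; rewrite in_itv/= => xab; rewrite ger0_norm ?psiB.
split => //.
apply/ler_addgt0Pr => e' e'0.
pose I := \int[mu]_(x in `[a, b]) `|g x|.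
have I0 : 0 <= I by apply: Rintegral_ge0.
(* Scaled so that the extra term [e * |g|] integrates to at most [e']. *)
pose e : R := e' / (I + 1).
have e0 : 0 < e by rewrite divr_gt0// ltr_wpDl.
have ieg : mu.-integrable `[a, b] (EFin \o (fun x => e * `|g x|)) by exact: integrable_scale.
pose h x := psi (u x) * `|g x| + e * `|g x|.
have ih : mu.-integrable `[a, b] (EFin \o h) by exact: integrable_add.
have h0 x : 0 <= h x by rewrite addr_ge0// mulr_ge0// ltW.
pose A y := \int[mu]_(x in `[a, y]) h x.
have ihS x y : a <= x -> y <= b -> mu.-integrable `[x, y] (EFin \o h).
  by move=> ax yb; apply: integrableS ih => //; apply: subset_itvScc; rewrite bnd_simp.
have AB x y : a <= x -> x <= y -> y <= b -> A y - A x = \int[mu]_(t in `[x, y]) h t.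
  by move=> ax xy yb; rewrite /A (Rintegral_itv_cat ax xy) ?ihS//; ring.
have Amono x y : a <= x -> x <= y -> y <= b -> A x <= A y.
  by move=> ax xy yb; rewrite -subr_ge0 AB// Rintegral_ge0.
have key x y (m : R) : a <= x -> x <= y -> y <= b ->
    (forall t, x <= t <= y -> m <= psi (u t) + e) -> 0 <= m ->
    m * `|u y - u x| <= A y - A x.
  move=> ax xy yb hm m0; rewrite (primitiveB ig uE)// AB//.
  have igxy : mu.-integrable `[x, y] (EFin \o g).
    by apply: integrableS ig => //; apply: subset_itvScc; rewrite bnd_simp.
  have iaxy : mu.-integrable `[x, y] (EFin \o (fun x => `|g x|)) by exact: integrable_normr.
  apply: (@le_trans _ _ (m * \int[mu]_(t in `[x, y]) `|g t|)).
    by rewrite ler_wpM2l// le_normr_Rintegral.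
  rewrite -RintegralZl//; apply: le_Rintegral => //.
  - exact: integrable_scale.
  - exact: ihS.
  - by move=> t /=; rewrite in_itv/= => xty; rewrite /h -mulrDl ler_wpM2r// hm.
have : `|Phi (u b) - Phi (u a)| <= A b - A a.
  apply: (@local_dominated_variation (Phi \o u)) => //.
    move=> x y /=; rewrite !in_itv/= => /andP[ax _] /andP[_ yb] xy; exact: Amono.
  move=> x xab.
  have e20 : 0 < e / 2 by rewrite divr_gt0.
  have [d1 d10 hd1] := (within_continuousP a b _).1 mpsiu x (e / 2) xab e20.
  have /cvgrPdist_lt/(_ _ e20)[d2 /= d20 hd2] := cpsi (u x).
  have [d3 d30 hd3] := (within_continuousP a b _).1 cu x d2 xab d20.
  exists (Num.min d1 d3); first by rewrite lt_min d10.
  move=> y yab; rewrite lt_min => /andP[yd1 yd3].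
  have uxy := hd3 y yab yd3.
  (* Halfway between [psi (u x)] and [psi (u x) + e]: near [x], [m] is above [psi] at the mean value
     point and below [psi (u t) + e]. *)
  pose m : R := psi (u x) + e / 2.
  have m0 : 0 <= m by rewrite addr_ge0// ltW.
  have st1 : `|Phi (u y) - Phi (u x)| <= m * `|u y - u x|.
    have near_ s : `|s - u x| < d2 -> psi s <= m.
      rewrite distrC => /hd2 /=; rewrite ltr_distl => /andP[? ?]; rewrite /m; lra.
    have /andP[x1 x2] : - M <= u x <= M by rewrite -ler_norml uM.
    have /andP[y1 y2] : - M <= u y <= M by rewrite -ler_norml uM.
    have [xy|xy|xy] := ltgtP (u x) (u y);
      last by rewrite xy !subrr !normr0 mulr0.
    have [s /andP[s1 s2]] := mvt (u x) (u y) x1 xy y2.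
      move=> /le_trans; apply; rewrite (@ger0_norm _ (u y - u x)); last by lra.
      apply: ler_wpM2r; first by lra.
      apply: near_; move: uxy; rewrite (@ger0_norm _ (u y - u x)); last by lra.
      by rewrite (@ger0_norm _ (s - u x)); lra.
    have [s /andP[s1 s2]] := mvt (u y) (u x) y1 xy x2.
      rewrite distrC (distrC (u y)).
      move=> /le_trans; apply; rewrite (@ger0_norm _ (u x - u y)); last by lra.
      apply: ler_wpM2r; first by lra.
      apply: near_; move: uxy; rewrite (@ler0_norm _ (u y - u x)); last by lra.
      by rewrite (@ler0_norm _ (s - u x)); lra.
  have mt t : a <= t <= b -> `|t - x| < d1 -> m <= psi (u t) + e.
    by move=> tab /(hd1 t tab) /=; rewrite ltr_distl /m => /andP[? ?]; lra.
  apply: (le_trans st1).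
  move: (xab) (yab) => /andP[ax xb] /andP[ay yb].
  have [xy|yx] := leP x y.
    rewrite (@ger0_norm _ (A y - A x)) ?subr_ge0 ?Amono//; apply: key => // t /andP[xt ty].
    apply: mt; first by rewrite (le_trans ax xt) (le_trans ty).
    by move: yd1; rewrite (@ger0_norm _ (y - x)) ?(@ger0_norm _ (t - x)); lra.
  rewrite (distrC (u y)) (distrC (A y)) (@ger0_norm _ (A x - A y)); last first.
    by rewrite subr_ge0 Amono// ltW.
  apply: key => //; first exact: ltW.
  move=> t /andP[yt tx].
  apply: mt; first by rewrite (le_trans ay yt) (le_trans tx).
  by move: yd1; rewrite (@ler0_norm _ (y - x)) ?(@ler0_norm _ (t - x)); lra.
move=> /le_trans; apply.
have -> : A a = 0 by rewrite /A set_itv1 Rintegral_set1.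
rewrite subr0 /A /h RintegralD// RintegralZl// lerD2l -/I /e.
by rewrite mulrAC ler_pdivrMr ?ltr_wpDl// ler_wpM2l ?ltW// ltrDl.
Qed.

End Interval.

(** * Sobolev functions on one edge *)

Lemma normrM_le_sqrD (R : realType) (p q : R) : `|p| * `|q| <= p ^+ 2 + q ^+ 2.
Proof.
rewrite -(real_normK (num_real p)) -(real_normK (num_real q)).
have := normr_ge0 p; have := normr_ge0 q; move: `|p| `|q| => a b a0 b0.
have := sqr_ge0 (a - b); nra.
Qed.

Section EdgeDomain.
Context {R : realType}.
Notation mu := (@lebesgue_measure R).

Definition edge_itv (l : option R) : interval R :=
  Interval (BLeft 0) (if l is Some l then BRight l else +oo%O).

Definition edge_dom (l : option R) : set (measurableTypeR R) := [set` edge_itv l].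

Definition H1_edge (D : set R) (u g : R -> R) : Prop :=
  [/\ mu.-integrable D (EFin \o (fun x => u x ^+ 2)),
      mu.-integrable D (EFin \o (fun x => g x ^+ 2)) &
      forall x, D x -> mu.-integrable `[0, x] (EFin \o g) /\
        u x = u 0 + \int[mu]_(t in `[0, x]) g t].

Implicit Types l : option R.

Lemma edge_domE l x : edge_dom l x = ((0 <= x) && (if l is Some l then x <= l else true)) :> Prop.
Proof. by case: l => [l|] /=; rewrite /edge_dom/= in_itv. Qed.

Lemma measurable_edge_dom l : measurable (edge_dom l).
Proof. exact: measurable_itv. Qed.

Lemma edge_dom_ge0 l x : edge_dom l x -> 0 <= x.
Proof. by rewrite edge_domE => /andP[]. Qed.

Lemma edge_dom_le l x y : edge_dom l y -> 0 <= x -> x <= y -> edge_dom l x.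
Proof.
rewrite !edge_domE => /andP[_ yl] -> xy /=.
by case: l yl => [l|//] yl; exact: le_trans yl.
Qed.

Lemma edge_dom_sub l x y : edge_dom l y -> 0 <= x -> `[x, y] `<=` edge_dom l.
Proof.
move=> yl x0 z /=; rewrite in_itv/= => /andP[xz zy].
by apply: (edge_dom_le yl) => //; exact: le_trans xz.
Qed.

Lemma measurable_fun_edge_dom l (f : R -> R) :
  (forall x, edge_dom l x -> measurable_fun (`[0, x] : set (measurableTypeR R)) f) ->
  measurable_fun (edge_dom l) f.
Proof.
case: l => [l|] H.
  have [l0|l0] := leP 0 l.
    by apply: (H l); rewrite edge_domE l0 lexx.
  rewrite (_ : edge_dom _ = set0); first exact: measurable_fun_set0.
  apply/seteqP; split=> // x; rewrite edge_domE => /andP[x0 xl].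
  by move: (le_trans x0 xl); rewrite leNgt l0.
rewrite /edge_dom /edge_itv itv_bndy_bigcup_BRight.
apply/measurable_fun_bigcup => // n; apply: H.
by rewrite edge_domE add0r ler0n.
Qed.

Section edge.
Variables (l : option R) (u g : R -> R).
Hypothesis H : H1_edge (edge_dom l) u g.
Let D := edge_dom l.

Let mD : measurable D. Proof. exact: measurable_edge_dom. Qed.

Lemma H1_edge_integrable x y : 0 <= x -> D y -> mu.-integrable `[x, y] (EFin \o g).
Proof.
move=> x0 Dy; case: H => _ _ /(_ y Dy)[iy _].
by apply: integrableS iy => //; apply: subset_itvScc; rewrite bnd_simp.
Qed.

Lemma H1_edge_primitive x y : 0 <= x -> x <= y -> D y ->
  u y = u x + \int[mu]_(t in `[x, y]) g t.
Proof.
move=> x0 xy Dy; case: H => _ _ Hu.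
rewrite -(@primitiveB R 0 y u g _ _ x y)//; first by rewrite addrC subrK.
- exact: H1_edge_integrable.
- by move=> z /andP[z0 zy]; case: (Hu z) => //; exact: edge_dom_le zy.
Qed.

Lemma H1_edge_continuous x y : 0 <= x -> x <= y -> D y -> {within `[x, y], continuous u}.
Proof.
move=> x0 xy Dy; apply: (primitive_continuous xy (H1_edge_integrable x0 Dy)).
move=> z /andP[xz zy]; apply: H1_edge_primitive => //.
by apply: (edge_dom_le Dy) => //; exact: le_trans xz.
Qed.

Lemma H1_edge_measurable : measurable_fun D u.
Proof.
apply: measurable_fun_edge_dom => x Dx.
apply: subspace_continuous_measurable_fun => //.
by apply: H1_edge_continuous => //; exact: edge_dom_ge0 Dx.
Qed.

Lemma H1_edge_measurable_grad : measurable_fun D g.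
Proof.
apply: measurable_fun_edge_dom => x Dx; apply/measurable_EFinP.
exact: (measurable_int mu (H1_edge_integrable (lexx 0) Dx)).
Qed.

Lemma H1_edge_integrable_mul : mu.-integrable D (EFin \o (fun x => `|u x| * `|g x|)).
Proof.
case: (H) => iu ig _.
apply: (@le_integrable _ _ _ mu D mD _ (EFin \o (fun x => u x ^+ 2 + g x ^+ 2))).
- apply/measurable_EFinP; apply: measurable_funM.
    by apply: measurableT_comp => //; exact: H1_edge_measurable.
  by apply: measurableT_comp => //; exact: H1_edge_measurable_grad.
- move=> x Dx /=; rewrite lee_fin normrM !normr_id.
  rewrite (@ger0_norm _ (u x ^+ 2 + g x ^+ 2)) ?addr_ge0 ?sqr_ge0//.
  exact: normrM_le_sqrD.
- exact: integrable_add.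
Qed.

Section dominated_chain.
Variables (Phi psi : R -> R) (M C : R).
Hypothesis uM : forall x, D x -> `|u x| <= M.
Hypothesis cpsi : continuous psi.
Hypothesis psi0 : forall s, 0 <= psi s.
Hypothesis psiC : forall s, `|s| <= M -> psi s <= C * `|s|.
Hypothesis mvt : forall p q : R, - M <= p -> p < q -> q <= M ->
    exists2 s : R, p <= s <= q & `|Phi q - Phi p| <= psi s * (q - p).

(** The linear bound on [psi] makes the integrand at most a multiple of [|u| * |g|], a product of
    two square integrable functions; this is what controls it on a halfline. *)
Lemma H1_edge_integrable_chain : mu.-integrable D (EFin \o (fun x => psi (u x) * `|g x|)).
Proof.
have iC := integrable_scale C mD H1_edge_integrable_mul.
apply: (@le_integrable _ _ _ mu D mD _ _ _ _ iC).
- apply/measurable_EFinP; apply: measurable_funM.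
    apply: (measurableT_comp (f := psi)); last exact: H1_edge_measurable.
    exact: continuous_measurable_fun.
  by apply: measurableT_comp => //; exact: H1_edge_measurable_grad.
- move=> x Dx /=; rewrite lee_fin !normrM !normr_id mulrA ler_wpM2r//.
  rewrite ger0_norm// (le_trans (psiC (uM Dx)))//.
  by rewrite ler_wpM2r// ler_norm.
Qed.

Lemma H1_edge_chain x y : 0 <= x -> x <= y -> D y ->
  `|Phi (u y) - Phi (u x)| <= \int[mu]_(t in `[x, y]) (psi (u t) * `|g t|).
Proof.
move=> x0 xy Dy.
have Dz z : x <= z <= y -> D z.
  by move=> /andP[xz zy]; apply: (edge_dom_le Dy) => //; exact: le_trans xz.
apply: (chain_rule_le (M := M) xy (H1_edge_integrable x0 Dy) _ _ cpsi psi0 mvt).2.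
- by move=> z /[dup] /Dz Dz' /andP[xz zy]; exact: H1_edge_primitive.
- by move=> z /Dz; exact: uM.
Qed.

(** The climb to [x] and the descent from it use disjoint parts of the edge, so one integral over
    the edge pays for both. This serves the edge whose interior contains the maximum. *)
Lemma H1_edge_chain2 x y : 0 <= x -> x <= y -> D y ->
  `|Phi (u x) - Phi (u 0)| + `|Phi (u y) - Phi (u x)| <=
  \int[mu]_(t in D) (psi (u t) * `|g t|).
Proof.
move=> x0 xy Dy.
have Dx := edge_dom_le Dy x0 xy.
apply: (le_trans (lerD (H1_edge_chain (lexx 0) x0 Dx) (H1_edge_chain x0 xy Dy))).
have iD := H1_edge_integrable_chain.
have i0y : mu.-integrable `[0, y] (EFin \o (fun t => psi (u t) * `|g t|)).
  by apply: integrableS iD => //; exact: edge_dom_sub.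
rewrite -(Rintegral_itv_cat x0 xy i0y).
rewrite /Rintegral fine_le//.
- exact: integrable_fin_num.
- exact: integrable_fin_num.
- apply: ge0_subset_integral => //.
  + exact: (measurable_int mu iD).
  + by move=> t _; rewrite lee_fin mulr_ge0.
  + exact: edge_dom_sub.
Qed.

End dominated_chain.
End edge.
End EdgeDomain.

(** * Decay on halflines and existence of a maximum on an edge *)

Section EdgeMax.
Context {R : realType}.
Notation mu := (@lebesgue_measure R).

Lemma Rintegral_cst_itv (a b c : R) : a <= b -> \int[mu]_(_ in `[a, b]) c = c * (b - a).
Proof.
move=> ab; rewrite Rintegral_cst//=; congr (_ * _).
rewrite lebesgue_measure_itv/= lte_fin.
by case: ltgtP ab => [||->] // _; rewrite subrr.
Qed.

Lemma sqr_mean_value (p q : R) : p < q ->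
  exists2 s : R, p <= s <= q & `|q ^+ 2 - p ^+ 2| <= (2 * `|s|) * (q - p).
Proof.
move=> pq; exists ((p + q) / 2); first by apply/andP; split; lra.
rewrite normrM (@ger0_norm _ 2^-1)// mulrCA divff// mulr1 subr_sqr mulrC normrM.
by rewrite (addrC q) (@ger0_norm _ (q - p))// subr_ge0 ltW.
Qed.

Lemma H1_edge_bounded (l : option R) (u g : R -> R) y :
  H1_edge (edge_dom l) u g -> edge_dom l y ->
  exists M, forall x, 0 <= x <= y -> `|u x| <= M.
Proof.
move=> H Dy; have y0 := edge_dom_ge0 Dy.
have cu : {within `[0, y], continuous (fun x => `|u x|)}.
  by move=> x; apply: cvg_norm; exact: (H1_edge_continuous H (lexx 0) y0 Dy).
have [c _ hc] := EVT_max y0 cu.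
by exists `|u c| => x xy; apply: hc; rewrite in_itv.
Qed.

Section halfline.
Variables (u g : R -> R).
Hypothesis H : H1_edge (edge_dom None) u g.

Let D0 x : 0 <= x -> edge_dom (None : option R) x.
Proof. by move=> x0; rewrite edge_domE x0. Qed.

Lemma H1_edge_small X e : 0 < e -> exists2 y, X <= y & 0 <= y /\ `|u y| < e.
Proof.
move=> e0; apply: contrapT => nex.
pose a := Num.max X 0.
have a0 : 0 <= a by rewrite le_max lexx orbT.
have ue y : a <= y -> e ^+ 2 <= u y ^+ 2.
  rewrite ge_max => /andP[Xy y0]; rewrite -(real_normK (num_real (u y))).
  apply: lerXn2r; rewrite ?nnegrE ?(ltW e0)//.
  by rewrite leNgt; apply/negP => uy; apply: nex; exists y.
case: (H) => iu _ _.
pose I := \int[mu]_(x in edge_dom None) (u x ^+ 2).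
have I0 : 0 <= I by apply: Rintegral_ge0 => x _; exact: sqr_ge0.
(* On a segment of this length the bound [e ^+ 2 <= u ^+ 2] would give an integral of at least
   [I + 1], above the total [I]. *)
pose L := (I + 1) / e ^+ 2.
have L0 : 0 < L by rewrite divr_gt0 ?exprn_gt0// ltr_wpDl.
have sub : `[a, a + L] `<=` edge_dom None.
  by apply: edge_dom_sub => //; apply: D0; rewrite addr_ge0// ltW.
have iS : mu.-integrable `[a, a + L] (EFin \o (fun x => u x ^+ 2)).
  by apply: integrableS iu => //; exact: measurable_edge_dom.
have : \int[mu]_(x in `[a, a + L]) (u x ^+ 2) <= I.
  rewrite /I /Rintegral fine_le//.
  - exact: integrable_fin_num.
  - apply: integrable_fin_num => //; exact: measurable_edge_dom.
  - apply: ge0_subset_integral => //.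
    + exact: measurable_edge_dom.
    + exact: (measurable_int mu iu).
    + by move=> t _; rewrite lee_fin sqr_ge0.
have : \int[mu]_(x in `[a, a + L]) (e ^+ 2) <= \int[mu]_(x in `[a, a + L]) (u x ^+ 2).
  apply: le_Rintegral => //.
    apply: continuous_compact_integrable; first exact: segment_compact.
    exact: continuous_subspaceT (fun x => cvg_cst _).
  by move=> x /=; rewrite in_itv/= => /andP[ax _]; exact: ue.
rewrite Rintegral_cst_itv; last by rewrite lerDl ltW.
rewrite addrAC subrr add0r.
rewrite /L mulrCA divff ?mulr1; last by rewrite expf_neq0// gt_eqF.
by move=> h1 h2; have := le_trans h1 h2; rewrite leNgt ltrDl ltr01.
Qed.

(** The derivative of [u ^+ 2] is bounded by the integrable function [2 * |u| * |g|], so [u ^+ 2]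
    varies little far out, and [H1_edge_small] supplies a far point where it is small. *)
Lemma H1_edge_decay e : 0 < e -> exists2 X, 0 <= X & forall y, X <= y -> `|u y| <= e.
Proof.
move=> e0.
pose h t := 2 * `|u t| * `|g t|.
have ih : mu.-integrable (edge_dom None) (EFin \o h).
  have := integrable_scale 2 (measurable_edge_dom None) (H1_edge_integrable_mul H).
  by apply: eq_integrable; [exact: measurable_edge_dom|move=> x _ /=; rewrite mulrA].
have h0 t : 0 <= h t by rewrite !mulr_ge0.
pose A y := \int[mu]_(t in `[0, y]) h t.
have ihS x y : 0 <= x -> 0 <= y -> mu.-integrable `[x, y] (EFin \o h).
  move=> x0 y0; apply: integrableS ih => //; first exact: measurable_edge_dom.
  by apply: edge_dom_sub => //; exact: D0.
have AB x y : 0 <= x -> x <= y -> A y - A x = \int[mu]_(t in `[x, y]) h t.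
  move=> x0 xy; rewrite /A (Rintegral_itv_cat x0 xy); first by ring.
  by apply: ihS => //; exact: le_trans xy.
have step x y : 0 <= x -> x <= y -> `|u y ^+ 2 - u x ^+ 2| <= A y - A x.
  move=> x0 xy; have y0 := le_trans x0 xy; rewrite AB//.
  have [M hM] := H1_edge_bounded H (D0 y0).
  apply: (chain_rule_le (M := M) (Phi := fun s => s ^+ 2) (psi := fun s => 2 * `|s|)
     xy (H1_edge_integrable H x0 (D0 y0)) _ _ _ _ _).2.
  - move=> z /andP[xz zy]; apply: (H1_edge_primitive H) => //.
    by apply: D0; exact: le_trans xz.
  - by move=> z /andP[xz zy]; apply: hM; rewrite zy (le_trans x0 xz).
  - move=> s; apply: cvgM; [exact: cvg_cst|exact: cvg_norm].
  - by move=> s; rewrite mulr_ge0.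
  - by move=> p q _ pq _; exact: sqr_mean_value.
have Amono x y : 0 <= x -> x <= y -> A x <= A y.
  by move=> x0 xy; rewrite -subr_ge0 (le_trans _ (step _ _ x0 xy)).
pose S := [set A x | x in [set x | 0 <= x]].
have ubS : has_ubound S.
  exists (\int[mu]_(t in edge_dom None) h t) => _ [y /= y0 <-].
  rewrite /Rintegral fine_le//.
  - by apply: integrable_fin_num => //; exact: ihS.
  - apply: integrable_fin_num => //; exact: measurable_edge_dom.
  - apply: ge0_subset_integral => //.
    + exact: measurable_edge_dom.
    + exact: (measurable_int mu ih).
    + by move=> t _; rewrite lee_fin.
    + by apply: edge_dom_sub => //; exact: D0.
have hS : has_sup S by split=> //; exists (A 0), 0 => //=.
have e20 : 0 < e ^+ 2 / 2 by rewrite divr_gt0 ?exprn_gt0.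
have [_ [X /= X0 <-] hX] := sup_adherent e20 hS.
have e2 : 0 < e / 2 by rewrite divr_gt0.
have [X' XX' [X'0 uX']] := H1_edge_small X e2.
exists X' => // y Xy.
have AX : A X <= A X' by exact: Amono.
have Ay : A y <= sup S by apply: ub_le_sup => //; exists y => //=; exact: le_trans Xy.
have st := step X' y X'0 Xy.
have uy2 : u y ^+ 2 <= e ^+ 2.
  have u2 : u X' ^+ 2 <= e ^+ 2 / 4.
    rewrite -(real_normK (num_real (u X'))).
    have -> : e ^+ 2 / 4 = (e / 2) ^+ 2 by field.
    by apply: lerXn2r; rewrite ?nnegrE ?divr_ge0 ?(ltW e0) ?(ltW uX').
  move: (ler_norm (u y ^+ 2 - u X' ^+ 2)) st hX u2 AX Ay (sqr_ge0 e).
  move: (u y ^+ 2) (u X' ^+ 2) `|_| (A y) (A X') (A X) (sup S) (e ^+ 2) => {}*; lra.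
by rewrite -(@ler_pXn2r _ 2) ?nnegrE ?(ltW e0)// real_normK ?num_real.
Qed.

End halfline.

(** On a halfline, decay below one nonzero value of [|u|] reduces the search to a compact
    segment. *)
Lemma H1_edge_max (l : option R) (u g : R -> R) :
  (if l is Some l then 0 < l else true) -> H1_edge (edge_dom l) u g ->
  exists2 x, edge_dom l x & forall y, edge_dom l y -> `|u y| <= `|u x|.
Proof.
move=> l0 H.
have seg y : edge_dom l y -> exists2 x, edge_dom l x & forall z, 0 <= z <= y -> `|u z| <= `|u x|.
  move=> Dy; have y0 := edge_dom_ge0 Dy.
  have cu : {within `[0, y], continuous (fun x => `|u x|)}.
    by move=> x; apply: cvg_norm; exact: (H1_edge_continuous H (lexx 0) y0 Dy).
  have [c + hc] := EVT_max y0 cu; rewrite in_itv/= => /andP[c0 cy].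
  exists c; first exact: edge_dom_le cy.
  by move=> z zy; apply: hc; rewrite in_itv.
case: l l0 H seg => [l|] l0 H seg.
  have [|x Dx hx] := seg l; first by rewrite edge_domE lexx ltW.
  by exists x => // y; rewrite edge_domE => yl; exact: hx.
have [[x x0 ux]|nex] := pselect (exists2 x, 0 <= x & u x != 0); last first.
  exists 0; first by rewrite edge_domE lexx.
  move=> y /edge_dom_ge0 y0; have [->|uy] := eqVneq (u y) 0; first by rewrite normr0.
  by exfalso; apply: nex; exists y.
have ux0 : 0 < `|u x| by rewrite normr_gt0.
have [X X0 hX] := H1_edge_decay H ux0.
have XxD : edge_dom None (Num.max X x) by rewrite edge_domE le_max X0.
have [z Dz hz] := seg _ XxD; exists z => // y /edge_dom_ge0 y0.
have [yX|Xy] := leP y X; first by apply: hz; rewrite y0 le_max yX.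
apply: (le_trans (hX _ (ltW Xy))); apply: hz.
by rewrite x0 le_max lexx orbT.
Qed.

End EdgeMax.

(** * Derivative rules in pointwise form *)

Section DerivativeRules.
Context {R : realType}.
Implicit Types (f g : R -> R) (x a b c : R).

Lemma is_derive_addf f g x a b : is_derive x 1 f a -> is_derive x 1 g b ->
  is_derive x 1 (fun y => f y + g y) (a + b).
Proof. by move=> df dg; exact: is_deriveD. Qed.

Lemma is_derive_subf f g x a b : is_derive x 1 f a -> is_derive x 1 g b ->
  is_derive x 1 (fun y => f y - g y) (a - b).
Proof. by move=> df dg; exact: is_deriveB. Qed.

Lemma is_derive_oppf f x a : is_derive x 1 f a -> is_derive x 1 (fun y => - f y) (- a).
Proof. by move=> df; exact: is_deriveN. Qed.

Lemma is_derive_mulf f g x a b : is_derive x 1 f a -> is_derive x 1 g b ->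
  is_derive x 1 (fun y => f y * g y) (a * g x + f x * b).
Proof.
move=> df dg; have := @is_deriveM _ _ f g x 1 a b df dg.
by move=> /is_derive_eq; apply; rewrite /GRing.scale/=; ring.
Qed.

Lemma is_derive_constf c x : is_derive x 1 (fun=> c) 0.
Proof. exact: is_derive_cst. Qed.

Lemma is_derive_scalef c f x a : is_derive x 1 f a ->
  is_derive x 1 (fun y => c * f y) (c * a).
Proof.
move=> df; apply: is_derive_eq (is_derive_mulf (is_derive_constf c x) df) _.
by rewrite mul0r add0r.
Qed.

Lemma is_derive_expf n f x a : is_derive x 1 f a ->
  is_derive x 1 (fun y => f y ^+ n.+1) (n.+1%:R * f x ^+ n * a).
Proof.
move=> df; elim: n => [|n IH].
  by apply: is_derive_eq df _; rewrite expr0 !mul1r.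
have -> : (fun y => f y ^+ n.+2) = (fun y => f y * f y ^+ n.+1).
  by apply/funext => y; rewrite exprS.
apply: is_derive_eq (is_derive_mulf df IH) _.
by rewrite -[n.+2]addn1 natrD exprS; ring.
Qed.

Lemma is_derive_compf f g x a b : is_derive (g x) 1 f a -> is_derive x 1 g b ->
  is_derive x 1 (fun y => f (g y)) (a * b).
Proof. by move=> df dg; exact: is_derive1_comp. Qed.

Lemma is_derive_invf f x a : f x != 0 -> is_derive x 1 f a ->
  is_derive x 1 (fun y => (f y)^-1) (- a / f x ^+ 2).
Proof.
move=> fx0 df; have := is_deriveV fx0 df.
by move=> /is_derive_eq; apply; rewrite /GRing.scale/=; field.
Qed.

Lemma is_derive_sqrtf f x a : 0 < f x -> is_derive x 1 f a ->
  is_derive x 1 (fun y => Num.sqrt (f y)) (a / (2 * Num.sqrt (f x))).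
Proof.
move=> fx0 df; have := is_derive_compf (is_derive1_sqrt fx0) df.
by move=> /is_derive_eq; apply; rewrite mulrC.
Qed.

Lemma is_derive_continuous f x a : is_derive x 1 f a -> {for x, continuous f}.
Proof. by move=> df; apply/differentiable_continuous/derivable1_diffP; exact: ex_derive. Qed.

Lemma mean_value_le f (df psi : R -> R) p q : p < q ->
  (forall x, p < x < q -> is_derive x 1 f (df x)) ->
  {within `[p, q], continuous f} ->
  (forall x, p < x < q -> `|df x| <= psi x) ->
  exists2 s, p <= s <= q & `|f q - f p| <= psi s * (q - p).
Proof.
move=> pq d cf le_.
have d' x : x \in `]p, q[ -> is_derive x 1 f (df x) by rewrite in_itv/=; exact: d.
have [s] := MVT pq d' cf.
rewrite in_itv/= => /[dup] spq /andP[ps sq] ->; exists s; first by rewrite !ltW.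
rewrite normrM (@ger0_norm _ (q - p)); last by rewrite subr_ge0 ltW.
by rewrite ler_wpM2r ?le_// subr_ge0 ltW.
Qed.

End DerivativeRules.

(** * The weight of the trail inequality and its primitive *)

Section TrailPrimitive.
Context {R : realType}.
Variable M : R.
Hypothesis M0 : 0 < M.

Let r (s : R) := Num.sqrt (M ^+ 4 - s ^+ 4).

(** For [|s| <= M] its square is [M ^+ 4 * s ^+ 2 - s ^+ 6], so squaring it produces exactly the
    mass and the sixth power norm. *)
Definition gn_weight (s : R) := `|s| * Num.sqrt (M ^+ 4 - s ^+ 4).

(* A primitive of s * sqrt (M ^ 4 - s ^ 4); the arctangent form of the arcsine
   is continuous up to the end points s = M and s = - M. *)
Definition gn_prim (s : R) :=
  4^-1 * (s ^+ 2 * Num.sqrt (M ^+ 4 - s ^+ 4) +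
    2 * M ^+ 4 * atan (s ^+ 2 * (M ^+ 2 + Num.sqrt (M ^+ 4 - s ^+ 4))^-1)).

Let X_gt0 s : 0 < M ^+ 2 + r s.
Proof. by rewrite ltr_pwDl ?exprn_gt0 ?sqrtr_ge0. Qed.

Lemma continuous_sqrt_gap : continuous (fun s : R => Num.sqrt (M ^+ 4 - s ^+ 4)).
Proof.
move=> s; apply: (@continuous_comp _ _ _ (fun s : R => M ^+ 4 - s ^+ 4) Num.sqrt).
  by apply: (is_derive_continuous (is_derive_subf (is_derive_constf _ _) (is_derive_expf 3 (is_derive_id s 1)))).
exact: sqrt_continuous.
Qed.

Lemma continuous_gn_weight : continuous gn_weight.
Proof. by move=> s; apply: cvgM; [exact: cvg_norm|exact: continuous_sqrt_gap]. Qed.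

Lemma gn_weight_ge0 s : 0 <= gn_weight s.
Proof. by rewrite mulr_ge0// sqrtr_ge0. Qed.

Lemma gn_weight_le s : gn_weight s <= M ^+ 2 * `|s|.
Proof.
rewrite /gn_weight mulrC ler_wpM2r//.
have -> : M ^+ 2 = Num.sqrt (M ^+ 4).
  by rewrite (_ : M ^+ 4 = (M ^+ 2) ^+ 2) ?sqrtr_sqr ?ger0_norm ?exprn_ge0 ?ltW// -exprM.
rewrite ler_wsqrtr// gerBl.
by rewrite (_ : s ^+ 4 = (s ^+ 2) ^+ 2) ?sqr_ge0// -exprM.
Qed.

Lemma continuous_gn_prim : continuous gn_prim.
Proof.
have csq : continuous (fun s : R => s ^+ 2) by exact: exprn_continuous.
move=> s; apply: cvgM; first exact: cvg_cst.
apply: cvgD; first by apply: cvgM; [exact: csq|exact: continuous_sqrt_gap].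
apply: cvgM; first exact: cvg_cst.
apply: (@continuous_comp _ _ _ (fun s : R => s ^+ 2 * (M ^+ 2 + Num.sqrt (M ^+ 4 - s ^+ 4))^-1) atan).
  apply: cvgM; first exact: csq.
  apply: cvgV; first by rewrite gt_eqF// X_gt0.
  by apply: cvgD; [exact: cvg_cst|exact: continuous_sqrt_gap].
exact: continuous_atan.
Qed.

Lemma is_derive_gn_prim s : - M < s < M ->
  is_derive s 1 gn_prim (s * Num.sqrt (M ^+ 4 - s ^+ 4)).
Proof.
move=> sM.
have s4 : s ^+ 4 < M ^+ 4.
  have -> : s ^+ 4 = `|s| ^+ 4 by rewrite -normrX ger0_norm ?exprn_even_ge0.
  by rewrite ltr_pXn2r ?nnegrE ?(ltW M0)// ltr_norml.
have gap : 0 < M ^+ 4 - s ^+ 4 by rewrite subr_gt0 s4.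
have r0 : 0 < r s by rewrite sqrtr_gt0.
have rr : r s ^+ 2 = M ^+ 4 - s ^+ 4 by rewrite sqr_sqrtr// ltW.
have dgap : is_derive s 1 (fun s : R => M ^+ 4 - s ^+ 4) (- (4 * s ^+ 3)).
  apply: is_derive_eq (is_derive_subf (is_derive_constf _ _) (is_derive_expf 3 (is_derive_id s 1))) _.
  by rewrite mulr1 sub0r.
have dr := is_derive_sqrtf (f := fun s : R => M ^+ 4 - s ^+ 4) gap dgap.
have dsq : is_derive s 1 (fun s : R => s ^+ 2) (2 * s).
  by apply: is_derive_eq (is_derive_expf 1 (is_derive_id s 1)) _; rewrite expr1 mulr1.
have dX := is_derive_addf (is_derive_constf (M ^+ 2) s) dr.
have dq := is_derive_mulf dsq (is_derive_invf (f := fun s : R => M ^+ 2 + r s) (lt0r_neq0 (X_gt0 s)) dX).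
have dat := is_derive_compf (is_derive1_atan _) dq.
have := is_derive_scalef 4^-1 (is_derive_addf (is_derive_mulf dsq dr) (is_derive_scalef (2 * M ^+ 4) dat)).
move=> /is_derive_eq; apply; rewrite -/(r s).
have X0 := lt0r_neq0 (X_gt0 s); have r0' := lt0r_neq0 r0; have M0' := lt0r_neq0 M0.
(* Half-angle formula: with s ^ 2 = M ^ 2 sin a and r = M ^ 2 cos a, the argument of the arctangent
   is tan (a / 2). *)
have -> : (1 + (s ^+ 2 / (M ^+ 2 + r s)) ^+ 2)^-1 = (M ^+ 2 + r s) / (2 * M ^+ 2).
  have : (M ^+ 2 + r s) ^+ 2 + s ^+ 4 = 2 * M ^+ 2 * (M ^+ 2 + r s) by ring: rr.
  move=> E; apply: (@mulfI _ (2 * M ^+ 2 / (M ^+ 2 + r s))).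
    by rewrite !mulf_neq0 ?invr_eq0 ?expf_neq0.
  have -> : 1 + (s ^+ 2 / (M ^+ 2 + r s)) ^+ 2 = 2 * M ^+ 2 / (M ^+ 2 + r s).
    have -> : 2 * M ^+ 2 / (M ^+ 2 + r s) = (2 * M ^+ 2 * (M ^+ 2 + r s)) / (M ^+ 2 + r s) ^+ 2 by field.
    by rewrite -E; field.
  by field; rewrite M0' X0.
by field: rr; rewrite M0' X0 r0'.
Qed.

Lemma gn_prim_mean_value p q : - M <= p -> p < q -> q <= M ->
  exists2 s, p <= s <= q & `|gn_prim q - gn_prim p| <= gn_weight s * (q - p).
Proof.
move=> pM pq qM; apply: (@mean_value_le R gn_prim (fun s => s * r s) gn_weight p q pq).
- move=> x /andP[px xq]; apply: is_derive_gn_prim.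
  by rewrite (le_lt_trans pM px) (lt_le_trans xq qM).
- apply: continuous_subspaceT; exact: continuous_gn_prim.
- by move=> x _; rewrite normrM (@ger0_norm _ (r x)) ?sqrtr_ge0.
Qed.

Lemma gn_prim0 : gn_prim 0 = 0.
Proof. by rewrite /gn_prim !expr0n /= !mul0r atan0 mulr0 addr0 mulr0. Qed.

(** The height climbed by the primitive between infinity and the maximum; the [pi] of the sharp
    constant enters here, through [atan 1]. *)
Lemma gn_primM : gn_prim M = pi / 8 * M ^+ 4.
Proof.
rewrite /gn_prim subrr sqrtr0 addr0 mulr0 add0r divff ?expf_neq0 ?gt_eqF// atan1.
by field.
Qed.

Lemma gn_primN s : gn_prim (- s) = gn_prim s.
Proof. by rewrite /gn_prim sqrrN (_ : (- s) ^+ 4 = s ^+ 4) //; ring. Qed.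

End TrailPrimitive.

(** * Variation along a trail *)

Section GraphBasics.
Context {R : realType}.
Notation mu := (@lebesgue_measure R).
Variable G : mgraph R.
Implicit Types (e : 'I_(nE G)) (p q : gpoint G).

Definition edge_len e : option R := if gtl G e is Some _ then Some (glen G e) else None.

Lemma edomE e : edom e = edge_dom (edge_len e).
Proof. by rewrite /edom /edge_dom /edge_len; case: (gtl G e). Qed.

Lemma edge_len_gt0 e : if edge_len e is Some l then 0 < l else true.
Proof. by rewrite /edge_len; case: (gtl G e) => // _; exact: glen_gt0. Qed.

Lemma in_domE p : in_dom p = edge_dom (edge_len p.1) p.2 :> Prop.
Proof. by rewrite edge_domE /in_dom /edge_len; case: (gtl G p.1). Qed.

Lemma in_dom0 e : in_dom (e, 0).
Proof. by rewrite /in_dom/= lexx/=; case: (gtl G e) => // _; exact/ltW/glen_gt0. Qed.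

Lemma in_dom_len e : in_dom (e, glen G e).
Proof. by rewrite /in_dom/= ltW ?glen_gt0//=; case: (gtl G e). Qed.

Lemma vtx_of0 e : vtx_of (e, 0) = Some (ghd G e).
Proof. by rewrite /vtx_of eqxx. Qed.

Lemma vtx_of_len e w : gtl G e = Some w -> vtx_of (e, glen G e) = Some w.
Proof. by move=> ew; rewrite /vtx_of/= gt_eqF ?glen_gt0// ew eqxx. Qed.

Lemma vtx_ofP p v : vtx_of p = Some v ->
  (p.2 = 0 /\ v = ghd G p.1) \/ (p.2 = glen G p.1 /\ gtl G p.1 = Some v).
Proof.
rewrite /vtx_of; case: eqP => [-> [<-]|_]; first by left.
by case: (gtl G p.1) => // w; case: eqP => // -> [->]; right.
Qed.

Lemma same_pt_refl p : same_pt p p.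
Proof. by rewrite /same_pt eqxx. Qed.

Lemma same_pt_sym p q : same_pt p q -> same_pt q p.
Proof.
rewrite /same_pt => /orP[/eqP->|/andP[h /eqP pq]]; first by rewrite eqxx.
by rewrite -pq h eqxx orbT.
Qed.

Lemma same_pt_trans p q s : same_pt p q -> same_pt q s -> same_pt p s.
Proof.
rewrite /same_pt => /orP[/eqP->//|/andP[h /eqP pq]] /orP[/eqP<-|/andP[_ /eqP <-]].
  by rewrite h pq eqxx orbT.
by rewrite h pq eqxx orbT.
Qed.

Lemma same_pt_vtx p q v : vtx_of p = Some v -> vtx_of q = Some v -> same_pt p q.
Proof. by rewrite /same_pt => -> ->; rewrite eqxx orbT. Qed.

(** A vertex may be visited by the trail while [p] represents it on an edge outside the trail. Then
    [p] is replaced by the end of a trail edge at the same vertex. *)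
Lemma on_trailP p s0 ss : in_dom p -> on_trail p s0 ss ->
  exists q, [/\ in_dom q, same_pt p q & q.1 \in map fst (s0 :: ss)].
Proof.
move=> pd [pin|[v [pv /hasP[s sin sv]]]].
  by exists p; rewrite same_pt_refl.
have s1 : s.1 \in map fst (s0 :: ss) by apply/mapP; exists s.
have [hv|tv] : Some (ghd G s.1) = Some v \/ gtl G s.1 = Some v.
  by move: sv; rewrite /step_ends; case: (s.2) => /= /orP[] /eqP; auto.
- exists (s.1, 0); rewrite in_dom0; split => //.
  by apply: same_pt_vtx pv _; rewrite vtx_of0.
- exists (s.1, glen G s.1); rewrite in_dom_len; split => //.
  by apply: same_pt_vtx pv _; rewrite (vtx_of_len tv).
Qed.

Section H1.
Variables u g : 'I_(nE G) -> R -> R.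
Hypothesis H : H1 u g.

Lemma H1_edgeP e : H1_edge (edge_dom (edge_len e)) (u e) (g e).
Proof. by case: H => [iu [ig [ac _]]]; rewrite -edomE; split; [exact: iu|exact: ig|exact: ac]. Qed.

Lemma H1_same_pt p q : same_pt p q -> u p.1 p.2 = u q.1 q.2.
Proof.
case: H => [_ [_ [_ [phi hphi]]]].
have val a v : vtx_of a = Some v -> u a.1 a.2 = phi v.
  by move=> /vtx_ofP[[-> ->]|[-> av]]; case: (hphi a.1) => // _; apply.
case/orP => [/eqP->//|/andP[+ /eqP pq]].
by case E : (vtx_of p) pq => [v|//] pq _; rewrite (val _ _ E) (val q v).
Qed.

Lemma H1_max : noncompact G -> exists2 p, in_dom p &
  forall q, in_dom q -> `|u q.1 q.2| <= `|u p.1 p.2|.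
Proof.
move=> [e0 _].
have /choice[x hx] e : exists x, edge_dom (edge_len e) x /\
    forall y, edge_dom (edge_len e) y -> `|u e y| <= `|u e x|.
  by have [x] := H1_edge_max (edge_len_gt0 e) (H1_edgeP e); exists x.
have [i _ hi] := @arg_maxP _ _ _ e0 predT (fun e => `|u e (x e)|) isT.
exists (i, x i); first by rewrite in_domE; case: (hx i).
move=> [e y]; rewrite in_domE /= => Dy.
by apply: le_trans (hi e isT); case: (hx e) => _; apply.
Qed.

Section trail_energy.
Variables (M : R).
Hypothesis M0 : 0 < M.
Hypothesis uM : forall q, in_dom q -> `|u q.1 q.2| <= M.

Let W e := \int[mu]_(t in edge_dom (edge_len e)) (gn_weight M (u e t) * `|g e t|).

Let uMe e x : edge_dom (edge_len e) x -> `|u e x| <= M.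
Proof. by move=> Dx; apply: (uM (q := (e, x))); rewrite in_domE. Qed.

Lemma integrable_gn_weight e :
  mu.-integrable (edge_dom (edge_len e)) (EFin \o (fun t => gn_weight M (u e t) * `|g e t|)).
Proof.
apply: (H1_edge_integrable_chain (M := M) (C := M ^+ 2) (H1_edgeP e) (@uMe e)).
- exact: continuous_gn_weight.
- exact: gn_weight_ge0.
- by move=> s _; exact: gn_weight_le.
Qed.

Let chain e x y : 0 <= x -> x <= y -> edge_dom (edge_len e) y ->
  `|gn_prim M (u e x) - gn_prim M (u e 0)| + `|gn_prim M (u e y) - gn_prim M (u e x)| <= W e.
Proof.
apply: (H1_edge_chain2 (M := M) (C := M ^+ 2) (H1_edgeP e) (@uMe e)).
- exact: continuous_gn_weight.
- exact: gn_weight_ge0.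
- by move=> s _; exact: gn_weight_le.
- by move=> p q; exact: gn_prim_mean_value.
Qed.

Variable phi : 'I_(nV G) -> R.
Hypothesis hphi : forall e, u e 0 = phi (ghd G e) /\
  forall w, gtl G e = Some w -> u e (glen G e) = phi w.

(** The value 0 at infinity is the limit of [gn_prim M (u e y)] along a halfline. *)
Let Psi (o : option 'I_(nV G)) := if o is Some v then gn_prim M (phi v) else 0.

(** On a halfline the second leg is cut at a far point where [u] is small, and continuity of
    [gn_prim] at 0 makes the missing piece arbitrarily small. *)
Lemma edge_variation e x : edge_dom (edge_len e) x ->
  `|gn_prim M (u e x) - Psi (Some (ghd G e))| + `|Psi (gtl G e) - gn_prim M (u e x)| <= W e.
Proof.
move=> Dx; have x0 := edge_dom_ge0 Dx; have [h0 hl] := hphi e.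
rewrite /= -h0; case E : (gtl G e) => [w|] /=.
  rewrite -(hl w E); apply: chain => //.
    by move: Dx; rewrite edge_domE /edge_len E => /andP[].
  by rewrite edge_domE /edge_len E lexx ltW// glen_gt0.
apply/ler_addgt0Pr => d d0.
have := @continuous_gn_prim R M M0 0; rewrite /continuous_at gn_prim0.
move=> /cvgrPdist_lt /(_ d d0)[d' /= d'0 hd'].
have HN : H1_edge (edge_dom None) (u e) (g e).
  by have := H1_edgeP e; rewrite /edge_len E.
have [y xy [y0 uy]] := H1_edge_small HN x d'0.
have := hd' (u e y); rewrite /ball_/= !sub0r !normrN => /(_ uy) hy.
have Dy : edge_dom (edge_len e) y by rewrite edge_domE /edge_len E y0.
have := chain x0 xy Dy.
have := ler_distD (gn_prim M (u e y)) (gn_prim M (u e x)) 0.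
rewrite !subr0 (distrC (gn_prim M (u e x)) (gn_prim M (u e y))).
by move: `|_ - gn_prim M (u e 0)| `|_ - _| `|_| `|_| hy => {}*; lra.
Qed.

Let adj (a b : 'I_(nE G) * bool) :=
  ((step_ends a).2 == (step_ends b).1) && ((step_ends a).2 != None).

Let step_variation s x : edge_dom (edge_len s.1) x ->
  `|gn_prim M (u s.1 x) - Psi (step_ends s).1| + `|Psi (step_ends s).2 - gn_prim M (u s.1 x)| <= W s.1.
Proof.
move=> /edge_variation; rewrite /step_ends; case: (s.2) => //=.
by rewrite addrC [`|gn_prim _ _ - _|]distrC [`|_ - gn_prim _ (u _ _)|]distrC.
Qed.

(** The first bound descends from the entry to infinity. The second goes from the entry up to a
    point and then down to infinity. Both are needed in one induction, since a point on the first
    edge uses the first bound for the remaining walk. *)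
Let walk_variation s ss : path adj s ss -> (step_ends (last s ss)).2 == None ->
  Psi (step_ends s).1 <= \sum_(t <- s :: ss) W t.1 /\
  forall t x, t \in s :: ss -> edge_dom (edge_len t.1) x ->
    2 * gn_prim M (u t.1 x) <= Psi (step_ends s).1 + \sum_(t <- s :: ss) W t.1.
Proof.
elim: ss s => [|s' ss IH] s /=.
  move=> _ /eqP send; rewrite big_seq1; split.
    have D0 : edge_dom (edge_len s.1) 0 by have := in_dom0 s.1; rewrite in_domE.
    have := step_variation D0; rewrite send /= sub0r normrN.
    have := ler_norm (- (gn_prim M (u s.1 0) - Psi (step_ends s).1)); rewrite normrN.
    have := ler_norm (gn_prim M (u s.1 0)).
    by move: `|_ - _| `|_| => a b; lra.
  move=> t x; rewrite inE => /eqP-> /step_variation; rewrite send /= sub0r normrN.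
  have := ler_norm (gn_prim M (u s.1 x) - Psi (step_ends s).1).
  have := ler_norm (gn_prim M (u s.1 x)).
  by move: `|_ - _| `|_| => a b; lra.
case/andP => /andP[/eqP ss' _] pth lst; have [IH1 IH2] := IH _ pth lst.
rewrite big_cons; move: IH1 IH2; set S := \sum_(t <- _) _ => IH1 IH2.
have key x : edge_dom (edge_len s.1) x ->
    Psi (step_ends s).1 - gn_prim M (u s.1 x) <= `|gn_prim M (u s.1 x) - Psi (step_ends s).1| /\
    gn_prim M (u s.1 x) - Psi (step_ends s).1 <= `|gn_prim M (u s.1 x) - Psi (step_ends s).1| /\
    Psi (step_ends s').1 - gn_prim M (u s.1 x) <= `|Psi (step_ends s).2 - gn_prim M (u s.1 x)| /\
    gn_prim M (u s.1 x) - Psi (step_ends s').1 <= `|Psi (step_ends s).2 - gn_prim M (u s.1 x)|.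
  move=> Dx; rewrite ss'; split; first by rewrite distrC ler_norm.
  by split; [|split]; rewrite ?ler_norm// distrC ler_norm.
have D0 : edge_dom (edge_len s.1) 0 by have := in_dom0 s.1; rewrite in_domE.
have [k1 [k2 [k3 k4]]] := key 0 D0; have sv := step_variation D0.
have abs_ : Psi (step_ends s).1 <= W s.1 + Psi (step_ends s').1 /\
            Psi (step_ends s').1 <= W s.1 + Psi (step_ends s).1.
  move: k1 k2 k3 k4 sv; move: `|_ - _| `|_ - _| => a b; lra.
split; first by case: abs_; lra.
move=> t x; rewrite inE => /orP[/eqP-> Dx|tin Dx]; last first.
  by have := IH2 t x tin Dx; case: abs_; lra.
have := step_variation Dx; have [+ [+ [+ +]]] := key x Dx.
by move: `|_ - _| `|_ - _| => a b; lra.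
Qed.

(** The trail comes from infinity, so its entry term is 0. As its edges are distinct, the sum over
    its steps is part of the sum over all edges. *)
Lemma trail_variation s0 ss p : trail2 s0 ss -> in_dom p -> on_trail p s0 ss ->
  2 * gn_prim M (u p.1 p.2) <= \sum_(e < nE G) W e.
Proof.
move=> /and4P[pth unq /eqP s0N lst] pd /(on_trailP pd)[q [qd pq qin]].
rewrite (H1_same_pt pq); move: qin => /mapP[t tin tq].
have [_ /(_ t q.2 tin)] := walk_variation pth lst.
rewrite s0N /= add0r -tq -in_domE => /(_ qd) /le_trans; apply.
rewrite -(big_map fst predT W) -[X in \sum_(_ <- X | _) _]/(map fst (s0 :: ss)).
rewrite big_uniq//= [leRHS](bigID (mem (map fst (s0 :: ss))))/= lerDl.
apply: sumr_ge0 => e _; apply: Rintegral_ge0 => x _.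
by rewrite mulr_ge0// gn_weight_ge0.
Qed.

End trail_energy.
End H1.
End GraphBasics.

(** * The sharp Gagliardo-Nirenberg inequality on a graph *)

Section GagliardoNirenberg.
Context {R : realType}.
Notation mu := (@lebesgue_measure R).
Variable G : mgraph R.
Variables u g : 'I_(nE G) -> R -> R.
Hypothesis H : H1 u g.

Lemma normk2E (f : 'I_(nE G) -> R -> R) :
  normk 2 f = \sum_(e < nE G) \int[mu]_(x in edge_dom (edge_len e)) (f e x ^+ 2).
Proof.
apply: eq_bigr => e _; rewrite edomE; congr fine; apply: eq_integral => x _.
by rewrite real_normK ?num_real.
Qed.

Lemma normk6E (f : 'I_(nE G) -> R -> R) :
  normk 6 f = \sum_(e < nE G) \int[mu]_(x in edge_dom (edge_len e)) (f e x ^+ 6).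
Proof.
apply: eq_bigr => e _; rewrite edomE; congr fine; apply: eq_integral => x _.
by rewrite -normrX ger0_norm// exprn_even_ge0.
Qed.

Lemma normk_ge0 k (f : 'I_(nE G) -> R -> R) : 0 <= normk k f.
Proof.
by apply: sumr_ge0 => e _; apply: Rintegral_ge0 => x _; rewrite exprn_ge0.
Qed.

Section defect.
Variable M : R.
Hypothesis M0 : 0 < M.
Hypothesis uM : forall q : gpoint G, in_dom q -> `|u q.1 q.2| <= M.

Let D (e : 'I_(nE G)) := edge_dom (edge_len e).
Let mD e : measurable (D e). Proof. exact: measurable_edge_dom. Qed.

Let uMe e x : D e x -> `|u e x| <= M.
Proof. by move=> Dx; apply: (uM (q := (e, x))); rewrite in_domE. Qed.

Let mu_ e : measurable_fun (D e) (u e).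
Proof. exact: H1_edge_measurable (H1_edgeP H e). Qed.

Let iu2 e : mu.-integrable (D e) (EFin \o (fun x => u e x ^+ 2)).
Proof. by case: (H1_edgeP H e). Qed.

Let ig2 e : mu.-integrable (D e) (EFin \o (fun x => g e x ^+ 2)).
Proof. by case: (H1_edgeP H e). Qed.

Lemma integrable_u6 e : mu.-integrable (D e) (EFin \o (fun x => u e x ^+ 6)).
Proof.
have m4 : measurable_fun (D e) (fun x => u e x ^+ 4) by exact: measurable_funX.
have le4 x : D e x -> `|u e x ^+ 4| <= M ^+ 4.
  by move=> Dx; rewrite normrX lerXn2r ?nnegrE ?(ltW M0)// uMe.
apply: (eq_integrable (mD e)) (integrable_mul_bounded (mD e) m4 le4 (iu2 e)).
by move=> x _ /=; rewrite -exprD.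
Qed.

(** Expansion of the square; the bound [|u| <= M] keeps the square root in [gn_weight] genuine. *)
Lemma gn_defect_edge (c : R) (e : 'I_(nE G)) :
  mu.-integrable (D e) (EFin \o (fun x => (2 * `|g e x| - c * gn_weight M (u e x)) ^+ 2)) /\
  \int[mu]_(x in D e) (2 * `|g e x| - c * gn_weight M (u e x)) ^+ 2 =
  4 * \int[mu]_(x in D e) (g e x ^+ 2)
  - 4 * c * \int[mu]_(x in D e) (gn_weight M (u e x) * `|g e x|)
  + c ^+ 2 * (M ^+ 4 * \int[mu]_(x in D e) (u e x ^+ 2) - \int[mu]_(x in D e) (u e x ^+ 6)).
Proof.
have i1 := integrable_scale 4 (mD e) (ig2 e).
have i2 := integrable_scale (- (4 * c)) (mD e) (integrable_gn_weight H M0 uM e).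
have i3 := integrable_scale (c ^+ 2 * M ^+ 4) (mD e) (iu2 e).
have i4 := integrable_scale (- c ^+ 2) (mD e) (integrable_u6 e).
have i12 := integrable_add (mD e) i1 i2.
have i34 := integrable_add (mD e) i3 i4.
have E x : D e x -> (2 * `|g e x| - c * gn_weight M (u e x)) ^+ 2 =
   (4 * (g e x ^+ 2) + - (4 * c) * (gn_weight M (u e x) * `|g e x|)) +
   (c ^+ 2 * M ^+ 4 * u e x ^+ 2 + - c ^+ 2 * u e x ^+ 6).
  move=> Dx; rewrite /gn_weight.
  have s2 : Num.sqrt (M ^+ 4 - u e x ^+ 4) ^+ 2 = M ^+ 4 - u e x ^+ 4.
    rewrite sqr_sqrtr// subr_ge0 -(@ger0_norm _ (u e x ^+ 4)) ?exprn_even_ge0//.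
    by rewrite normrX lerXn2r ?nnegrE ?(ltW M0)// uMe.
  have u2 : `|u e x| ^+ 2 = u e x ^+ 2 by rewrite real_normK ?num_real.
  have g2 : `|g e x| ^+ 2 = g e x ^+ 2 by rewrite real_normK ?num_real.
  by ring: s2 u2 g2.
split.
  apply: (eq_integrable (mD e)) (integrable_add (mD e) i12 i34) => x.
  by rewrite inE => Dx /=; rewrite E.
rewrite (@eq_Rintegral _ _ _ mu _ (fun x => (4 * (g e x ^+ 2) + - (4 * c) * (gn_weight M (u e x) * `|g e x|)) +
   (c ^+ 2 * M ^+ 4 * u e x ^+ 2 + - c ^+ 2 * u e x ^+ 6))); last first.
  by move=> x; rewrite inE => Dx; exact: E.
rewrite RintegralD// RintegralD// RintegralD// !RintegralZl//.
- by ring.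
- exact: integrable_u6.
- exact: integrable_gn_weight.
Qed.

End defect.

(** The defect is stated with its [M] and [p0], beyond the inequality it implies, because the
    equality case needs that every edge integral of the square vanishes. *)
Lemma gn_defect : noncompact G -> assumptionH G -> 0 < normk 2 u ->
  exists M : R, exists p0 : gpoint G,
    [/\ 0 < M, in_dom p0, `|u p0.1 p0.2| = M,
       (forall q : gpoint G, in_dom q -> `|u q.1 q.2| <= M) &
    let c := pi / normk 2 u in
    \sum_(e < nE G) \int[mu]_(x in edge_dom (edge_len e))
        (2 * `|g e x| - c * gn_weight M (u e x)) ^+ 2
      <= 4 * normk 2 g - c ^+ 2 * normk 6 u].
Proof.
move=> ncG HG m0.
have [p0 p0d hp0] := H1_max H ncG.
exists `|u p0.1 p0.2|, p0; set M := `|u p0.1 p0.2|.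
have M0 : 0 < M.
  rewrite lt0r normr_ge0 andbT; apply/negP => /eqP M0.
  move: m0; rewrite normk2E big1 ?ltxx// => e _.
  rewrite (@eq_Rintegral _ _ _ mu _ (fun=> 0)).
    by rewrite /Rintegral integral0.
  move=> x; rewrite inE => Dx; apply/eqP; rewrite sqrf_eq0 -normr_le0.
  by rewrite -M0; apply: (hp0 (e, x)); rewrite in_domE.
split => // c.
(* This makes the mass term [c ^+ 2 * M ^+ 4 * normk 2 u] equal to [c * M ^+ 4 * pi], which is also
   the lower bound that the trail gives for [4 * c * W]; the two cancel. *)
have cE : c * normk 2 u = pi by rewrite /c divfK// gt_eqF.
have [s0 [ss [tr onp]]] := HG p0 p0d.
have [phi hphi] : exists phi : 'I_(nV G) -> R, forall e,
    u e 0 = phi (ghd G e) /\ forall w, gtl G e = Some w -> u e (glen G e) = phi w.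
  by case: H => _ [_ [_ [phi hphi]]]; exists phi.
have := trail_variation H M0 hp0 hphi tr p0d onp.
have -> : gn_prim M (u p0.1 p0.2) = pi / 8 * M ^+ 4.
  rewrite -(gn_primM M0) /M; case: (ger0P (u p0.1 p0.2)) => // _.
  by rewrite gn_primN.
set W := \sum_(e < nE G) _ => hW.
have -> : \sum_(e < nE G) \int[mu]_(x in edge_dom (edge_len e))
     (2 * `|g e x| - c * gn_weight M (u e x)) ^+ 2 =
   4 * normk 2 g - 4 * c * W + c ^+ 2 * (M ^+ 4 * normk 2 u - normk 6 u).
  rewrite (eq_bigr _ (fun e _ => (gn_defect_edge M0 hp0 c e).2)) big_split/= sumrB.
  rewrite -!mulr_sumr sumrB -mulr_sumr -!normk2E -normk6E //.
have : 4 * c * (2 * (pi / 8 * M ^+ 4)) <= 4 * c * W.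
  by rewrite ler_wpM2l// mulr_ge0// divr_ge0 ?pi_ge0 ?normk_ge0.
have -> : c ^+ 2 * (M ^+ 4 * normk 2 u - normk 6 u) = c * M ^+ 4 * pi - c ^+ 2 * normk 6 u.
  by rewrite -cE; ring.
have -> : 4 * c * (2 * (pi / 8 * M ^+ 4)) = c * M ^+ 4 * pi by field.
by move: (4 * c * W) (c * M ^+ 4 * pi) (c ^+ 2 * normk 6 u) (normk 2 g) => {}*; lra.
Qed.

Lemma gn_ineq : noncompact G -> assumptionH G -> 0 < normk 2 u ->
  pi ^+ 2 * normk 6 u <= 4 * normk 2 u ^+ 2 * normk 2 g.
Proof.
move=> ncG HG m0; have [M [p0 [_ _ _ _ /=]]] := gn_defect ncG HG m0.
set c := pi / _ => le_.
have : 0 <= 4 * normk 2 g - c ^+ 2 * normk 6 u.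
  apply: le_trans le_; apply: sumr_ge0 => e _; apply: Rintegral_ge0 => x _.
  exact: sqr_ge0.
rewrite subr_ge0 /c exprMn exprVn mulrAC ler_pdivrMr ?exprn_gt0//.
by rewrite [leRHS]mulrAC.
Qed.

End GagliardoNirenberg.

(** * Solitons *)

Section FTC.
Context {R : realType}.
Notation mu := (@lebesgue_measure R).
Implicit Types (F f : R -> R) (a b l : R).

Lemma integrable_continuous_itv f a b : continuous f -> mu.-integrable `[a, b] (EFin \o f).
Proof.
move=> cf; apply: continuous_compact_integrable; first exact: segment_compact.
exact: continuous_subspaceT.
Qed.

Lemma Rintegral_FTC F f a b : a <= b -> (forall x : R, is_derive x 1 F (f x)) -> continuous f ->
  \int[mu]_(x in `[a, b]) f x = F b - F a.
Proof.
rewrite le_eqVlt => /predU1P[<- _ _|ab dF cf].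
  by rewrite set_itv1 Rintegral_set1 subrr.
have cF : continuous F by move=> x; exact: is_derive_continuous (dF x).
rewrite /Rintegral (continuous_FTC2 (F := F) ab)//.
- exact: continuous_subspaceT.
- split; first by move=> x _; case: (dF x).
    exact/cvg_at_right_filter/cF.
  exact/cvg_at_left_filter/cF.
- by move=> x _; rewrite derive1E; case: (dF x).
Qed.

Lemma integral_FTCy F f a l : (forall x : R, 0 <= f x) -> (forall x : R, is_derive x 1 F (f x)) ->
  continuous f -> F x @[x --> +oo] --> l ->
  (\int[mu]_(x in `[a, +oo[) (f x)%:E = (l - F a)%:E)%E.
Proof.
move=> f0 dF cf Fl.
have cF : continuous F by move=> x; exact: is_derive_continuous (dF x).
rewrite (@ge0_continuous_FTC2y R f F a l)//.
- exact: continuous_subspaceT.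
- exact/cvg_at_right_filter/cF.
- by move=> x _; rewrite derive1E; case: (dF x).
Qed.

Lemma integral_even_FTC F f l : (forall x : R, 0 <= f x) -> (forall x : R, f (- x) = f x) ->
  (forall x : R, is_derive x 1 F (f x)) -> continuous f -> F x @[x --> +oo] --> l ->
  (\int[mu]_x (f x)%:E = (2 * (l - F 0))%:E)%E.
Proof.
move=> f0 fN dF cf Fl; rewrite ge0_symfun_integralT//; last by move=> x /=; rewrite fN.
have -> : [set x : R | 0 <= x] = `[0, +oo[%classic by apply/seteqP; split => x /=; rewrite in_itv/= andbT.
by rewrite (integral_FTCy _ f0 dF cf Fl) -EFinM.
Qed.

End FTC.

(** * The hyperbolic secant and the soliton *)

Section Sech.
Context {R : realType}.
Notation mu := (@lebesgue_measure R).
Implicit Types x : R.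

Definition sech x := 2 / (expR x + expR (- x)).
Definition tanh x := (expR x - expR (- x)) / (expR x + expR (- x)).

Let den_gt0 x : 0 < expR x + expR (- x).
Proof. by rewrite addr_gt0 ?expR_gt0. Qed.

Let den_neq0 x : expR x + expR (- x) != 0.
Proof. by rewrite gt_eqF. Qed.

Let expVe x : expR x * expR (- x) = 1.
Proof. exact: expRxMexpNx_1. Qed.

Lemma sech_gt0 x : 0 < sech x.
Proof. by rewrite divr_gt0. Qed.

Lemma sechN x : sech (- x) = sech x.
Proof. by rewrite /sech opprK addrC. Qed.

Lemma sech_tanh x : sech x ^+ 2 + tanh x ^+ 2 = 1.
Proof.
rewrite /sech /tanh; have := expVe x; have := den_neq0 x.
by move: (expR x) (expR (- x)) => a b ab E; field: E.
Qed.

Lemma tanh_sqr x : tanh x ^+ 2 = 1 - sech x ^+ 2.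
Proof. by rewrite -(sech_tanh x) addrAC subrr add0r. Qed.

Lemma sech_le1 x : sech x <= 1.
Proof.
rewrite /sech ler_pdivrMr// mul1r; have := expVe x; have := den_gt0 x.
by move: (expR x) (expR (- x)) => a b ab E; have := sqr_ge0 (a - b); nra.
Qed.

Lemma is_derive_expRN x : is_derive x 1 (fun y : R => expR (- y)) (- expR (- x)).
Proof.
have := is_derive_compf (is_derive_expR _) (is_derive_oppf (is_derive_id x 1)).
by move=> /is_derive_eq; apply; rewrite mulrN1.
Qed.

Lemma is_derive_sech x : is_derive x 1 sech (- (sech x * tanh x)).
Proof.
have dd := is_derive_addf (is_derive_expR x) (is_derive_expRN x).
have := is_derive_scalef 2 (is_derive_invf (f := fun y => expR y + expR (- y)) (den_neq0 x) dd).
move=> /is_derive_eq; apply; rewrite /sech /tanh; have := den_neq0 x.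
by move: (expR x) (expR (- x)) => a b ab; field.
Qed.

Lemma is_derive_tanh x : is_derive x 1 tanh (sech x ^+ 2).
Proof.
have dd := is_derive_addf (is_derive_expR x) (is_derive_expRN x).
have dn := is_derive_subf (is_derive_expR x) (is_derive_expRN x).
have := is_derive_mulf dn (is_derive_invf (f := fun y => expR y + expR (- y)) (den_neq0 x) dd).
move=> /is_derive_eq; apply; rewrite /sech; have := expVe x; have := den_neq0 x.
by move: (expR x) (expR (- x)) => a b ab E; field: E.
Qed.

Lemma continuous_sech : continuous sech.
Proof. by move=> x; exact: is_derive_continuous (is_derive_sech x). Qed.

Lemma continuous_tanh : continuous tanh.
Proof. by move=> x; exact: is_derive_continuous (is_derive_tanh x). Qed.

(** The primitive is the Gudermannian function up to a constant; in this form its limit at infinity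
    is immediate. *)
Lemma is_derive_atan_exp x : is_derive x 1 (fun y : R => 2 * atan (expR y)) (sech x).
Proof.
have := is_derive_scalef 2 (is_derive_compf (is_derive1_atan _) (is_derive_expR x)).
move=> /is_derive_eq; apply; rewrite /sech.
have := expVe x; have := den_neq0 x; have := expR_gt0 x.
move: (expR x) (expR (- x)) => a b a0 ab E.
have -> : b = a^-1 by apply: (mulfI (lt0r_neq0 a0)); rewrite E divff// gt_eqF.
have -> : a + a^-1 = (1 + a ^+ 2) / a by field; rewrite gt_eqF.
by rewrite invf_div; ring.
Qed.

Lemma tanh_le1 x : `|tanh x| <= 1.
Proof.
rewrite -(@ler_pXn2r _ 2) ?nnegrE// expr1n real_normK ?num_real//.
by rewrite -(sech_tanh x) lerDr sqr_ge0.
Qed.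

Definition sech3_prim x := 2^-1 * (sech x * tanh x) + atan (expR x).

Lemma is_derive_sech3_prim x : is_derive x 1 sech3_prim (sech x ^+ 3).
Proof.
have d1 := is_derive_scalef 2^-1 (is_derive_mulf (is_derive_sech x) (is_derive_tanh x)).
have := is_derive_addf d1 (is_derive_scalef 2^-1 (is_derive_atan_exp x)).
have -> : (fun y : R => 2^-1 * (sech y * tanh y) + 2^-1 * (2 * atan (expR y))) = sech3_prim.
  by apply/funext => y; rewrite /sech3_prim; field.
by move=> /is_derive_eq; apply; have := tanh_sqr x; move: (sech x) (tanh x) => a b E; field: E.
Qed.

Lemma cvgy_expR : @expR R x @[x --> +oo] --> +oo.
Proof.
apply/cvgryPge => A; near=> x; apply: le_trans (expR_ge1Dx x).
have : A <= x by near: x; apply: nbhs_pinfty_ge; rewrite num_real.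
by move=> /le_trans; apply; rewrite lerDr.
Unshelve. all: by end_near. Qed.

Lemma sech_lt_exp x : sech x <= 2 * expR (- x).
Proof.
rewrite /sech ler_wpM2l// -[leRHS]invrK lef_pV2 ?posrE ?invr_gt0 ?expR_gt0//.
by rewrite expRN invrK lerDl invr_ge0 expR_ge0.
Qed.

Lemma cvgy_sech : sech x @[x --> +oo] --> 0.
Proof.
apply: (@squeeze_cvgr _ _ _ _ (fun=> 0) (fun x => 2 * expR (- x))).
- by near=> x; rewrite sech_lt_exp ltW ?sech_gt0.
- exact: cvg_cst.
- by rewrite -[0](mulr0 2); apply: cvgM; [exact: cvg_cst|exact: cvgr_expR].
Unshelve. all: by end_near. Qed.

Lemma cvgy_atan_exp : atan (@expR R x) @[x --> +oo] --> pi / 2.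
Proof. exact: (cvg_comp _ _ cvgy_expR (@cvgy_atan R)). Qed.

Lemma cvgy_sech3_prim : sech3_prim x @[x --> +oo] --> pi / 2.
Proof.
rewrite -[X in _ --> X]add0r; apply: cvgD; last exact: cvgy_atan_exp.
rewrite -[0](mulr0 2^-1); apply: cvgM; first exact: cvg_cst.
apply/norm_cvg0P; apply: (@squeeze_cvgr _ _ _ _ (fun=> 0) sech).
- near=> x; rewrite normr_ge0/= normrM (@ger0_norm _ (sech x)) ?(ltW (sech_gt0 x))//.
  by rewrite ler_piMr ?tanh_le1// (ltW (sech_gt0 x)).
- exact: cvg_cst.
- exact: cvgy_sech.
Unshelve. all: by end_near. Qed.

Lemma integral_sech (k : R) : 0 < k -> (\int[mu]_x (sech (k * x))%:E = (pi / k)%:E)%E.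
Proof.
move=> k0.
have dk x : is_derive x 1 (fun y => k^-1 * (2 * atan (expR (k * y)))) (sech (k * x)).
  have dl : is_derive x 1 (fun y : R => k * y) k.
    by apply: is_derive_eq (is_derive_scalef k (is_derive_id x 1)) _; rewrite mulr1.
  have := is_derive_scalef k^-1 (is_derive_compf (is_derive_atan_exp (k * x)) dl).
  by move=> /is_derive_eq; apply; rewrite mulrCA mulVf ?mulr1// gt_eqF.
have l : k^-1 * (2 * atan (expR (k * x))) @[x --> +oo] --> k^-1 * (2 * (pi / 2)).
  apply: cvgM; first exact: cvg_cst.
  apply: cvgM; first exact: cvg_cst.
  apply: (cvg_comp (fun x : R => k * x) (fun x : R => atan (expR x)) _ cvgy_atan_exp).
  by apply: gt0_cvgMry => //; exact: cvg_id.
rewrite (integral_even_FTC _ _ dk _ l).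
- by rewrite mulr0 expR0 atan1; congr EFin; field; rewrite gt_eqF.
- by move=> x; rewrite ltW ?sech_gt0.
- by move=> x; rewrite mulrN sechN.
- move=> x; apply: (@continuous_comp _ _ _ (fun x : R => k * x) sech); last exact: continuous_sech.
  exact: mulrl_continuous.
Qed.

Lemma integral_sech3 : (\int[mu]_x (sech x ^+ 3)%:E = (pi / 2)%:E)%E.
Proof.
rewrite (integral_even_FTC _ _ is_derive_sech3_prim _ cvgy_sech3_prim).
- by rewrite /sech3_prim /tanh oppr0 subrr mul0r mulr0 mulr0 add0r expR0 atan1; congr EFin; field.
- by move=> x; rewrite exprn_ge0// ltW ?sech_gt0.
- by move=> x; rewrite sechN.
- move=> x; apply: (@continuous_comp _ _ _ sech (fun y => y ^+ 3)); first exact: continuous_sech.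
  exact: exprn_continuous.
Qed.

(** The extremal profile on the line: its mass is pi, its sixth power norm pi / 2 and the squared
    norm of its derivative pi / 8, which gives equality in the sharp inequality. *)
Definition soliton x := Num.sqrt (sech x).
Definition dsoliton x := - 2^-1 * (soliton x * tanh x).

Lemma soliton_gt0 x : 0 < soliton x.
Proof. by rewrite sqrtr_gt0 sech_gt0. Qed.

Lemma soliton_sqr x : soliton x ^+ 2 = sech x.
Proof. by rewrite sqr_sqrtr// ltW ?sech_gt0. Qed.

Lemma soliton_le1 x : soliton x <= 1.
Proof. by rewrite -sqrtr1 ler_wsqrtr// sech_le1. Qed.

Lemma solitonN x : soliton (- x) = soliton x.
Proof. by rewrite /soliton sechN. Qed.

Lemma is_derive_soliton x : is_derive x 1 soliton (dsoliton x).
Proof.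
have := is_derive_sqrtf (sech_gt0 x) (is_derive_sech x).
move=> /is_derive_eq; apply; rewrite /dsoliton -/(soliton x) -soliton_sqr.
by have := soliton_gt0 x; move: (soliton x) (tanh x) => a b a0; field; rewrite gt_eqF.
Qed.

Lemma continuous_soliton : continuous soliton.
Proof. by move=> x; exact: is_derive_continuous (is_derive_soliton x). Qed.

Lemma continuous_dsoliton : continuous dsoliton.
Proof.
move=> x; apply: cvgM; first exact: cvg_cst.
by apply: cvgM; [exact: continuous_soliton|exact: continuous_tanh].
Qed.

Lemma dsoliton_sqr x : dsoliton x ^+ 2 = 4^-1 * (sech x - sech x ^+ 3).
Proof.
rewrite /dsoliton; have := tanh_sqr x; have := soliton_sqr x.
by move: (soliton x) (sech x) (tanh x) => a b c E1 E2; field: E1 E2.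
Qed.

Lemma soliton6 x : soliton x ^+ 6 = sech x ^+ 3.
Proof. by rewrite -soliton_sqr -exprM. Qed.

End Sech.

(** Bounds the loss in the sixth power when the soliton is lowered by a constant [b]. The error is
    given in [a ^+ 2], since the square of the soliton is [sech], whose integral is at hand. *)
Lemma powB_ge (R : realType) (a b : R) : 0 <= b -> b <= a -> a <= 1 ->
  a ^+ 6 - 6 * b * a ^+ 2 <= (a - b) ^+ 6.
Proof.
move=> b0 ba a1.
have a0 : 0 <= a by exact: le_trans ba.
have ab0 : 0 <= a - b by rewrite subr_ge0.
suff : a ^+ 6 - (a - b) ^+ 6 <= 6 * b * a ^+ 2 by move: (_ ^+ 6) (_ ^+ 6) (_ * _) => {}*; lra.
rewrite subrXX opprB addrC subrK -mulrA mulrCA ler_wpM2l//.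
apply: (@le_trans _ _ (\sum_(i < 6) a ^+ 2)); last first.
  by rewrite sumr_const card_ord mulr_natl.
apply: ler_sum => i _.
have aX n : (2 <= n)%N -> a ^+ n <= a ^+ 2 by move=> n2; apply: ler_wiXn2l.
apply: (@le_trans _ _ (a ^+ 5)); last exact: aX.
have -> : a ^+ 5 = a ^+ (6.-1 - i) * a ^+ i.
  by rewrite -exprD subnK// -ltnS ltn_ord.
rewrite ler_wpM2l ?exprn_ge0// lerXn2r ?nnegrE//.
by rewrite gerBl.
Qed.

Lemma tanh_ge0 (R : realType) (x : R) : 0 <= x -> 0 <= tanh x.
Proof.
move=> x0; apply: divr_ge0; last by rewrite addr_ge0 ?expR_ge0.
by rewrite subr_ge0 ler_expR; lra.
Qed.

Lemma sech_le (R : realType) (y T : R) : `|y| <= T -> sech T <= sech y.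
Proof.
rewrite ler_norml => /andP[Ty yT].
rewrite /sech ler_wpM2l// lef_pV2 ?posrE ?addr_gt0 ?expR_gt0//.
have h1 : expR y <= expR T by rewrite ler_expR.
have h2 : expR (- T) * expR (- y) <= 1 by rewrite -expRD expR_le1; lra.
have := expRxMexpNx_1 y; have := expRxMexpNx_1 T.
move: (expR y) (expR T) (expR (- T)) (expR (- y)) h1 h2 => a b c d h1 h2 bc ad.
(* The difference of the two denominators factors as (e ^ T - e ^ y) (1 - e ^ (- T - y)). *)
have := mulr_ge0 (_ : 0 <= b - a) (_ : 0 <= 1 - c * d).
rewrite !subr_ge0 => /(_ h1 h2).
have -> : (b - a) * (1 - c * d) = b - d * (b * c) - a + c * (a * d) by ring.
by rewrite bc ad; lra.
Qed.

(** * Truncated solitons on a halfline *)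

Section HalflineApprox.
Context {R : realType}.
Notation mu := (@lebesgue_measure R).
Variable T : R.
Hypothesis T0 : 0 < T.

Let P : set (measurableTypeR R) := `[0, 2 * T].
Let mP : measurable P. Proof. exact: measurable_itv. Qed.
(** The subtracted constant makes [f] vanish at both 0 and [2 * T], so that its extension by zero
    remains in H1. *)
Let f (x : R) := soliton (x - T) - soliton T.
Let h (x : R) := dsoliton (x - T).

Let shiftc (k : R -> R) : continuous k -> continuous (fun x => k (x - T)).
Proof.
move=> ck x; apply: (@continuous_comp _ _ _ (fun x : R => x - T) k); last exact: ck.
by apply: cvgB; [exact: cvg_id|exact: cvg_cst].
Qed.

Let cf : continuous f.
Proof. by move=> x; apply: cvgB; [exact: (shiftc continuous_soliton)|exact: cvg_cst]. Qed.

Let ch : continuous h. Proof. exact: (shiftc continuous_dsoliton). Qed.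

Let dshift (k k' : R -> R) : (forall x : R, is_derive x 1 k (k' x)) ->
  forall x : R, is_derive x 1 (fun y => k (y - T)) (k' (x - T)).
Proof.
move=> dk x; have dx : is_derive x 1 (fun y : R => y - T) 1.
  by apply: is_derive_eq (is_derive_subf (is_derive_id x 1) (is_derive_constf T x)) _; rewrite subr0.
by apply: is_derive_eq (is_derive_compf (f := k) (g := fun y : R => y - T) (dk (x - T)) dx) _; rewrite mulr1.
Qed.

Definition bump : R -> R := f \_ P.
Definition dbump : R -> R := h \_ P.

Let T20 : 0 <= 2 * T. Proof. by rewrite mulr_ge0// ltW. Qed.

Let PE x : (x \in P) = (0 <= x <= 2 * T).
Proof. by apply/idP/idP; rewrite inE /P/= in_itv/=. Qed.

Let bumpE x : bump x = if 0 <= x <= 2 * T then f x else 0.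
Proof. by rewrite /bump /patch PE. Qed.

Let PD : P `<=` edge_dom None.
Proof. by move=> x; rewrite edge_domE /P/= in_itv/= => /andP[->]. Qed.

Let integrable_patch (k : R -> R) : continuous k ->
  mu.-integrable (edge_dom None) (EFin \o (k \_ P)).
Proof.
move=> ck; rewrite -restrict_EFin; apply/integrable_restrict; rewrite ?(setIidr PD)//.
- exact: measurable_edge_dom.
- exact: integrable_continuous_itv.
Qed.

Let Rintegral_patch (k : R -> R) :
  \int[mu]_(x in edge_dom None) (k \_ P) x = \int[mu]_(x in P) k x.
Proof. by rewrite -Rintegral_mkcondr (setIidr PD). Qed.

Let patchX (k : R -> R) n : (fun x => (k \_ P) x ^+ n.+1) = (fun x => k x ^+ n.+1) \_ P.
Proof. by apply/funext => x; rewrite /patch; case: ifP => // _; rewrite expr0n. Qed.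

Lemma H1_bump : H1_edge (edge_dom None) bump dbump.
Proof.
split.
- rewrite (patchX f 1); apply: integrable_patch => x.
  by apply: (@continuous_comp _ _ _ f (fun y => y ^+ 2)); [exact: cf|exact: exprn_continuous].
- rewrite (patchX h 1); apply: integrable_patch => x.
  by apply: (@continuous_comp _ _ _ h (fun y => y ^+ 2)); [exact: ch|exact: exprn_continuous].
move=> x /edge_dom_ge0 x0; split.
  apply: integrableS (integrable_patch ch) => //; first exact: measurable_edge_dom.
  by apply: edge_dom_sub => //; rewrite edge_domE x0.
rewrite -Rintegral_mkcondr.
(* The derivative is zero beyond [2 * T], so the integral stops there. *)
pose y := Num.min x (2 * T).
have y0 : 0 <= y by rewrite le_min x0.
have -> : `[0, x] `&` P = `[0, y]%classic.
  apply/seteqP; split => z; rewrite /P/= !in_itv/= le_min.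
    by move=> [/andP[-> ->] /andP[_ ->]].
  by move=> /andP[-> /andP[-> ->]].
rewrite (Rintegral_FTC y0 (dshift is_derive_soliton) ch).
rewrite !bumpE lexx T20 /= /f sub0r solitonN subrr add0r x0 /=.
rewrite /y minElt; case: (ltP x (2 * T)) => [xT|Tx]; first by rewrite (ltW xT).
by case: ifP => [xT|_]; [congr (soliton _ - _)|]; rewrite mulr2n mulrDl mul1r ?addrK ?subrr//; lra.
Qed.

Lemma bump0 : bump 0 = 0.
Proof. by rewrite bumpE lexx T20 /f sub0r solitonN subrr. Qed.

Let f_bound x : 0 <= x <= 2 * T -> 0 <= f x <= soliton (x - T).
Proof.
move=> /andP[x0 xT]; rewrite /f subr_ge0 lerBlDr lerDl (ltW (soliton_gt0 _)) andbT.
by rewrite ler_wsqrtr//; apply: sech_le; rewrite ler_norml; apply/andP; split; lra.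
Qed.

Let cX (k : R -> R) n : continuous k -> continuous (fun x => k x ^+ n).
Proof.
by move=> ck x; apply: (@continuous_comp _ _ _ k (fun y => y ^+ n)); [exact: ck|exact: exprn_continuous].
Qed.

Let csech : continuous (fun x => sech (x - T)) . Proof. exact: (shiftc continuous_sech). Qed.

Let int_sech : \int[mu]_(x in P) sech (x - T) = 2 * atan (expR T) - 2 * atan (expR (- T)).
Proof.
rewrite (Rintegral_FTC T20 (dshift is_derive_atan_exp) csech) sub0r.
by have -> : 2 * T - T = T by lra.
Qed.

Let int_sech3 : \int[mu]_(x in P) (sech (x - T) ^+ 3) =
  sech T * tanh T + atan (expR T) - atan (expR (- T)).
Proof.
rewrite (Rintegral_FTC T20 (dshift is_derive_sech3_prim) (cX csech)) sub0r.
have -> : 2 * T - T = T by lra.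
rewrite /sech3_prim sechN.
have -> : tanh (- T) = - tanh T by rewrite /tanh opprK -mulNr opprB (addrC (expR (- T)) (expR T)).
by field.
Qed.

Let ik (k : R -> R) : continuous k -> mu.-integrable P (EFin \o k).
Proof. exact: integrable_continuous_itv. Qed.

Let PP x : P x -> 0 <= x <= 2 * T. Proof. by rewrite /P/= in_itv. Qed.

Let atan_bnd : 2 * atan (expR T) - 2 * atan (expR (- T)) <= pi.
Proof.
have := atan_ltpi2 (expR T); have : 0 <= atan (expR (- T)).
  by rewrite -[leLHS]atan0; apply: le_atan; exact: expR_ge0.
by move: (atan _) (atan _) => a b; lra.
Qed.

Lemma bump_norm2 : \int[mu]_(x in edge_dom None) (bump x ^+ 2) <= pi.
Proof.
rewrite (_ : (fun x => bump x ^+ 2) = (fun x => f x ^+ 2) \_ P); last exact: (patchX f 1).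
rewrite Rintegral_patch; apply: le_trans atan_bnd; rewrite -int_sech.
apply: le_Rintegral => //; [by apply: ik; apply: cX|exact: ik|move=> x /PP/f_bound/andP[f0 fs]].
by rewrite -soliton_sqr lerXn2r ?nnegrE// (ltW (soliton_gt0 _)).
Qed.

Lemma bump_norm6_le : \int[mu]_(x in edge_dom None) (bump x ^+ 6) <=
  \int[mu]_(x in edge_dom None) (bump x ^+ 2).
Proof.
rewrite (_ : (fun x => bump x ^+ 2) = (fun x => f x ^+ 2) \_ P); last exact: (patchX f 1).
rewrite (_ : (fun x => bump x ^+ 6) = (fun x => f x ^+ 6) \_ P); last exact: (patchX f 5).
rewrite !Rintegral_patch; apply: le_Rintegral => //; [by apply: ik; apply: cX|by apply: ik; apply: cX|].
move=> x /PP/f_bound/andP[f0 fs]; apply: ler_wiXn2l => //.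
exact: le_trans fs (soliton_le1 _).
Qed.

(** By [powB_ge] the loss is at most [6 * soliton T] times the integral of [sech], which is at most
    pi; the nonnegative term [sech T * tanh T] is dropped. *)
Lemma bump_norm6_ge : atan (expR T) - atan (expR (- T)) - 6 * pi * soliton T <=
  \int[mu]_(x in edge_dom None) (bump x ^+ 6).
Proof.
rewrite (_ : (fun x => bump x ^+ 6) = (fun x => f x ^+ 6) \_ P); last exact: (patchX f 5).
rewrite Rintegral_patch.
have i3 := ik (cX (n := 3) csech).
have i1 := integrable_scale (- (6 * soliton T)) mP (ik csech).
apply: (@le_trans _ _ (\int[mu]_(x in P) (sech (x - T) ^+ 3 + - (6 * soliton T) * sech (x - T)))).
  rewrite RintegralD// RintegralZl//; last exact: ik.
  rewrite int_sech3 int_sech mulNr.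
  have := ler_wpM2l (_ : 0 <= 6 * soliton T) atan_bnd.
  rewrite mulr_ge0 ?(ltW (soliton_gt0 _))// => /(_ isT).
  have : 0 <= sech T * tanh T.
    by rewrite mulr_ge0 ?(ltW (sech_gt0 _)) ?tanh_ge0// ltW.
  have -> : 6 * pi * soliton T = 6 * soliton T * pi by ring.
  by move: (_ * tanh T) => a; lra.
apply: le_Rintegral => //; [exact: integrable_add|by apply: ik; apply: cX|].
move=> x /PP xP; rewrite -soliton6 -soliton_sqr mulNr.
apply: powB_ge; [exact/ltW/soliton_gt0| |exact: soliton_le1].
by move: (f_bound xP); rewrite /f subr_ge0 => /andP[].
Qed.

Lemma dbump_norm2 : \int[mu]_(x in edge_dom None) (dbump x ^+ 2) <= pi / 8.
Proof.
rewrite (_ : (fun x => dbump x ^+ 2) = (fun x => h x ^+ 2) \_ P); last exact: (patchX h 1).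
rewrite Rintegral_patch.
have -> : (fun x => h x ^+ 2) = (fun x => 4^-1 * (sech (x - T) - sech (x - T) ^+ 3)).
  by apply/funext => x; rewrite /h dsoliton_sqr.
have i3 := ik (cX (n := 3) csech).
rewrite RintegralZl//; last first.
  apply: ik => x; apply: cvgB; [exact: csech|exact: (cX (n := 3) csech)].
rewrite RintegralB//; last exact: ik.
rewrite int_sech int_sech3.
have : 0 <= sech T * tanh T.
  by rewrite mulr_ge0 ?(ltW (sech_gt0 _)) ?tanh_ge0// ltW.
by have := atan_bnd; move: (_ * tanh T) (atan _) (atan _) => {}*; lra.
Qed.

End HalflineApprox.

Section Approx.
Context {R : realType}.
Notation mu := (@lebesgue_measure R).
Variable G : mgraph R.

(** The bump vanishes at the vertex of its halfline, so extension by zero is continuous on any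
    graph. The bound [normk 6 u <= normk 2 u] keeps the mass away from 0. *)
Lemma approx_gn (e : R) : noncompact G -> 0 < e -> exists u g : 'I_(nE G) -> R -> R,
  [/\ H1 u g, normk 2 u <= pi, normk 2 g <= pi / 8, normk 6 u <= normk 2 u &
      pi / 2 - e <= normk 6 u].
Proof.
move=> [e0 e0N] e_gt0.
have [T [T0 hT]] : exists T, 0 < T /\
    pi / 2 - e <= atan (@expR R T) - atan (expR (- T)) - 6 * pi * soliton T.
  have : atan (@expR R T) - atan (expR (- T)) - 6 * pi * soliton T @[T --> +oo] --> pi / 2 - 0 - 6 * pi * 0.
    apply: cvgB; first apply: cvgB.
    - exact: cvgy_atan_exp.
    - rewrite -(@atan0 R); apply: (cvg_comp _ _ (@cvgr_expR R)); exact: continuous_atan.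
    - apply: cvgM; first exact: cvg_cst.
      rewrite -(@sqrtr0 R); apply: (cvg_comp _ _ cvgy_sech); exact: sqrt_continuous.
  rewrite mulr0 !subr0 => /cvgrPdist_le /(_ e e_gt0) hc.
  suff : \forall T \near +oo, 0 < T /\
    pi / 2 - e <= atan (@expR R T) - atan (expR (- T)) - 6 * pi * soliton T.
    by move=> /filter_ex.
  near=> T; split; first by near: T; apply: nbhs_pinfty_gt; rewrite num_real.
  have : `|pi / 2 - (atan (@expR R T) - atan (expR (- T)) - 6 * pi * soliton T)| <= e.
    by near: T.
  by rewrite ler_distl; move: (_ - _) => a /andP[? ?]; lra.
pose u (i : 'I_(nE G)) := if i == e0 then bump T else fun=> 0.
pose g (i : 'I_(nE G)) := if i == e0 then dbump T else fun=> 0.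
have Dom0 : edge_dom (edge_len e0) = edge_dom None by rewrite /edge_len e0N.
have i0 D : mu.-integrable D (EFin \o (fun=> 0 : R)) by exact: integrable0.
have sumE k (w : R -> R) : (0 < k)%N ->
  \sum_(i < nE G) \int[mu]_(x in edge_dom (edge_len i)) ((if i == e0 then w else fun=> 0) x ^+ k) =
  \int[mu]_(x in edge_dom None) (w x ^+ k).
  move=> k0; rewrite (bigD1 e0)//= eqxx Dom0 big1 ?addr0// => i /negPf ->.
  under eq_Rintegral do rewrite expr0n gtn_eqF//.
  by rewrite /Rintegral integral0.
have Hug : H1 u g.
  have HB i : H1_edge (edge_dom (edge_len i)) (u i) (g i).
    rewrite /u /g; have [->|_] := eqVneq i e0; first by rewrite Dom0; exact: H1_bump.
    split.
    - by rewrite (_ : (fun=> _) = (fun=> 0)) //; apply/funext => x; rewrite expr0n.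
    - by rewrite (_ : (fun=> _) = (fun=> 0)) //; apply/funext => x; rewrite expr0n.
    - by move=> x _; split => //; rewrite /Rintegral integral0 addr0.
  split; first by move=> i; rewrite edomE; case: (HB i).
  split; first by move=> i; rewrite edomE; case: (HB i).
  split; first by move=> i x; rewrite edomE => xD; case: (HB i) => _ _ /(_ x xD).
  exists (fun=> 0) => i; rewrite /u; have [->|_] := eqVneq i e0; last by [].
  by rewrite bump0 //; split => // w; rewrite e0N.
exists u, g; split => //.
- by rewrite normk2E sumE// bump_norm2.
- by rewrite normk2E sumE// dbump_norm2.
- by rewrite normk2E normk6E !sumE// bump_norm6_le.
- by rewrite normk6E sumE// (le_trans hT)// bump_norm6_ge.
Unshelve. all: by end_near. Qed.

End Approx.

(** * The critical mass and the energy level *)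

Section Scaling.
Context {R : realType}.
Notation mu := (@lebesgue_measure R).
Variable G : mgraph R.
Variables (u g : 'I_(nE G) -> R -> R) (k : R).
Hypothesis H : H1 u g.

Lemma H1_scale : H1 (fun e x => k * u e x) (fun e x => k * g e x).
Proof.
have mD e : measurable (edge_dom (@edge_len R G e)) by exact: measurable_edge_dom.
case: (H) => [_ [_ [_ [phi hphi]]]].
split=> [e|].
  rewrite edomE; case: (H1_edgeP H e) => iu _ _.
  apply: (eq_integrable (mD e)) (integrable_scale (k ^+ 2) (mD e) iu) => x _ /=.
  by rewrite exprMn.
split=> [e|].
  rewrite edomE; case: (H1_edgeP H e) => _ ig _.
  apply: (eq_integrable (mD e)) (integrable_scale (k ^+ 2) (mD e) ig) => x _ /=.
  by rewrite exprMn.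
split=> [e x|].
  rewrite edomE => xD; case: (H1_edgeP H e) => _ _ /(_ x xD)[ix uE].
  split; first exact: integrable_scale.
  by rewrite -[fine _]/(\int[mu]_(t in `[0, x]) (k * g e t)) RintegralZl// uE mulrDr.
exists (fun v => k * phi v) => e; have [h1 h2] := hphi e.
by split=> [|w ew]; [rewrite h1|rewrite (h2 w ew)].
Qed.

Lemma normk2_scale : normk 2 (fun e x => k * u e x) = k ^+ 2 * normk 2 u.
Proof.
rewrite !normk2E mulr_sumr; apply: eq_bigr => e _.
under eq_Rintegral do rewrite exprMn.
by rewrite RintegralZl//; [exact: measurable_edge_dom|case: (H1_edgeP H e)].
Qed.

Lemma normk2_scale_grad : normk 2 (fun e x => k * g e x) = k ^+ 2 * normk 2 g.
Proof.
rewrite !normk2E mulr_sumr; apply: eq_bigr => e _.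
under eq_Rintegral do rewrite exprMn.
by rewrite RintegralZl//; [exact: measurable_edge_dom|case: (H1_edgeP H e)].
Qed.

Lemma normk6_scale : noncompact G -> normk 6 (fun e x => k * u e x) = k ^+ 6 * normk 6 u.
Proof.
move=> ncG; have [p _ hp] := H1_max H ncG.
rewrite !normk6E mulr_sumr; apply: eq_bigr => e _.
under eq_Rintegral do rewrite exprMn.
rewrite RintegralZl//; first exact: measurable_edge_dom.
apply: (integrable_u6 H (M := `|u p.1 p.2| + 1)); first by rewrite ltr_wpDl.
by move=> q /hp /le_trans; apply; rewrite lerDl.
Qed.

End Scaling.

Section CriticalMass.
Context {R : realType}.
Implicit Types G : mgraph R.

Let pi0 : 0 < pi :> R. Proof. exact: pi_gt0. Qed.

Lemma KconstE G : noncompact G -> assumptionH G -> Kconst G = (4 / pi ^+ 2)%:E.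
Proof.
move=> ncG HG; apply/eqP; rewrite eq_le; apply/andP; split.
  apply: ge_ereal_sup => _ [u [g [Hu [m0 ->]]]]; rewrite lee_fin.
  have := gn_ineq Hu ncG HG m0.
  (* Division by zero returns 0, so the quotient is 0 here. *)
  have [->|g0] := eqVneq (normk 2 g) 0.
    by rewrite !mulr0 invr0 mulr0 => _; rewrite divr_ge0// exprn_ge0// ltW.
  have {}g0 : 0 < normk 2 g by rewrite lt0r g0 normk_ge0.
  move=> le_; rewrite ler_pdivrMr ?mulr_gt0 ?exprn_gt0// mulrAC ler_pdivlMr ?exprn_gt0//.
  by rewrite mulrC mulrA.
apply/lee_addgt0Pr => e e0.
(* The first bound keeps [normk 6 u] positive. The second makes the error [d], divided by the
   limiting denominator pi ^ 3 / 8, at most [e]. *)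
pose d := Num.min (pi / 4) (e * pi ^+ 3 / 8).
have d0 : 0 < d by rewrite lt_min !divr_gt0 ?mulr_gt0 ?exprn_gt0.
have [u [g [Hu m1 g1 m6 n6]]] := approx_gn ncG d0.
have d1 : d <= pi / 4 by rewrite ge_min lexx.
have d2 : d <= e * pi ^+ 3 / 8 by rewrite ge_min lexx orbT.
have n60 : 0 < normk 6 u by move: pi0; lra.
have m0 : 0 < normk 2 u by exact: lt_le_trans m6.
have g0 : 0 < normk 2 g.
  rewrite lt0r normk_ge0 andbT; apply/negP => /eqP g0.
  have := gn_ineq Hu ncG HG m0; rewrite g0 mulr0 leNgt => /negP; apply.
  by rewrite mulr_gt0// exprn_gt0.
have le_ : 4 / pi ^+ 2 <= normk 6 u / (normk 2 u ^+ 2 * normk 2 g) + e.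
  apply: (@le_trans _ _ (normk 6 u / (pi ^+ 2 * (pi / 8)) + e)).
    apply: (@le_trans _ _ ((pi / 2 - d) / (pi ^+ 2 * (pi / 8)) + e)); last first.
      by rewrite lerD2r ler_wpM2r// invr_ge0 !mulr_ge0 ?exprn_ge0 ?divr_ge0 ?(ltW pi0).
    rewrite -lerBlDr.
    have -> : 4 / pi ^+ 2 - e = (pi / 2 - e * pi ^+ 3 / 8) / (pi ^+ 2 * (pi / 8)).
      by have := lt0r_neq0 pi0; move: (pi : R) => p p0; field.
    by rewrite ler_wpM2r ?lerB// invr_ge0 !mulr_ge0 ?exprn_ge0 ?divr_ge0 ?(ltW pi0).
  rewrite lerD2r ler_wpM2l ?normk_ge0// lef_pV2 ?posrE ?mulr_gt0 ?exprn_gt0 ?divr_gt0//.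
  by rewrite ler_pM ?normk_ge0 ?exprn_ge0 ?normk_ge0// lerXn2r ?nnegrE ?normk_ge0 ?(ltW pi0).
apply: (@le_trans _ _ ((normk 6 u / (normk 2 u ^+ 2 * normk 2 g))%:E + e%:E)%E).
  by rewrite -EFinD lee_fin.
rewrite leeD2r//; apply: ereal_sup_ubound.
by exists u, g.
Qed.

Lemma noncompact_Rline : noncompact (Rline R).
Proof. by exists ord0. Qed.

Lemma assumptionH_Rline : assumptionH (Rline R).
Proof.
move=> [e x] _; exists (ord0, false), [:: (lift ord0 ord0, true)]; split => //.
by left => /=; rewrite !inE; case: e => -[|[|//]] i.
Qed.

(** This is pi sqrt 3 / 2, in the form to which [mucrit] reduces. *)
Definition mass_crit : R := Num.sqrt (3 / (4 / pi ^+ 2)).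

Lemma mucritE G : noncompact G -> assumptionH G -> mucrit G = mass_crit.
Proof. by move=> ncG HG; rewrite /mucrit KconstE. Qed.

Lemma mass_crit_sqr : mass_crit ^+ 2 = 3 / 4 * pi ^+ 2.
Proof.
rewrite sqr_sqrtr; first by have := lt0r_neq0 pi0; move: (pi : R) => p p0; field.
by rewrite !divr_ge0// exprn_ge0// ltW.
Qed.

Lemma mass_crit_gt0 : 0 < mass_crit.
Proof. by rewrite sqrtr_gt0 !divr_gt0// exprn_gt0. Qed.

Lemma energy_crit_ge0 G (u g : 'I_(nE G) -> R -> R) : noncompact G -> assumptionH G ->
  H1 u g -> normk 2 u = mass_crit -> 0 <= energy u g.
Proof.
move=> ncG HG Hu um; have := gn_ineq Hu ncG HG; rewrite um mass_crit_sqr.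
move=> /(_ mass_crit_gt0).
have -> : 4 * (3 / 4 * pi ^+ 2) * normk 2 g = pi ^+ 2 * (3 * normk 2 g) by field.
by rewrite ler_pM2l ?exprn_gt0// /energy; move: (normk 6 u) (normk 2 g) => a b; lra.
Qed.

(** At the critical mass the energy of a multiple of [u] is a positive factor times the deficit of
    [u] in the sharp inequality, so both the level 0 and its attainment become statements about that
    deficit. *)
Lemma energy_scaled G (u g : 'I_(nE G) -> R -> R) : noncompact G ->
  H1 u g -> 0 < normk 2 u ->
  exists k, [/\ k ^+ 2 = mass_crit / normk 2 u,
    H1 (fun e x => k * u e x) (fun e x => k * g e x),
    normk 2 (fun e x => k * u e x) = mass_crit &
    energy (fun e x => k * u e x) (fun e x => k * g e x) =
      k ^+ 2 / 2 * (normk 2 g - pi ^+ 2 * normk 6 u / (4 * normk 2 u ^+ 2))].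
Proof.
move=> ncG Hu m0; exists (Num.sqrt (mass_crit / normk 2 u)).
set k := Num.sqrt _.
have kE : k ^+ 2 = mass_crit / normk 2 u.
  by rewrite sqr_sqrtr// divr_ge0 ?normk_ge0// ltW// mass_crit_gt0.
split => //; first exact: H1_scale.
  by rewrite (normk2_scale _ Hu) kE divfK// gt_eqF.
rewrite /energy (normk2_scale_grad _ Hu) (normk6_scale _ Hu ncG).
have -> : k ^+ 6 = k ^+ 2 * (3 / 4 * pi ^+ 2 / normk 2 u ^+ 2).
  by rewrite -mass_crit_sqr -expr_div_n -kE -exprM -exprD.
by field; rewrite gt_eqF.
Qed.

Lemma Elevel_crit G : noncompact G -> assumptionH G -> Elevel G mass_crit = 0%E.
Proof.
move=> ncG HG; apply/eqP; rewrite eq_le; apply/andP; split; last first.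
  by apply: le_ereal_inf_tmp => _ [u [g [Hu [um ->]]]]; rewrite lee_fin energy_crit_ge0.
apply/lee_addgt0Pr => e e0; rewrite add0e.
have mc0 := mass_crit_gt0.
(* The first bound gives a mass of at least pi / 4, hence [k ^+ 2 <= 4 * mass_crit / pi]; the
   deficit is at most [d / 4], and the second bound brings the product below [e]. *)
pose d := Num.min (pi / 4) (e * pi * 2 / mass_crit).
have d0 : 0 < d by rewrite lt_min !divr_gt0 ?mulr_gt0.
have d1 : d <= pi / 4 by rewrite ge_min lexx.
have d2 : d <= e * pi * 2 / mass_crit by rewrite ge_min lexx orbT.
have [u [g [Hu m1 g1 m6 n6]]] := approx_gn ncG d0.
have m4 : pi / 4 <= normk 2 u by apply: le_trans m6; move: pi0; lra.
have m0 : 0 < normk 2 u by apply: lt_le_trans m4; rewrite divr_gt0.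
have [k [kE Hk mk Ek]] := energy_scaled ncG Hu m0.
apply: (@le_trans _ _ (energy (fun e x => k * u e x) (fun e x => k * g e x))%:E).
  apply: ereal_inf_lbound; exists (fun e x => k * u e x), (fun e x => k * g e x).
  by [].
rewrite lee_fin Ek.
have k2 : 0 <= k ^+ 2 / 2 by rewrite divr_ge0// sqr_ge0.
(* Since the mass is at most pi, the deficit is at most [normk 2 g - normk 6 u / 4], hence at most
   pi / 8 - (pi / 2 - d) / 4. *)
have h1 : normk 2 g - pi ^+ 2 * normk 6 u / (4 * normk 2 u ^+ 2) <= d / 4.
  have : normk 6 u / 4 <= pi ^+ 2 * normk 6 u / (4 * normk 2 u ^+ 2).
    rewrite ler_pdivlMr ?mulr_gt0 ?exprn_gt0//.
    have -> : normk 6 u / 4 * (4 * normk 2 u ^+ 2) = normk 2 u ^+ 2 * normk 6 u by field.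
    by rewrite ler_wpM2r ?normk_ge0// lerXn2r ?nnegrE ?normk_ge0 ?(ltW pi0).
  move: (pi ^+ 2 * normk 6 u / _) => X; lra.
apply: (le_trans (ler_wpM2l k2 h1)).
have h2 : k ^+ 2 <= 4 * mass_crit / pi.
  have -> : 4 * mass_crit / pi = mass_crit / (pi / 4).
    by have := lt0r_neq0 pi0; move: (pi : R) => p p0; field.
  by rewrite kE ler_wpM2l ?(ltW mc0)// lef_pV2 ?posrE ?divr_gt0.
apply: (@le_trans _ _ (4 * mass_crit / pi / 2 * (d / 4))).
  by rewrite ler_wpM2r ?divr_ge0 ?(ltW d0)// ler_wpM2r.
apply: (@le_trans _ _ (4 * mass_crit / pi / 2 * ((e * pi * 2 / mass_crit) / 4))).
  by rewrite ler_wpM2l ?ler_wpM2r// ?divr_ge0 ?mulr_ge0 ?(ltW mc0) ?(ltW pi0).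
rewrite le_eqVlt; apply/orP; left; apply/eqP.
by have := lt0r_neq0 pi0; have := lt0r_neq0 mc0; move: mass_crit (pi : R) => {}* ; field; apply/andP.
Qed.

Lemma attained_crit G : noncompact G -> assumptionH G ->
  attained G mass_crit <-> exists u g : 'I_(nE G) -> R -> R,
    [/\ H1 u g, 0 < normk 2 u & pi ^+ 2 * normk 6 u = 4 * normk 2 u ^+ 2 * normk 2 g].
Proof.
move=> ncG HG; split=> [[u [g [Hu [um]]]]|[u [g [Hu m0 eqn]]]].
  rewrite Elevel_crit// => -[E0]; exists u, g; rewrite um mass_crit_gt0 mass_crit_sqr.
  split => //; move: E0; rewrite /energy => E0.
  have -> : normk 6 u = 3 * normk 2 g by move: E0; move: (normk 6 u) (normk 2 g) => a b; lra.
  by field.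
have [k [kE Hk mk Ek]] := energy_scaled ncG Hu m0.
exists (fun e x => k * u e x), (fun e x => k * g e x); split => //; split => //.
rewrite Elevel_crit// Ek eqn; congr EFin.
by field; rewrite gt_eqF.
Qed.

End CriticalMass.

(** * Path distances *)

Section Chains.
Context {R : realType} {T : Type}.
Variables (ok : T * T -> bool) (cost : T * T -> R) (gl : T -> T -> bool).

(** Common form of the paths behind [gdist] and [glue_dist]: admissible jumps with a cost, joined by
    a free identification. Both distances are infima of such costs. *)
Definition chain (s t : T) (r : R) : Prop := exists c0 cs,
  [/\ c0.1 = s, (last c0 cs).2 = t, all ok (c0 :: cs),
      path (fun a b => gl a.2 b.1) c0 cs & r = \sum_(c <- c0 :: cs) cost c].

Lemma chain_step s t : ok (s, t) -> chain s t (cost (s, t)).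
Proof. by move=> st; exists (s, t), [::]; rewrite /= st big_seq1. Qed.

Lemma chain_cat s t t' r c c' : chain s t c -> gl t t' -> chain t' r c' -> chain s r (c + c').
Proof.
move=> [c0 [cs [<- <- oc pc ->]]] tt' [d0 [ds [h <- od pd ->]]].
exists c0, (cs ++ d0 :: ds); split => //.
- by rewrite last_cat.
- by rewrite -cat_cons all_cat oc.
- by rewrite cat_path pc /= h tt'.
- by rewrite -cat_cons big_cat.
Qed.

Lemma chain_ind (P : T -> T -> R -> Prop) :
  (forall s t, ok (s, t) -> P s t (cost (s, t))) ->
  (forall s t t' r c, ok (s, t) -> gl t t' -> chain t' r c -> P t' r c ->
     P s r (cost (s, t) + c)) ->
  forall s t c, chain s t c -> P s t c.
Proof.
move=> base step s t c [c0 [cs [<- <- oc pc ->]]].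
elim: cs c0 oc pc => [|c1 cs IH] [a b] /=.
  by rewrite andbT => oc _; rewrite big_seq1; exact: base.
case/andP => oc occ /andP[gc pc]; rewrite big_cons; apply: (step a b c1.1) => //.
  by exists c1, cs.
exact: IH.
Qed.

Lemma chain_sym s t c : (forall a b, ok (a, b) -> ok (b, a)) ->
  (forall a b, cost (a, b) = cost (b, a)) -> (forall a b, gl a b -> gl b a) ->
  chain s t c -> chain t s c.
Proof.
move=> oks costs gls; elim/chain_ind => {s t c} [s t st|s t t' r c st tt' _ IH].
  by rewrite costs; apply: chain_step; exact: oks.
rewrite addrC costs; apply: chain_cat IH (gls _ _ tt') _.
exact/chain_step/oks.
Qed.

(** The source of all lower bounds on distances: a function that is 1-Lipschitz along jumps and
    invariant under the identification. *)
Lemma chain_potential (h : T -> R) s t c :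
  (forall a b, ok (a, b) -> `|h a - h b| <= cost (a, b)) ->
  (forall a b b' d, ok (a, b) -> ok (b', d) -> gl b b' -> h b = h b') ->
  chain s t c -> `|h s - h t| <= c.
Proof.
move=> hc hg; elim/chain_ind => {s t c} [s t|s t t' r c st tt' ch IH]; first exact: hc.
apply: (le_trans (ler_distD (h t) _ _)); apply: lerD; first exact: hc.
case: ch tt' IH => -[a b] [cs [/= <- _ /andP[ab _] _ _]] tt'.
by rewrite (hg s t a b).
Qed.

Lemma chain_ge0 s t c : (forall a, 0 <= cost a) -> chain s t c -> 0 <= c.
Proof.
move=> c0 ch; have := chain_potential (h := fun=> 0) _ _ ch.
by rewrite subrr normr0; apply => // a b _; rewrite c0.
Qed.

Definition chain_dist (s t : T) : R := inf [set c | chain s t c].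

Lemma chain_dist_le s t c : (forall a, 0 <= cost a) -> chain s t c -> chain_dist s t <= c.
Proof.
move=> c0 ch; apply: ge_inf => //; exists 0 => d /=; exact: chain_ge0.
Qed.

Lemma chain_dist_ge s t d : (exists c, chain s t c) ->
  (forall c, chain s t c -> d <= c) -> d <= chain_dist s t.
Proof. by move=> ex hd; apply: lb_le_inf. Qed.

End Chains.

Section GraphChains.
Context {R : realType}.
Variable G : mgraph R.
Implicit Types p q r : gpoint G.

Definition gok (c : gpoint G * gpoint G) := (c.1.1 == c.2.1) && in_dom c.1 && in_dom c.2.
Definition gcst (c : gpoint G * gpoint G) : R := `|c.1.2 - c.2.2|.
Definition reach := chain gok gcst (@same_pt R G).

Lemma gdistE p q : gdist p q = chain_dist gok gcst (@same_pt R G) p q.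
Proof.
congr inf; apply/seteqP; split => r /=.
  by move=> [c0 [cs [[h1 [h2 [h3 h4]]] ->]]]; exists c0, cs.
by move=> [c0 [cs [h1 h2 h3 h4 ->]]]; exists c0, cs.
Qed.

Lemma reach_edge p q : in_dom p -> in_dom q -> p.1 = q.1 -> reach p q `|p.2 - q.2|.
Proof.
move=> pd qd pq; apply: (@chain_step R _ gok gcst (@same_pt R G) p q).
by rewrite /gok /= pq eqxx pd.
Qed.

Lemma reach_cat p q q' r c c' : reach p q c -> same_pt q q' -> reach q' r c' ->
  reach p r (c + c').
Proof. exact: chain_cat. Qed.

Lemma reach_sym p q c : reach p q c -> reach q p c.
Proof.
apply: chain_sym => [a b|a b|a b]; last exact: same_pt_sym.
  by rewrite /gok /= eq_sym andbAC.
by rewrite /gcst distrC.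
Qed.

Lemma gconnected_reach p q : gconnected G -> in_dom p -> in_dom q -> exists c, reach p q c.
Proof.
move=> cG pd qd; have [c0 [cs [h1 [h2 [h3 h4]]]]] := cG p q pd qd.
by exists (\sum_(c <- c0 :: cs) gcst c), c0, cs.
Qed.

Lemma gdist_le p q c : reach p q c -> gdist p q <= c.
Proof. by move=> pq; rewrite gdistE; apply: chain_dist_le pq => a; exact: normr_ge0. Qed.

Lemma reach_potential (h : gpoint G -> R) p q c :
  (forall e x y, in_dom (e, x) -> in_dom (e, y) -> `|h (e, x) - h (e, y)| <= `|x - y|) ->
  (forall a b, in_dom a -> in_dom b -> same_pt a b -> h a = h b) ->
  reach p q c -> `|h p - h q| <= c.
Proof.
move=> hl hs; apply: chain_potential.
  by move=> [e x] [e' y] /andP[/andP[/= /eqP<- xd] yd]; exact: hl.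
by move=> a b b' d /andP[_ bd] /andP[/andP[_ b'd] _]; exact: hs.
Qed.

(** Connectedness ensures that the infimum is over a nonempty set. *)
Lemma gdist_potential (h : gpoint G -> R) p q : gconnected G -> in_dom p -> in_dom q ->
  (forall e x y, in_dom (e, x) -> in_dom (e, y) -> `|h (e, x) - h (e, y)| <= `|x - y|) ->
  (forall a b, in_dom a -> in_dom b -> same_pt a b -> h a = h b) ->
  `|h p - h q| <= gdist p q.
Proof.
move=> cG pd qd hl hs; rewrite gdistE; apply: chain_dist_ge.
  exact: gconnected_reach.
by move=> c; exact: reach_potential.
Qed.

End GraphChains.

Section GlueChains.
Context {R : realType}.
Implicit Types (s t a b x : R) (xs : seq R).

Definition glue_reach (xs : seq R) :=
  chain (fun=> true) (fun c : R * R => `|c.1 - c.2|) (glued xs).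

Lemma glue_distE xs s t : glue_dist xs s t =
  chain_dist (fun=> true) (fun c : R * R => `|c.1 - c.2|) (glued xs) s t.
Proof.
congr inf; apply/seteqP; split => r /=.
  by move=> [c0 [cs [h1 [h2 [h3 ->]]]]]; exists c0, cs; split => //; exact/allP.
by move=> [c0 [cs [h1 h2 _ h4 ->]]]; exists c0, cs.
Qed.

Lemma glue_dist_le xs s t : glue_dist xs s t <= `|s - t|.
Proof.
rewrite glue_distE; apply: chain_dist_le; first by move=> a; exact: normr_ge0.
exact: (@chain_step R _ _ (fun c : R * R => `|c.1 - c.2|)).
Qed.

Lemma glue_dist_potential (h : R -> R) xs s t : (forall a b, `|h a - h b| <= `|a - b|) ->
  (forall x, x \in xs -> h x = h (- x)) -> `|h s - h t| <= glue_dist xs s t.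
Proof.
move=> hl hs; rewrite glue_distE; apply: chain_dist_ge.
  by eexists; exact: (@chain_step R _ _ (fun c : R * R => `|c.1 - c.2|)).
move=> c; apply: chain_potential => [a b _|a b b' d _ _]; first exact: hl.
move=> /orP[/eqP->//|/hasP[x /hs hx /orP[] /andP[/eqP-> /eqP->]]] //.
Qed.

Lemma glue_dist_nil s t : glue_dist [::] s t = `|s - t|.
Proof.
apply/eqP; rewrite eq_le glue_dist_le /=.
exact: (@glue_dist_potential id).
Qed.

Lemma glue_distxx xs s : glue_dist xs s s = 0.
Proof.
apply/eqP; rewrite eq_le; apply/andP; split.
  by have := glue_dist_le xs s s; rewrite subrr normr0.
by have := @glue_dist_potential (fun=> 0) xs s s; rewrite subrr normr0; apply.
Qed.

End GlueChains.

(** * Positions along a trail *)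

Section TrailPosition.
Context {R : realType}.
Variable G : mgraph R.
Implicit Types (s : 'I_(nE G) * bool) (ss : seq ('I_(nE G) * bool)) (p q : gpoint G) (o : R).

Let adj (a b : 'I_(nE G) * bool) :=
  ((step_ends a).2 == (step_ends b).1) && ((step_ends a).2 != None).

Definition step_pos s p : R := if s.2 then p.2 else glen G s.1 - p.2.

(** Arc length along the walk, started at the offset [o]. In the walks considered, a halfline occurs
    only as the last step, traversed forwards, so the arbitrary [glen] of a halfline is never
    counted. *)
Fixpoint walk_pos o ss p : R := if ss is s :: ss' then
  if s.1 == p.1 then o + step_pos s p else walk_pos (o + glen G s.1) ss' p else 0.

Definition entry_pt s : gpoint G := (s.1, if s.2 then 0 else glen G s.1).
Definition exit_pt s : gpoint G := (s.1, if s.2 then glen G s.1 else 0).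

Lemma in_dom_entry s : in_dom (entry_pt s).
Proof. by rewrite /entry_pt; case: (s.2); [exact: in_dom0|exact: in_dom_len]. Qed.

Lemma in_dom_exit s : in_dom (exit_pt s).
Proof. by rewrite /exit_pt; case: (s.2); [exact: in_dom_len|exact: in_dom0]. Qed.

Lemma vtx_of_entry s v : (step_ends s).1 = Some v -> vtx_of (entry_pt s) = Some v.
Proof.
rewrite /step_ends /entry_pt; case: (s.2) => /=; last exact: vtx_of_len.
by rewrite vtx_of0.
Qed.

Lemma vtx_of_exit s v : (step_ends s).2 = Some v -> vtx_of (exit_pt s) = Some v.
Proof.
rewrite /step_ends /exit_pt; case: (s.2) => /=; first exact: vtx_of_len.
by rewrite vtx_of0.
Qed.

Lemma step_pos_entry s : step_pos s (entry_pt s) = 0.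
Proof. by rewrite /step_pos /entry_pt; case: (s.2) => //=; rewrite subrr. Qed.

Lemma step_pos_exit s : step_pos s (exit_pt s) = glen G s.1.
Proof. by rewrite /step_pos /exit_pt; case: (s.2) => //=; rewrite subr0. Qed.

Lemma step_pos_ge0 s v p : (step_ends s).1 = Some v -> in_dom p -> p.1 = s.1 ->
  0 <= step_pos s p.
Proof.
rewrite /step_ends /step_pos /in_dom => + + ps; rewrite ps.
case: (s.2) => /= [_ /andP[]//|->]; by rewrite subr_ge0 => /andP[].
Qed.

Lemma step_pos_le s v p : (step_ends s).2 = Some v -> in_dom p -> p.1 = s.1 ->
  step_pos s p <= glen G s.1.
Proof.
rewrite /step_ends /step_pos /in_dom => + + ps; rewrite ps.
by case: (s.2) => /= [-> /andP[]//|_ /andP[? _]]; rewrite gerBl.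
Qed.

Lemma step_posB s p q : `|step_pos s p - step_pos s q| = `|p.2 - q.2|.
Proof.
rewrite /step_pos; case: (s.2) => //.
by rewrite -normrN; congr `|_|; ring.
Qed.

Lemma step_pos_inj s p q : p.1 = s.1 -> q.1 = s.1 -> step_pos s p = step_pos s q -> p = q.
Proof.
case: p q => [e x] [f y] /= -> -> /eqP; rewrite -subr_eq0 -normr_eq0 step_posB.
by rewrite normr_eq0 subr_eq0 => /eqP /= ->.
Qed.

Lemma walk_pos_affine o ss (e : 'I_(nE G)) : e \in map fst ss ->
  exists k c : R, (k = 1 \/ k = -1) /\ forall x, walk_pos o ss (e, x) = k * x + c.
Proof.
elim: ss o => [//|s ss IH] o /=; rewrite inE eq_sym; case: eqP => /= [se _|_]; last exact: IH.
rewrite /step_pos; case: (s.2) => /=.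
  by exists 1, o; split; [left|move=> x; rewrite mul1r addrC].
by exists (-1), (o + glen G s.1); split; [right|move=> x; ring].
Qed.

Section walk.

Let on ss p := in_dom p && (p.1 \in map fst ss).

Lemma walk_posP o s ss v : path adj s ss -> (step_ends (last s ss)).2 = None ->
  (step_ends s).1 = Some v -> uniq (map fst (s :: ss)) ->
  [/\ forall p, on (s :: ss) p -> o <= walk_pos o (s :: ss) p,
      forall p q, on (s :: ss) p -> in_dom q -> vtx_of q = Some v ->
         reach q p (walk_pos o (s :: ss) p - o),
      forall p, on (s :: ss) p -> walk_pos o (s :: ss) p = o -> vtx_of p = Some v &
      [/\ forall p q, on (s :: ss) p -> on (s :: ss) q ->
           reach p q `|walk_pos o (s :: ss) p - walk_pos o (s :: ss) q|,
         forall p q, on (s :: ss) p -> on (s :: ss) q ->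
           walk_pos o (s :: ss) p = walk_pos o (s :: ss) q -> same_pt p q &
         forall t, o <= t -> exists2 p, on (s :: ss) p & walk_pos o (s :: ss) p = t]].
Proof.
elim: ss s o v => [|s' ss IH] s o v.
  rewrite [last _ _]/= => _ sN sv _.
  have onE p : on [:: s] p -> in_dom p /\ p.1 = s.1.
    by rewrite /on /= inE => /andP[-> /eqP].
  have posE p : p.1 = s.1 -> walk_pos o [:: s] p = o + step_pos s p.
    by move=> /= ps; rewrite ps eqxx.
  have s2 : s.2 = true by move: sN; rewrite /step_ends; case: (s.2).
  have tN : gtl G s.1 = None by move: sN; rewrite /step_ends s2.
  split.
  - move=> p /onE[pd ps]; rewrite posE// lerDl; exact: step_pos_ge0 sv pd ps.
  - move=> p q /onE[pd ps] qd qv; rewrite posE// addrAC subrr add0r.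
    have -> : step_pos s p = 0 + `|(entry_pt s).2 - p.2|.
      by rewrite add0r -(step_posB s) step_pos_entry sub0r normrN ger0_norm ?(step_pos_ge0 sv).
    apply: (@reach_cat _ _ q q (entry_pt s)).
    + by have := reach_edge qd qd erefl; rewrite subrr normr0.
    + exact: same_pt_vtx qv (vtx_of_entry sv).
    + by apply: reach_edge => //; exact: in_dom_entry.
  - move=> p /onE[pd ps]; rewrite posE// => /eqP; rewrite -subr_eq0 addrAC subrr add0r => /eqP h.
    rewrite (@step_pos_inj s p (entry_pt s))//; first exact: vtx_of_entry.
    by rewrite step_pos_entry.
  split.
  - move=> p q /onE[pd ps] /onE[qd qs]; rewrite !posE// opprD addrACA subrr add0r step_posB.
    by apply: reach_edge => //; rewrite ps.
  - move=> p q /onE[pd ps] /onE[qd qs]; rewrite !posE// => /addrI /(step_pos_inj ps qs) ->.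
    exact: same_pt_refl.
  - move=> t ot; exists (s.1, t - o).
      by rewrite /on /= inE eqxx andbT /in_dom /= subr_ge0 ot tN.
    by rewrite posE// /step_pos s2 /= addrC subrK.
rewrite [path _ _ _]/= [last _ _]/= [uniq _]/= -/(map fst (s' :: ss)).
move=> /andP[/andP[/eqP ss' sN] pth] lst sv /andP[sni unq].
case E : (step_ends s).2 ss' sN => [w|//] ss' _.
have [I1 I2 I3 [I4 I5 I6]] := IH s' (o + glen G s.1) w pth lst (esym ss') unq.
pose L := glen G s.1.
have L0 : 0 < L by exact: glen_gt0.
pose f := walk_pos o [:: s, s' & ss]; pose f' := walk_pos (o + L) (s' :: ss).
have fs p : p.1 = s.1 -> f p = o + step_pos s p by move=> ps; rewrite /f /= ps eqxx.
have fn p : p.1 <> s.1 -> f p = f' p by move=> ps; rewrite /f /f' /=; case: eqP => // /esym.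
have onE p : on [:: s, s' & ss] p -> in_dom p /\ (p.1 = s.1 \/ p.1 <> s.1 /\ on (s' :: ss) p).
  rewrite /on => /andP[pd]; rewrite [map _ _]/= inE => /orP[/eqP ps|pin]; split=> //; first by left.
  right; split; last by rewrite pd.
  by move=> ps; move: sni; rewrite -ps pin.
have onS p : on (s' :: ss) p -> on [:: s, s' & ss] p.
  move=> /andP[pd pin]; rewrite /on pd /= in_cons; apply/orP; right; exact: pin.
have onS' p : on (s' :: ss) p -> p.1 <> s.1.
  by rewrite /on => /andP[_ pin] ps; move: sni; rewrite -ps pin.
have ge0 p : in_dom p -> p.1 = s.1 -> 0 <= step_pos s p by move=> *; exact: step_pos_ge0 sv _ _.
have leL p : in_dom p -> p.1 = s.1 -> step_pos s p <= L by move=> *; exact: step_pos_le E _ _.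
have ed := in_dom_entry s; have xd := in_dom_exit s.
have ev := vtx_of_entry sv; have xv := vtx_of_exit E.
(* The chain leaves the first edge through its exit point, at position [o + L]. *)
have first_rest p q : in_dom p -> p.1 = s.1 -> on (s' :: ss) q -> reach p q (f' q - (o + step_pos s p)).
  move=> pd ps qon.
  have -> : f' q - (o + step_pos s p) = `|p.2 - (exit_pt s).2| + (f' q - (o + L)).
    rewrite -(step_posB s) step_pos_exit ler0_norm ?subr_le0 ?leL//.
    by rewrite /L; ring.
  apply: (@reach_cat _ _ p (exit_pt s) (exit_pt s)); last exact: I2.
  - by apply: reach_edge.
  - exact: same_pt_refl.
split.
- move=> p /onE[pd [ps|[ps pon]]]; rewrite -/(f p).
    by rewrite fs// lerDl ge0.
  by rewrite fn//; apply: le_trans (I1 p pon); rewrite lerDl ltW.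
- move=> p q /onE[pd [ps|[ps pon]]] qd qv; rewrite -/(f p).
    rewrite fs// addrAC subrr add0r.
    have -> : step_pos s p = 0 + `|(entry_pt s).2 - p.2|.
      by rewrite add0r -(step_posB s) step_pos_entry sub0r normrN ger0_norm ?ge0.
    apply: (@reach_cat _ _ q q (entry_pt s)).
    + by have := reach_edge qd qd erefl; rewrite subrr normr0.
    + exact: same_pt_vtx qv ev.
    + by apply: reach_edge.
  rewrite fn//.
  have -> : f' p - o = 0 + (f' p - (o + step_pos s (entry_pt s))).
    by rewrite step_pos_entry addr0 add0r.
  apply: (@reach_cat _ _ q q (entry_pt s)); last exact: first_rest.
  + by have := reach_edge qd qd erefl; rewrite subrr normr0.
  + exact: same_pt_vtx qv ev.
- move=> p /onE[pd [ps|[ps pon]]]; rewrite -/(f p).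
    rewrite fs// => /eqP; rewrite -subr_eq0 addrAC subrr add0r => /eqP h.
    rewrite (@step_pos_inj s p (entry_pt s))//.
    by rewrite step_pos_entry.
  rewrite fn// => fo; exfalso.
  by have := I1 p pon; rewrite -/(f' p) fo -/L; move: L0; lra.
split.
- move=> p q /onE[pd [ps|[ps pon]]] /onE[qd [qs|[qs qon]]]; rewrite -/(f p) -/(f q).
  + rewrite !fs// opprD addrACA subrr add0r step_posB.
    by apply: reach_edge => //; rewrite ps.
  + have := first_rest p q pd ps qon; rewrite fs// fn// distrC ger0_norm//.
    rewrite subr_ge0; apply: le_trans (I1 q qon); rewrite lerD2l; exact: leL.
  + have := first_rest q p qd qs pon; rewrite (fs q)// (fn p)// ger0_norm.
      exact: reach_sym.
    rewrite subr_ge0; apply: le_trans (I1 p pon); rewrite lerD2l; exact: leL.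
  + by rewrite !fn//; exact: I4.
(* Positions are at most [o + L] on the first edge and at least [o + L] on the rest, so they agree
   only at the junction. *)
- have mixed p q : in_dom p -> p.1 = s.1 -> on (s' :: ss) q -> o + step_pos s p = f' q -> same_pt p q.
    move=> pd ps qon h; have h1 := I1 q qon; have h2 := leL p pd ps.
    have h3 : f' q = o + L by rewrite -/(f' q) -/L in h1; move: h h1 h2; lra.
    apply: same_pt_vtx (I3 q qon h3).
    rewrite (@step_pos_inj s p (exit_pt s))// step_pos_exit -/L.
    by move: h3; rewrite -h => /addrI.
  move=> p q /onE[pd [ps|[ps pon]]] /onE[qd [qs|[qs qon]]]; rewrite -/(f p) -/(f q).
  + rewrite !fs// => /addrI /(step_pos_inj ps qs) ->; exact: same_pt_refl.
  + by rewrite fs// fn//; exact: mixed.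
  + by rewrite (fs q)// (fn p)// => h; apply: same_pt_sym; exact: mixed.
  + by rewrite !fn//; exact: I5.
- move=> t ot; have [tL|Lt] := leP t (o + L); last first.
    have [p pon h] := I6 t (ltW Lt); exists p; first exact: onS.
    by rewrite -/(f p) fn//; exact: onS'.
  exists (s.1, if s.2 then t - o else L - (t - o)).
    rewrite /on [map _ _]/= inE eqxx andbT /in_dom /=.
    by case: (s.2); case: (gtl G s.1) => [?|] /=; rewrite -/L ?andbT; try apply/andP; try split; move: ot tL; lra.
  rewrite -/(f _) fs// /step_pos; case: (s.2) => /=; rewrite -/L; lra.
Qed.

End walk.

(** The first edge of a trail is a halfline coming from infinity. It receives the negative
    positions, and the origin is its vertex. *)
Definition trail_pos s0 ss p : R := if p.1 == s0.1 then - p.2 else walk_pos 0 ss p.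

Lemma trail_pos_affine s0 ss (e : 'I_(nE G)) : e \in map fst (s0 :: ss) ->
  exists k c : R, (k = 1 \/ k = -1) /\ forall x, trail_pos s0 ss (e, x) = k * x + c.
Proof.
rewrite /trail_pos /= inE; case: eqP => [_ _|_ /=]; last exact: walk_pos_affine.
by exists (-1), 0; split; [right|move=> x; rewrite addr0 mulN1r].
Qed.

(** The position unrolls the trail onto the whole line. Only an upper bound on distances results,
    because the trail may meet itself and allow shortcuts. *)
Lemma trail_posP s0 ss : trail2 s0 ss ->
  let on p := in_dom p && (p.1 \in map fst (s0 :: ss)) in let f := trail_pos s0 ss in
  [/\ forall p q, on p -> on q -> reach p q `|f p - f q|,
      forall p q, on p -> on q -> f p = f q -> same_pt p q &
      forall t, exists2 p, on p & f p = t].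
Proof.
move=> /and4P[pth unq /eqP s0N /eqP lst] on f.
have s2 : s0.2 = false by move: s0N; rewrite /step_ends; case: (s0.2).
have tN : gtl G s0.1 = None by move: s0N; rewrite /step_ends s2.
have sx : (step_ends s0).2 = Some (ghd G s0.1) by rewrite /step_ends s2.
case: ss pth unq lst @on @f => [|s ss] pth unq lst on f; first by move: lst; rewrite /= sx.
move: pth => /= /andP[/andP[/eqP ss0 _] pth].
move: unq => /= /andP[sni unq].
have [I1 I2 I3 [I4 I5 I6]] := walk_posP 0 pth lst (esym (etrans (esym sx) ss0)) unq.
pose f' := walk_pos 0 (s :: ss).
pose on' p := in_dom p && (p.1 \in map fst (s :: ss)).
have fs p : p.1 = s0.1 -> f p = - p.2 by move=> ps; rewrite /f /trail_pos ps eqxx.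
have fn p : p.1 <> s0.1 -> f p = f' p by move=> ps; rewrite /f /trail_pos; case: eqP.
have onE p : on p -> in_dom p /\ (p.1 = s0.1 \/ p.1 <> s0.1 /\ on' p).
  rewrite /on => /andP[pd]; rewrite [map _ _]/= inE => /orP[/eqP ps|pin]; split=> //; first by left.
  right; split; last by rewrite /on' pd.
  by move=> ps; move: sni; rewrite -ps pin.
have onS p : on' p -> on p.
  move=> /andP[pd pin]; rewrite /on pd /= in_cons; apply/orP; right; exact: pin.
have onS' p : on' p -> p.1 <> s0.1.
  by rewrite /on' => /andP[_ pin] ps; move: sni; rewrite -ps pin.
have ge0 p : in_dom p -> 0 <= p.2 by move=> /andP[].
have e0d := in_dom0 s0.1; have e0v := vtx_of0 s0.1.
have first_rest p q : in_dom p -> p.1 = s0.1 -> on' q -> reach p q (f' q + p.2).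
  move=> pd ps qon.
  have -> : f' q + p.2 = `|p.2 - 0| + (f' q - 0) by rewrite !subr0 ger0_norm ?ge0// addrC.
  apply: (@reach_cat _ _ p (s0.1, 0) (s0.1, 0)); last exact: I2.
  - by have := reach_edge pd e0d ps.
  - exact: same_pt_refl.
split.
- move=> p q /onE[pd [ps|[ps pon]]] /onE[qd [qs|[qs qon]]].
  + have -> : `|f p - f q| = `|p.2 - q.2| by rewrite !fs// -normrN; congr `|_|; ring.
    by apply: reach_edge => //; rewrite ps.
  + have := first_rest p q pd ps qon; rewrite fs// fn// distrC opprK ger0_norm//.
    by rewrite addr_ge0 ?ge0// I1.
  + have := first_rest q p qd qs pon; rewrite (fs q)// (fn p)// opprK ger0_norm.
      exact: reach_sym.
    by rewrite addr_ge0 ?ge0// I1.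
  + by rewrite !fn//; exact: I4.
- have mixed p q : in_dom p -> p.1 = s0.1 -> on' q -> - p.2 = f' q -> same_pt p q.
    move=> pd ps qon h; have h1 := I1 q qon; have h2 := ge0 p pd.
    have h3 : f' q = 0 by rewrite -/(f' q) in h1; move: h h1 h2; lra.
    apply: same_pt_vtx (I3 q qon h3).
    have -> : p = (s0.1, 0).
      by case: p ps h {pd h2} => e x /= -> /eqP; rewrite h3 oppr_eq0 => /eqP->.
    by [].
  move=> p q /onE[pd [ps|[ps pon]]] /onE[qd [qs|[qs qon]]].
  + rewrite !fs// => /oppr_inj h.
    have -> : p = q by case: p q ps qs h {pd qd} => e x [e' y] /= -> -> ->.
    exact: same_pt_refl.
  + by rewrite fs// fn//; exact: mixed.
  + by rewrite (fs q)// (fn p)// => h; apply: same_pt_sym; exact: mixed.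
  + by rewrite !fn//; exact: I5.
- move=> t; have [t0|t0] := leP 0 t.
    have [p pon h] := I6 t t0; exists p; first exact: onS.
    by rewrite fn//; exact: onS'.
  exists (s0.1, - t); last by rewrite fs//= opprK.
  by rewrite /on [map _ _]/= inE eqxx andbT /in_dom/= tN andbT oppr_ge0 ltW.
Qed.

End TrailPosition.

(** * Piecewise isometric changes of variables *)

Section AffineInvariance.
Context {R : realType}.
Notation mu := (@lebesgue_measure R).
Implicit Types (k c a b : R).

Definition affine_map k c : measurableTypeR R -> measurableTypeR R := fun x => k * x + c.

Let maff k c : measurable_fun setT (affine_map k c).
Proof. by apply: measurable_funD => //; exact: measurable_funM. Qed.

HB.instance Definition _ k c :=
  isMeasurableFun.Build _ _ _ _ (affine_map k c) (maff k c).

Let aff_itv k c a b : k = 1 \/ k = -1 -> mu (affine_map k c @^-1` `]a, b]) = mu `]a, b].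
Proof.
case=> ->.
  have -> : affine_map 1 c @^-1` `]a, b] = `]a - c, b - c]%classic.
    by apply/seteqP; split => x /=; rewrite /affine_map !in_itv/= mul1r => /andP[? ?]; apply/andP; split; lra.
  rewrite !lebesgue_measure_itv/= !lte_fin; congr (if _ then _ else _); first by apply/idP/idP; lra.
  by rewrite -!EFinD; congr EFin; ring.
have -> : affine_map (-1) c @^-1` `]a, b] = `[c - b, c - a[%classic.
  by apply/seteqP; split => x /=; rewrite /affine_map !in_itv/= mulN1r => /andP[? ?]; apply/andP; split; lra.
rewrite !lebesgue_measure_itv/= !lte_fin; congr (if _ then _ else _); first by apply/idP/idP; lra.
by rewrite -!EFinD; congr EFin; ring.
Qed.

(** As [k * k = 1], the inverse map has the same slope, so the image of [J] is a measurable
    preimage. Lebesgue measure is invariant since the map preserves the lengths of half-open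
    intervals, even when a reflection moves the open end. *)
Lemma integral_affine k c (J : set (measurableTypeR R)) (F : R -> \bar R) :
  k = 1 \/ k = -1 -> measurable J -> measurable_fun [set: measurableTypeR R] F -> (forall x, 0 <= F x)%E ->
  measurable ((fun x => k * x + c) @` J : set (measurableTypeR R)) /\
  (\int[mu]_(x in J) F (k * x + c)%R = \int[mu]_(y in (fun x => k * x + c)%R @` J) F y)%E.
Proof.
move=> k1 mJ mF F0.
have kk : k * k = 1 by case: k1 => ->; ring.
have imE : (fun x => k * x + c) @` J = affine_map k (- (k * c)) @^-1` J.
  apply/seteqP; split => [_ [x Jx <-]|y Jy] /=.
    by rewrite /affine_map (_ : k * _ + _ = x)//; ring: kk.
  exists (affine_map k (- (k * c)) y) => //; rewrite /affine_map; ring: kk.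
have mI : measurable ((fun x => k * x + c) @` J : set (measurableTypeR R)).
  by rewrite imE -[X in measurable X]setTI; exact: maff.
split => //.
have preE : affine_map k c @^-1` ((fun x => k * x + c) @` J) = J.
  apply/seteqP; split => [x [y Jy]|x Jx] /=; last by exists x.
  rewrite /affine_map => /addIr /(congr1 (fun z => k * z)); rewrite !mulrA kk !mul1r => <- //.
rewrite -[in LHS]preE.
transitivity (\int[pushforward mu (affine_map k c)]_(y in (fun x => (k * x + c)%R) @` J) F y)%E.
  rewrite ge0_integral_pushforward//; exact: measurable_funS mF.
apply: eq_measure_integral => A mA _.
apply/esym/(@lebesgue_measure_unique R (pushforward mu (affine_map k c))) => // X.
by move=> [[a b] _ <-]; rewrite /= /pushforward aff_itv.
Qed.

End AffineInvariance.

Section LocalIsometry.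
Context {R : realType}.
Notation mu := (@lebesgue_measure R).
Implicit Types (f : R -> R) (a x y : R) (b : option R) (Q : seq R).

Definition local_isom f x := exists2 d, 0 < d &
  forall y z, `|y - x| < d -> `|z - x| < d -> `|f y - f z| = `|y - z|.

Lemma locally_constant f (a b : R) : a <= b ->
  (forall x, a <= x <= b -> exists2 d, 0 < d & forall y, a <= y <= b -> `|y - x| < d -> f y = f x) ->
  f b = f a.
Proof.
move=> ab H; apply/eqP; rewrite -subr_eq0 -normr_le0.
have := @local_dominated_variation R f (fun=> 0) a b ab; rewrite subrr; apply => //.
move=> x /H[d d0 hd]; exists d => // y yab yx.
by rewrite (hd y yab yx) subrr.
Qed.

(** Polarisation: the squared distances between [x], [x + h] and [y] determine the product of the
    increments of [f], and the increment over [h] fixes the sign [k]. *)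
Lemma local_isom_affine f x : local_isom f x -> exists k d,
  [/\ k = 1 \/ k = -1, 0 < d & forall y, `|y - x| < d -> f y = f x + k * (y - x)].
Proof.
move=> [d d0 H]; pose h := d / 2.
have h0 : 0 < h by rewrite divr_gt0.
have xx : `|x - x| < d by rewrite subrr normr0.
have xh : `|x + h - x| < d by rewrite addrAC subrr add0r gtr0_norm// /h; lra.
pose k := (f (x + h) - f x) / h.
have kh : f (x + h) - f x = k * h by rewrite /k divfK// gt_eqF.
have sq (p q : R) : `|p| = `|q| -> p ^+ 2 = q ^+ 2.
  by move=> pq; rewrite -[LHS]real_normK ?num_real// pq real_normK ?num_real.
have k2 : k ^+ 2 = 1.
  have := sq _ _ (H _ _ xh xx); rewrite kh addrAC subrr add0r exprMn => /eqP.
  by rewrite -subr_eq0 -{2}[h ^+ 2]mul1r -mulrBl mulf_eq0 subr_eq0 sqrf_eq0 (gt_eqF h0) orbF => /eqP.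
exists k, d; split => //.
  by move/eqP: k2; rewrite sqrf_eq1 => /orP[] /eqP; auto.
move=> y yx.
have e1 := sq _ _ (H _ _ yx xx).
have e2 := sq _ _ (H _ _ yx xh).
have e3 : (f y - f x) * (k * h) = (y - x) * h.
  move: e1 e2; have -> : f (x + h) = f x + k * h by rewrite -kh; ring.
  move=> e1 e2; apply: (@mulfI _ 2) => //.
  have -> : 2 * ((f y - f x) * (k * h)) = (f y - f x) ^+ 2 + k ^+ 2 * h ^+ 2 - (f y - (f x + k * h)) ^+ 2 by ring.
  by rewrite e1 e2 k2; ring.
have e4 : (f y - f x) * k = y - x by apply: (@mulIf _ h); rewrite ?gt_eqF// -mulrA.
by rewrite -e4; ring: k2.
Qed.

Definition open_itv a b : interval R := Interval (BRight a) (if b is Some b then BLeft b else +oo%O).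

Lemma in_open_itv a b x : (x \in open_itv a b) = (a < x) && (if b is Some b then x < b else true).
Proof. by case: b => [b|]; rewrite in_itv/= ?andbT. Qed.

Lemma open_itv_between a b x y z : x \in open_itv a b -> y \in open_itv a b -> x <= z <= y ->
  z \in open_itv a b.
Proof.
rewrite !in_open_itv => /andP[ax _] /andP[_ yb] /andP[xz zy]; rewrite (lt_le_trans ax xz) /=.
by case: b yb => [b|//]; exact: le_lt_trans.
Qed.

(** The slope is locally constant, hence constant on the interval; then the intercept
    [f x - k x0 * x] is constant for the same reason. *)
Lemma local_isom_itv f a b : (forall x, x \in open_itv a b -> local_isom f x) ->
  exists k c : R, (k = 1 \/ k = -1) /\ forall x, x \in open_itv a b -> f x = k * x + c.
Proof.
move=> H.
have [[x0 x0i]|nex] := pselect (exists x, x \in open_itv a b); last first.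
  by exists 1, 0; split; [left|move=> x xi; exfalso; apply: nex; exists x].
have /choice[kd hkd] : forall x, exists kd : R * R, x \in open_itv a b ->
  [/\ kd.1 = 1 \/ kd.1 = -1, 0 < kd.2 & forall y, `|y - x| < kd.2 -> f y = f x + kd.1 * (y - x)].
  move=> x; have [xi|_] := boolP (x \in open_itv a b); last by exists (0, 0).
  by have [k [d kd]] := local_isom_affine (H x xi); exists (k, d).
pose k x := (kd x).1; pose d x := (kd x).2.
have kloc x y : x \in open_itv a b -> y \in open_itv a b -> `|y - x| < d x -> k y = k x.
  move=> xi yi yx; have [_ dx hx] := hkd x xi; have [_ dy hy] := hkd y yi.
  (* Chosen so that [y + e] lies in both neighbourhoods, where the two affine formulas can be
     compared. *)
  pose e := Num.min (d y) (d x - `|y - x|) / 2.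
  have m0 : 0 < Num.min (d y) (d x - `|y - x|) by rewrite lt_min dy subr_gt0.
  have e0 : 0 < e by rewrite divr_gt0.
  have [e1 e2] : e < d y /\ e < d x - `|y - x|.
    have : e < Num.min (d y) (d x - `|y - x|) by rewrite ltr_pdivrMr// ltr_pMr// ltr1n.
    by rewrite lt_min => /andP[].
  have zy : `|y + e - y| < d y by rewrite addrAC subrr add0r gtr0_norm.
  have zx : `|y + e - x| < d x.
    rewrite addrAC (le_lt_trans (ler_normD _ _))// (@gtr0_norm _ e)//.
    by rewrite -ltrBrDl.
  have := hy _ zy; rewrite (hx _ zx) (hx _ yx) -/(k x) -/(k y) => E.
  have /eqP : (k x - k y) * e = 0.
    have -> : (k x - k y) * e = f x + k x * (y + e - x) -
      (f x + k x * (y - x) + k y * (y + e - y)) by ring.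
    by rewrite E subrr.
  by rewrite mulf_eq0 (gt_eqF e0) orbF subr_eq0 => /eqP.
have glob (F : R -> R) : (forall x, x \in open_itv a b -> exists2 r, 0 < r &
    forall y, y \in open_itv a b -> `|y - x| < r -> F y = F x) ->
    forall x, x \in open_itv a b -> F x = F x0.
  move=> loc x xi; have [le_|/ltW le_] := leP x0 x; [|symmetry]; apply: locally_constant => // z zi.
    have [r r0 hr] := loc z (open_itv_between x0i xi zi); exists r => // y yi.
    by apply: hr; exact: open_itv_between yi.
  have [r r0 hr] := loc z (open_itv_between xi x0i zi); exists r => // y yi.
  by apply: hr; exact: open_itv_between yi.
have kx : forall x, x \in open_itv a b -> k x = k x0.
  by apply: glob => x xi; have [_ dx _] := hkd x xi; exists (d x) => // y yi; exact: kloc.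
exists (k x0), (f x0 - k x0 * x0); split; first by have [] := hkd x0 x0i.
move=> x xi.
have : f x - k x0 * x = f x0 - k x0 * x0.
  apply: (glob (fun x => f x - k x0 * x)) => // z zi.
  have [_ dz hz] := hkd z zi; exists (d z) => // y yi yz.
  by rewrite (hz y yz) -/(k z) kx//; ring.
by move=> <-; ring.
Qed.

Definition punctured a b Q : set (measurableTypeR R) := [set` open_itv a b] `\` [set` Q].

Lemma puncturedE a b Q x :
  punctured a b Q x = [&& a < x, (if b is Some b then x < b else true) & x \notin Q] :> Prop.
Proof.
rewrite andbA -in_open_itv; apply/propext; split => [[xi /negP xQ]|/andP[xi xQ]].
  by apply/andP; split.
by split => //; exact/negP.
Qed.

Lemma punctured_notin a b Q q : q \notin open_itv a b -> punctured a b (q :: Q) = punctured a b Q.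
Proof.
move=> qi; apply/seteqP; split => x [xi xQ]; split => //= xq; apply: xQ => /=.
  by rewrite inE xq orbT.
by move: xq; rewrite inE => /orP[/eqP xq|//]; move: qi; rewrite -xq (xi : x \in open_itv a b).
Qed.

Lemma punctured_split a b Q q : q \in open_itv a b ->
  punctured a b (q :: Q) = punctured a (Some q) Q `|` punctured q b Q.
Proof.
rewrite in_open_itv => /andP[aq qb]; apply/seteqP; split => x.
  rewrite /setU/= !puncturedE inE negb_or => /and4P[-> -> xq ->]; rewrite !andbT /=.
  by apply/orP; rewrite -neq_lt.
case; rewrite !puncturedE inE.
  move=> /and3P[-> xq xQ]; rewrite (negPf xQ) orbF (lt_eqF xq) andbT /=.
  by case: b qb => // b'; exact: lt_trans.
by move=> /and3P[qx -> xQ]; rewrite (negPf xQ) orbF (gt_eqF qx) (lt_trans aq qx).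
Qed.

(** Each point of [Q] inside the interval splits it in two, down to pieces on which [f] is affine;
    injectivity keeps the images of the pieces disjoint. *)
Lemma punctured_integral Q a b f :
  (forall x, punctured a b Q x -> local_isom f x) ->
  (forall x y, punctured a b Q x -> punctured a b Q y -> f x = f y -> x = y) ->
  [/\ measurable (punctured a b Q), measurable (f @` punctured a b Q : set (measurableTypeR R)),
      measurable_fun (punctured a b Q) f &
      forall F : R -> \bar R, measurable_fun [set: measurableTypeR R] F -> (forall x, 0 <= F x)%E ->
        (\int[mu]_(x in punctured a b Q) F (f x) = \int[mu]_(y in f @` punctured a b Q) F y)%E].
Proof.
elim: Q a b => [|q Q IH] a b hloc hinj.
  have pE : punctured a b [::] = [set` open_itv a b].
    by apply/seteqP; split => [x []//|x xi]; split.
  rewrite pE in hloc hinj *.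
  have [k [c [k1 fE]]] := local_isom_itv hloc.
  have mI : measurable ([set` open_itv a b] : set (measurableTypeR R)) by exact: measurable_itv.
  have imE : f @` [set` open_itv a b] = (fun x => k * x + c) @` [set` open_itv a b].
    by apply/seteqP; split => _ [x xi <-]; exists x => //; rewrite fE.
  split => //.
  - rewrite imE.
    by case: (integral_affine (F := fun=> 0%E) c k1 mI) => // ; exact: measurable_cst.
  - apply: (eq_measurable_fun (fun x => k * x + c)); first by move=> x; rewrite inE => /fE ->.
    by apply: measurable_funD => //; exact: measurable_funM.
  - move=> F mF F0; rewrite imE -(integral_affine c k1 mI mF F0).2.
    by apply: eq_integral => x; rewrite inE => /fE ->.
have [qi|qi] := boolP (q \in open_itv a b); last first.
  by rewrite punctured_notin// in hloc hinj *; exact: IH.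
have pE := punctured_split Q qi.
have sub1 x : punctured a (Some q) Q x -> punctured a b (q :: Q) x by rewrite pE; left.
have sub2 x : punctured q b Q x -> punctured a b (q :: Q) x by rewrite pE; right.
have [m1 mi1 mf1 I1] := IH a (Some q) (fun x h => hloc x (sub1 x h))
  (fun x y hx hy => hinj x y (sub1 x hx) (sub1 y hy)).
have [m2 mi2 mf2 I2] := IH q b (fun x h => hloc x (sub2 x h))
  (fun x y hx hy => hinj x y (sub2 x hx) (sub2 y hy)).
have disj : [disjoint punctured a (Some q) Q & punctured q b Q].
  apply/disj_setPS => x []; rewrite !puncturedE => /and3P[_ xq _] /and3P[qx _ _].
  by move: (lt_trans xq qx); rewrite ltxx.
have idisj : [disjoint f @` punctured a (Some q) Q & f @` punctured q b Q].
  apply/disj_setPS => _ [[x xi <-] [y yi yx]].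
  have xy := hinj x y (sub1 x xi) (sub2 y yi) (esym yx).
  by move/disj_setPS : disj => /(_ x); apply; split => //; rewrite xy.
rewrite pE image_setU; split.
- exact: measurableU.
- exact: measurableU.
- exact/measurable_funU.
- move=> F mF F0; rewrite !ge0_integral_setU//.
  + by rewrite I1// I2.
  + exact: measurable_funS mF.
  + apply: (measurable_comp (F := setT)) => //.
    exact/measurable_funU.
Qed.

End LocalIsometry.

Section FiniteSets.
Context {R : realType}.
Notation mu := (@lebesgue_measure R).

Lemma measurable_seq (s : seq R) : measurable ([set` s] : set (measurableTypeR R)).
Proof.
apply: countable_measurable; first by move=> x; exact: measurable_set1.
exact/finite_set_countable/finite_seq.
Qed.

Lemma measure0_seq (s : seq R) : mu [set` s] = 0%E.
Proof. by apply: countable_lebesgue_measure0; exact/finite_set_countable/finite_seq. Qed.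

(** An edge and its punctured interior agree off a finite, hence null, set; [odflt 0 b] stands for
    the far end when there is one. *)
Lemma edge_dom_punctured (b : option R) (Q : seq R) :
  edge_dom b `\` [set` [:: 0, odflt 0 b & Q]] =
  punctured 0 b Q `\` [set` [:: 0, odflt 0 b & Q]].
Proof.
apply/seteqP; split => x [xd xN]; split => //.
  move/negP : (xN); rewrite !inE !negb_or => /and3P[xn0 xnl xQ].
  move: xd; rewrite edge_domE puncturedE => /andP[x0 xl].
  rewrite lt_def xn0 x0 xQ andbT /=.
  by case: b xl xnl {xN} => [b|//] /= xb xnb; rewrite lt_neqAle xnb xb.
move: xd; rewrite edge_domE puncturedE => /and3P[x0 xl xQ].
by rewrite (ltW x0)/=; case: b xl {xN} => // b /ltW.
Qed.

End FiniteSets.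

(** * Change of variables from a family of edges to the line *)

Section ChangeOfVariables.
Context {R : realType} {E : finType}.
Notation mu := (@lebesgue_measure R).
Variables (A : {pred E}) (l : E -> option R) (f : E -> R -> R) (Q : E -> seq R) (P : seq R).
Hypothesis isom : forall e x, e \in A -> punctured 0 (l e) (Q e) x -> local_isom (f e) x.
Hypothesis inj : forall e e' x x', e \in A -> e' \in A ->
  punctured 0 (l e) (Q e) x -> punctured 0 (l e') (Q e') x' -> f e x = f e' x' ->
  e = e' /\ x = x'.
Hypothesis cover : forall t, t \notin P ->
  exists e x, [/\ e \in A, punctured 0 (l e) (Q e) x & f e x = t].

(** The images of the punctured edges are disjoint and miss only points of the finite set [P]. *)
Lemma change_of_variables (F : R -> R) : continuous F -> (forall x, 0 <= F x) ->
  (forall e, e \in A -> measurable_fun (edge_dom (l e)) (fun x => F (f e x))) ->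
  (\sum_(e in A) \int[mu]_(x in edge_dom (l e)) (F (f e x))%:E = \int[mu]_x (F x)%:E)%E.
Proof.
move=> cF F0 mFf.
have mF : measurable_fun [set: measurableTypeR R] (fun x => (F x)%:E).
  by apply/measurable_EFinP; exact: continuous_measurable_fun.
have F0' x : (0 <= (F x)%:E)%E by rewrite lee_fin.
pose S e : set (measurableTypeR R) := if e \in A then f e @` punctured 0 (l e) (Q e) else set0.
have piece e : e \in A -> [/\ measurable (punctured 0 (l e) (Q e)), measurable (S e) &
    (\int[mu]_(x in edge_dom (l e)) (F (f e x))%:E = \int[mu]_(y in S e) (F y)%:E)%E].
  move=> eA; have [m1 m2 m3 m4] := punctured_integral (fun x => isom eA)
    (fun x y hx hy h => (inj eA eA hx hy h).2).
  rewrite /S eA; split => //; rewrite -(m4 _ mF F0').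
  pose N : set (measurableTypeR R) := [set` [:: 0, odflt 0 (l e) & Q e]].
  have mN : measurable N by exact: measurable_seq.
  have N0 : mu N = 0%E by exact: measure0_seq.
  rewrite (@ge0_negligible_integral _ _ _ mu _ N)//.
  - rewrite edge_dom_punctured -ge0_negligible_integral//.
    exact: (measurableT_comp mF m3).
  - exact: measurable_edge_dom.
  - by apply/measurable_EFinP; exact: mFf.
have mS e : measurable (S e).
  have [eA|eA] := boolP (e \in A); first by have [] := piece e eA.
  by rewrite /S (negPf eA).
transitivity (\sum_(e in A) \int[mu]_(y in S e) (F y)%:E)%E.
  by apply: eq_bigr => e /piece[].
pose T := \big[setU/set0]_(e <- enum A) S e.
have tS : trivIset [set` enum A] S.
  apply/trivIsetP => e e' _ _ ee'; apply/seteqP; split => // y [].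
  rewrite /S; case: ifPn => // eA [x xp <-]; case: ifPn => // e'A [x' xp' /esym h].
  by have [ee _] := inj eA e'A xp xp' h; move: ee'; rewrite ee eqxx.
have mT : measurable T by apply: bigsetU_measurable => e _; exact: mS.
have mFT : measurable_fun T (fun x => (F x)%:E) by exact: measurable_funS mF.
rewrite -big_enum/= -(ge0_integral_bigsetU mu mS (enum_uniq _) tS mFT)// -/T.
rewrite [RHS](@ge0_negligible_integral _ _ _ mu _ (~` T))//.
- by rewrite setTD setCK.
- exact: measurableC.
- apply: countable_lebesgue_measure0; apply: (@sub_countable _ _ _ [set` P]); last first.
    exact/finite_set_countable/finite_seq.
  apply: subset_card_le => t /= nT; apply: contrapT => /negP /cover[e [x [eA xp xt]]].
  apply: nT; rewrite /T -bigcup_seq; exists e; first by rewrite /= mem_enum.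
  by rewrite /S eA; exists x.
Qed.

Lemma change_of_variables_fin (F : R -> R) (I : R) : continuous F -> (forall x, 0 <= F x) ->
  (forall e, e \in A -> measurable_fun (edge_dom (l e)) (fun x => F (f e x))) ->
  (\int[mu]_x (F x)%:E = I%:E)%E ->
  (forall e, e \in A -> mu.-integrable (edge_dom (l e)) (EFin \o (fun x => F (f e x)))) /\
  \sum_(e in A) \int[mu]_(x in edge_dom (l e)) F (f e x) = I.
Proof.
move=> cF F0 mFf FI; have := change_of_variables cF F0 mFf; rewrite FI => sumI.
have int0 e : (0 <= \int[mu]_(x in edge_dom (l e)) (F (f e x))%:E)%E.
  by apply: integral_ge0 => x _; rewrite lee_fin.
have fin e : e \in A -> (\int[mu]_(x in edge_dom (l e)) (F (f e x))%:E \is a fin_num)%E.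
  move=> eA; rewrite ge0_fin_numE//; apply: (@le_lt_trans _ _ I%:E); last exact: ltry.
  by rewrite -sumI (bigD1 e)//= leeDl// sume_ge0.
split.
  move=> e eA; apply/integrableP; split; first by apply/measurable_EFinP; exact: mFf.
  under eq_integral do rewrite /= ger0_norm//.
  by rewrite -ge0_fin_numE// fin.
apply: EFin_inj; rewrite -sumI -sumEFin; apply: eq_bigr => e eA.
by rewrite fineK// fin.
Qed.

End ChangeOfVariables.

(** * Rigidity of optimizers *)

Section ArcoshPrimitive.
Context {R : realType}.
Variables (M n : R).
Hypotheses (M0 : 0 < M) (n0 : 0 < n).
Implicit Types (s a b : R).

Let t (s : R) := s ^+ 2 / M ^+ 2.
(** The absolute value keeps the root positive for every [s], so the weight below is continuous on
    the whole line; it changes nothing for [|s| <= M]. *)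
Let q (s : R) := Num.sqrt (`|1 - t s ^+ 2| + n).

(* As n tends to 0 this tends to arcosh (M ^ 2 / s ^ 2), the profile coordinate
   of the soliton; the regularisation removes the singularities at 0 and M. *)
Definition arcosh_reg (s : R) :=
  ln (1 + Num.sqrt (1 - (s ^+ 2 / M ^+ 2) ^+ 2 + n)) - ln (s ^+ 2 / M ^+ 2 + n).

(** On [- M, M] this is the modulus of the derivative of [arcosh_reg]. *)
Definition arcosh_reg_weight (s : R) :=
  2 * `|s| / M ^+ 2 * (t s / (q s * (1 + q s)) + (t s + n)^-1).

Let t_ge0 s : 0 <= t s.
Proof. by rewrite divr_ge0 ?sqr_ge0. Qed.

Let q_gt0 s : 0 < q s.
Proof. by rewrite sqrtr_gt0 ltr_wpDl. Qed.

Let q1_gt0 s : 0 < 1 + q s.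
Proof. by rewrite addr_gt0. Qed.

Let tn_gt0 s : 0 < t s + n.
Proof. by rewrite ltr_wpDl. Qed.

Let M2 : M ^+ 2 != 0. Proof. by rewrite expf_neq0// gt_eqF. Qed.

Let t_le1 s : - M <= s <= M -> t s <= 1.
Proof.
move=> sM; rewrite /t ler_pdivrMr ?exprn_gt0// mul1r -(real_normK (num_real s)).
by rewrite lerXn2r ?nnegrE ?(ltW M0)// ler_norml.
Qed.

Let qE s : - M <= s <= M -> q s = Num.sqrt (1 - t s ^+ 2 + n).
Proof.
by move=> /t_le1 t1; rewrite /q ger0_norm// subr_ge0 expr_le1.
Qed.

Let is_derive_t s : is_derive s 1 t (2 * s / M ^+ 2).
Proof.
have := is_derive_mulf (is_derive_expf 1 (is_derive_id s 1)) (is_derive_constf (M ^+ 2)^-1 s).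
by move=> /is_derive_eq; apply; rewrite expr1; field; rewrite gt_eqF.
Qed.

Let continuous_t : continuous t.
Proof. by move=> s; exact: is_derive_continuous (is_derive_t s). Qed.

Let continuous_q : continuous q.
Proof.
move=> s; apply: (@continuous_comp _ _ _ (fun s => `|1 - t s ^+ 2| + n) Num.sqrt); last exact: sqrt_continuous.
apply: cvgD; last exact: cvg_cst.
apply: cvg_norm; apply: cvgB; first exact: cvg_cst.
by apply: (@continuous_comp _ _ _ t (fun y => y ^+ 2)); [exact: continuous_t|exact: exprn_continuous].
Qed.

Lemma continuous_arcosh_reg_weight : continuous arcosh_reg_weight.
Proof.
move=> s; apply: cvgM.
  apply: cvgM; last exact: cvg_cst.
  by apply: cvgM; [exact: cvg_cst|exact: cvg_norm].
apply: cvgD.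
  apply: cvgM; first exact: continuous_t.
  apply: cvgV; first by rewrite mulf_neq0// gt_eqF.
  apply: cvgM; first exact: continuous_q.
  by apply: cvgD; [exact: cvg_cst|exact: continuous_q].
apply: cvgV; first by rewrite gt_eqF.
by apply: cvgD; [exact: continuous_t|exact: cvg_cst].
Qed.

Let core_ge0 s : 0 <= t s / (q s * (1 + q s)) + (t s + n)^-1.
Proof.
apply: addr_ge0; last by rewrite invr_ge0 ltW.
by apply: divr_ge0 => //; apply: mulr_ge0; exact: ltW.
Qed.

Lemma arcosh_reg_weight_ge0 s : 0 <= arcosh_reg_weight s.
Proof.
apply: mulr_ge0; last exact: core_ge0.
by apply: divr_ge0; [exact: mulr_ge0|exact: sqr_ge0].
Qed.

Let is_derive_arcosh_reg s : - M <= s <= M ->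
  is_derive s 1 arcosh_reg (- (2 * s / M ^+ 2 * (t s / (q s * (1 + q s)) + (t s + n)^-1))).
Proof.
move=> sM.
have d2 := is_derive_expf 1 (is_derive_t s).
have d3 := is_derive_addf (is_derive_subf (is_derive_constf 1 s) d2) (is_derive_constf n s).
have g0 : 0 < 1 - t s ^+ 2 + n.
  by rewrite ltr_wpDl// subr_ge0 expr_le1// t_le1.
have d4 := is_derive_sqrtf (f := fun s => 1 - t s ^+ 2 + n) g0 d3.
have d5 := is_derive_addf (is_derive_constf 1 s) d4.
have g1 : 0 < 1 + Num.sqrt (1 - t s ^+ 2 + n) by rewrite -qE.
have d6 := is_derive_compf (g := fun s => 1 + Num.sqrt (1 - t s ^+ 2 + n)) (is_derive1_ln g1) d5.
have d7 := is_derive_addf (is_derive_t s) (is_derive_constf n s).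
have d8 := is_derive_compf (g := fun s => t s + n) (is_derive1_ln (tn_gt0 s)) d7.
have := is_derive_subf d6 d8.
move=> /is_derive_eq; apply; rewrite -qE// expr1.
have := lt0r_neq0 (q_gt0 s); have := lt0r_neq0 (q1_gt0 s); have := lt0r_neq0 (tn_gt0 s).
move: (q s) (t s) => a b h1 h2 h3; field.
by rewrite h1 h2 h3 lt0r_neq0.
Qed.

Lemma arcosh_reg_mean_value a b : - M <= a -> a < b -> b <= M ->
  exists2 s, a <= s <= b & `|arcosh_reg b - arcosh_reg a| <= arcosh_reg_weight s * (b - a).
Proof.
move=> Ma ab bM.
have d s : a < s < b -> is_derive s 1 arcosh_reg
    (- (2 * s / M ^+ 2 * (t s / (q s * (1 + q s)) + (t s + n)^-1))).
  move=> /andP[as_ sb]; apply: is_derive_arcosh_reg.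
  by rewrite (le_trans Ma (ltW as_)) (le_trans (ltW sb)).
apply: (mean_value_le ab d).
- apply/subspace_continuousP => s /=; rewrite in_itv/= => /andP[as_ sb].
  apply: cvg_within_filter; apply: (is_derive_continuous (is_derive_arcosh_reg _)).
  by rewrite (le_trans Ma as_) (le_trans sb).
- move=> s _; rewrite normrN !normrM (@ger0_norm _ (M ^+ 2)^-1) ?invr_ge0 ?sqr_ge0//.
  by rewrite (@ger0_norm _ 2)// (@ger0_norm _ (_ + _)) ?core_ge0.
Qed.

(** The bound is uniform in [n]: the zero of [gn_weight] at [M] and its linear decay at 0 offset the
    two singularities. After scaling, the two summands of the weight contribute at most [1 - p] and
    [p]. *)
Lemma arcosh_reg_weight_le s : `|s| <= M ->
  arcosh_reg_weight s * gn_weight M s <= 2 * M ^+ 2.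
Proof.
rewrite ler_norml => sM; have t1 := t_le1 sM.
pose p := Num.sqrt (1 - t s ^+ 2).
have p0 : 0 <= p by rewrite sqrtr_ge0.
have p2 : p ^+ 2 = 1 - t s ^+ 2 by rewrite sqr_sqrtr// subr_ge0 expr_le1.
have pq : p <= q s by rewrite qE// ler_wsqrtr// lerDl ltW.
have -> : gn_weight M s = `|s| * (M ^+ 2 * p).
  congr (_ * _); rewrite /p -[X in X * Num.sqrt _]ger0_norm ?sqr_ge0// -sqrtr_sqr -sqrtrM ?sqr_ge0//.
  by congr Num.sqrt; rewrite /t; field; rewrite gt_eqF.
rewrite /arcosh_reg_weight.
have -> : 2 * `|s| / M ^+ 2 * (t s / (q s * (1 + q s)) + (t s + n)^-1) * (`|s| * (M ^+ 2 * p)) =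
   2 * M ^+ 2 * (t s * p * (t s / (q s * (1 + q s)) + (t s + n)^-1)).
  have s2 : `|s| ^+ 2 = t s * M ^+ 2 by rewrite real_normK ?num_real// /t divfK.
  move: (t s / _ + _) => X; transitivity (2 * `|s| ^+ 2 * X * p); last by rewrite s2; ring.
  by field; rewrite gt_eqF.
rewrite ger_pMr; last by rewrite mulr_gt0 ?exprn_gt0.
rewrite mulrDr.
have h1 : t s * p * (t s / (q s * (1 + q s))) <= 1 - p.
  have -> : 1 - p = t s ^+ 2 / (1 + p).
    have -> : t s ^+ 2 = 1 - p ^+ 2 by rewrite p2; ring.
    by field; rewrite gt_eqF// ltr_wpDr.
  have -> : t s * p * (t s / (q s * (1 + q s))) = t s ^+ 2 * (p / q s * (1 + q s)^-1).
    by field; rewrite !gt_eqF.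
  rewrite ler_wpM2l ?sqr_ge0// -[leRHS]mul1r ler_pM ?divr_ge0 ?invr_ge0 ?(ltW (q_gt0 _)) ?(ltW (q1_gt0 _))//.
    by rewrite ler_pdivrMr// mul1r.
  by rewrite lef_pV2 ?posrE ?lerD2l// ltr_wpDr.
have h2 : t s * p * (t s + n)^-1 <= p.
  by rewrite mulrAC ler_piMl// ler_pdivrMr// mul1r lerDl ltW.
by have := lerD h1 h2; rewrite subrK.
Qed.

End ArcoshPrimitive.

(** * The profile on one edge when the defect vanishes *)

Section EdgeProfile.
Context {R : realType}.
Notation mu := (@lebesgue_measure R).
Variables (l : option R) (u g : R -> R) (M c : R).
Hypotheses (H : H1_edge (edge_dom l) u g) (M0 : 0 < M) (c0 : 0 <= c).
Hypothesis uM : forall x, edge_dom l x -> `|u x| <= M.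
Hypothesis iod : mu.-integrable (edge_dom l) (EFin \o (fun x => (2 * `|g x| - c * gn_weight M (u x)) ^+ 2)).
Hypothesis od0 : \int[mu]_(x in edge_dom l) (2 * `|g x| - c * gn_weight M (u x)) ^+ 2 = 0.

Let mD : measurable (edge_dom l). Proof. exact: measurable_edge_dom. Qed.

Let ae_grad : {ae mu, forall x, edge_dom l x -> `|g x| = c / 2 * gn_weight M (u x)}.
Proof.
pose h x := (2 * `|g x| - c * gn_weight M (u x)) ^+ 2.
have i0 : (\int[mu]_(x in edge_dom l) `|(h x)%:E| = 0)%E.
  under eq_integral do rewrite gee0_abs ?lee_fin ?sqr_ge0//.
  by rewrite -[LHS]fineK ?integrable_fin_num//; congr EFin.
have := (ae_eq_integral_abs mu mD (measurable_int mu iod)).1 i0.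
apply: filterS => x /= hx Dx; have := hx Dx => -[/eqP]; rewrite sqrf_eq0 subr_eq0 => /eqP e.
by rewrite mulrAC -e; field.
Qed.

(** Vanishing of the square gives [|g| = c / 2 * gn_weight M u] almost everywhere, and
    [arcosh_reg_weight_le] then bounds the integrand of the chain rule by [c * M ^+ 2], whatever [n]
    is. *)
Lemma arcosh_reg_lipschitz n x y : 0 < n -> 0 <= x -> x <= y -> edge_dom l y ->
  `|arcosh_reg M n (u y) - arcosh_reg M n (u x)| <= c * M ^+ 2 * (y - x).
Proof.
move=> n0 x0 xy Dy.
pose w := arcosh_reg_weight M n.
have Dz z : x <= z <= y -> edge_dom l z.
  by move=> /andP[xz zy]; apply: (edge_dom_le Dy) => //; exact: le_trans xz.
have sub : `[x, y] `<=` edge_dom l by exact: edge_dom_sub.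
have cu := H1_edge_continuous H x0 xy Dy.
have mu_ : measurable_fun (`[x, y] : set (measurableTypeR R)) u by exact: subspace_continuous_measurable_fun.
have cw : continuous w by exact: continuous_arcosh_reg_weight.
have mw : measurable_fun (`[x, y] : set (measurableTypeR R)) (fun z => w (u z)).
  by apply: (measurableT_comp (f := w)) => //; exact: continuous_measurable_fun.
have mg : measurable_fun (`[x, y] : set (measurableTypeR R)) g.
  by apply: measurable_funS (H1_edge_measurable_grad H).
have [ic le_] := chain_rule_le (M := M) (psi := w) (Phi := arcosh_reg M n) xy (H1_edge_integrable H x0 Dy)
  (fun z (h : x <= z <= y) => H1_edge_primitive H x0 (proj1 (andP h)) (Dz z h))
  (fun z h => uM (Dz z h)) cw (fun s => arcosh_reg_weight_ge0 M n0 s)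
  (fun a b => arcosh_reg_mean_value M0 n0 (a := a) (b := b)).
apply: (le_trans le_).
pose k z := w (u z) * (c / 2 * gn_weight M (u z)).
have mk : measurable_fun (`[x, y] : set (measurableTypeR R)) k.
  apply: measurable_funM => //; apply: measurable_funM => //.
  apply: (measurableT_comp (f := gn_weight M)) => //; apply: continuous_measurable_fun.
  exact: continuous_gn_weight.
have k0 z : 0 <= k z.
  by rewrite mulr_ge0 ?arcosh_reg_weight_ge0// mulr_ge0 ?gn_weight_ge0// divr_ge0.
have -> : \int[mu]_(z in `[x, y]) (w (u z) * `|g z|) = \int[mu]_(z in `[x, y]) k z.
  congr fine; apply: ge0_ae_eq_integral => //.
  - by apply/measurable_EFinP; apply: measurable_funM => //; exact: measurableT_comp.
  - exact/measurable_EFinP.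
  - by move=> z _; rewrite lee_fin mulr_ge0// arcosh_reg_weight_ge0.
  - by move=> z _; rewrite lee_fin.
  - apply: filterS ae_grad => z hz zxy; congr EFin; rewrite /k hz//.
    exact: sub.
have kle z : x <= z <= y -> k z <= c * M ^+ 2.
  move=> /Dz /uM uz; have := arcosh_reg_weight_le M0 n0 uz => h.
  rewrite /k mulrCA; have -> : c * M ^+ 2 = c / 2 * (2 * M ^+ 2) by field.
  by rewrite ler_wpM2l// divr_ge0.
rewrite -Rintegral_cst_itv//; apply: le_Rintegral => //.
- apply: (@le_integrable _ _ _ mu _ _ _ (EFin \o (fun=> c * M ^+ 2))) => //.
  + exact/measurable_EFinP.
  + move=> z /=; rewrite in_itv/= => zxy; rewrite lee_fin ger0_norm//.
    by rewrite (le_trans (kle z zxy))// ler_norm.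
  + by apply: integrable_continuous_itv => z; exact: cvg_cst.
- by apply: integrable_continuous_itv => z; exact: cvg_cst.
Qed.

Let T z := u z ^+ 2 / M ^+ 2.
Let P z := Num.sqrt (1 - T z ^+ 2).

(** The limit n -> 0 is taken without logarithms or quotients because [a] or [b] may be 0. *)
Lemma limit_profile (a b K : R) : 0 <= a <= 1 -> 0 <= b <= 1 -> 1 <= K ->
  (forall n, 0 < n -> (1 + Num.sqrt (1 - a ^+ 2 + n)) * (b + n) <=
                      K * ((1 + Num.sqrt (1 - b ^+ 2 + n)) * (a + n))) ->
  (1 + Num.sqrt (1 - a ^+ 2)) * b <= K * ((1 + Num.sqrt (1 - b ^+ 2)) * a).
Proof.
move=> /andP[a0 a1] /andP[b0 b1] K1 h; apply/ler_addgt0Pr => e e0.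
(* The choice n = z ^ 2 lets the square root grow by at most [z]; four error terms of size at most
   [z], multiplied by [K], stay below [e]. *)
pose z := Num.min 1 (e / (4 * K)).
have K0 : 0 < K by exact: lt_le_trans K1.
have z0 : 0 < z by rewrite lt_min ltr01 divr_gt0// mulr_gt0.
have z1 : z <= 1 by rewrite ge_min lexx.
have ze : 4 * K * z <= e.
  by rewrite mulrC -ler_pdivlMr ?mulr_gt0// ge_min lexx orbT.
have pb0 : 0 <= 1 - b ^+ 2 by rewrite subr_ge0 expr_le1.
have := h (z ^+ 2) (exprn_gt0 2 z0).
have q1 : Num.sqrt (1 - a ^+ 2) <= Num.sqrt (1 - a ^+ 2 + z ^+ 2) by rewrite ler_wsqrtr// lerDl sqr_ge0.
have q2 : Num.sqrt (1 - b ^+ 2 + z ^+ 2) <= Num.sqrt (1 - b ^+ 2) + z.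
  rewrite -[leRHS]ger0_norm ?addr_ge0 ?sqrtr_ge0 ?(ltW z0)// -sqrtr_sqr ler_wsqrtr//.
  rewrite sqrrD sqr_sqrtr// lerD2r lerDl mulrn_wge0// mulr_ge0 ?sqrtr_ge0 ?(ltW z0)//.
have q3 : Num.sqrt (1 - b ^+ 2) <= 1 by rewrite -[leRHS]sqrtr1 ler_wsqrtr// gerBl sqr_ge0.
have q4 := sqrtr_ge0 (1 - a ^+ 2); have q5 := sqrtr_ge0 (1 - b ^+ 2).
move: q1 q2 q3 q4 q5.
move: (Num.sqrt (1 - a ^+ 2)) (Num.sqrt (1 - a ^+ 2 + z ^+ 2)) => A' A.
move: (Num.sqrt (1 - b ^+ 2)) (Num.sqrt (1 - b ^+ 2 + z ^+ 2)) => B' B q1 q2 q3 q4 q5 hh.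
apply: (@le_trans _ _ ((1 + A) * (b + z ^+ 2))).
  by rewrite ler_pM ?addr_ge0 ?lerD2l// lerDl sqr_ge0.
apply: (le_trans hh).
apply: (@le_trans _ _ (K * ((1 + B') * a) + K * (4 * z))); last first.
  by rewrite lerD2l mulrA (mulrC K) .
rewrite -mulrDr ler_wpM2l ?(ltW K0)//.
apply: (@le_trans _ _ ((1 + (B' + z)) * (a + z ^+ 2))).
  by rewrite ler_wpM2r ?lerD2l// addr_ge0 ?sqr_ge0.
have z2 : z ^+ 2 <= z by rewrite expr2 ler_piMl// ltW.
have : z * a <= z by rewrite ler_piMr// ltW.
have : B' * z ^+ 2 <= z by apply: le_trans z2; rewrite ler_piMl// sqr_ge0.
have : z * z ^+ 2 <= z by apply: le_trans z2; rewrite ler_piMl// sqr_ge0.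
by nra.
Qed.

(** Exponential form of the Lipschitz bound for arcosh (1 / T) = ln ((1 + P) / T), meaningful even
    where [T] vanishes. *)
Lemma edge_profile_le x y : edge_dom l x -> edge_dom l y ->
  (1 + P x) * T y <= expR (c * M ^+ 2 * `|x - y|) * ((1 + P y) * T x).
Proof.
move=> Dx Dy.
have T01 z : edge_dom l z -> 0 <= T z <= 1.
  move=> /uM uz; rewrite /T divr_ge0 ?sqr_ge0//= ler_pdivrMr ?exprn_gt0// mul1r.
  by rewrite -(real_normK (num_real (u z))) lerXn2r ?nnegrE ?(ltW M0).
apply: limit_profile; [exact: T01|exact: T01| |].
  rewrite -[leLHS]expR0 ler_expR; apply: mulr_ge0 => //; apply: mulr_ge0 => //.
  exact: sqr_ge0.
move=> n n0.
have lip : `|arcosh_reg M n (u x) - arcosh_reg M n (u y)| <= c * M ^+ 2 * `|x - y|.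
  have [xy|/ltW yx] := leP x y.
    by rewrite distrC (distrC x) (@ger0_norm _ (y - x)) ?subr_ge0//; apply: arcosh_reg_lipschitz => //; exact: edge_dom_ge0 Dx.
  by rewrite (@ger0_norm _ (x - y)) ?subr_ge0//; apply: arcosh_reg_lipschitz => //; exact: edge_dom_ge0 Dy.
have q0 z : edge_dom l z -> 0 < 1 + Num.sqrt (1 - T z ^+ 2 + n).
  by move=> _; rewrite ltr_pwDl// sqrtr_ge0.
have t0 z : edge_dom l z -> 0 < T z + n by move=> /T01/andP[? _]; rewrite ltr_wpDl.
have := le_trans (ler_norm _) lip; rewrite /arcosh_reg -/(T x) -/(T y).
move: (q0 x Dx) (q0 y Dy) (t0 x Dx) (t0 y Dy).
move: (1 + Num.sqrt (1 - T x ^+ 2 + n)) (1 + Num.sqrt (1 - T y ^+ 2 + n)) (T x + n) (T y + n) => X Y a b X0 Y0 a0 b0.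
rewrite -!ln_div ?posrE ?divr_gt0// -ler_expR lnK ?posrE ?divr_gt0//.
move: (expR _) => E le_.
have -> : X * b = X / a / (Y / b) * (Y * a) by field; rewrite !gt_eqF.
by rewrite ler_wpM2r// mulr_ge0// ltW.
Qed.

End EdgeProfile.

(** * From a coordinate on the graph to the line or a bubble tower *)

Section CoordinateIsometry.
Context {R : realType}.
Variables (G : mgraph R) (f : gpoint G -> R).
Hypothesis f_reach : forall p q, in_dom p -> in_dom q -> reach p q `|f p - f q|.
Hypothesis f_edge : forall e x y, `|f (e, x) - f (e, y)| = `|x - y|.
Hypothesis f_inj : forall p q, in_dom p -> in_dom q -> f p = f q -> same_pt p q.
Hypothesis f_surj : forall t, exists2 p, in_dom p & f p = t.
Hypothesis f_same : forall p q, in_dom p -> in_dom q -> same_pt p q -> `|f p| = `|f q|.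

Let ends : seq (gpoint G) :=
  [seq (e, 0) | e <- enum 'I_(nE G)] ++ [seq (e, glen G e) | e <- enum 'I_(nE G)].

Let ends_dom p : p \in ends -> in_dom p.
Proof.
rewrite mem_cat => /orP[] /mapP[e _ ->]; [exact: in_dom0|exact: in_dom_len].
Qed.

Let vtx_ends p v : vtx_of p = Some v -> p \in ends.
Proof.
case: p => e x /vtx_ofP /= [[-> _]|[-> _]]; rewrite mem_cat; apply/orP; [left|right];
  by apply/mapP; exists e; rewrite ?mem_enum.
Qed.

(** Distinct coordinates are identified only at vertices, so the finite list [ends] contains all
    candidates; each pair of opposite positions is recorded by its positive member. *)
Definition glue_points : seq R := undup [seq f p | p <- ends &
  (0 < f p) && has (fun q => same_pt p q && (f q == - f p)) ends].

Let glue_pointsP x : reflect (exists p q, [/\ p \in ends, q \in ends, same_pt p q,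
    f p = x & f q = - x /\ 0 < x]) (x \in glue_points).
Proof.
rewrite mem_undup; apply: (iffP mapP) => [[p]|[p [q [pe qe pq <- [fq x0]]]]].
  rewrite mem_filter => /andP[/andP[fp0 /hasP[q qe /andP[pq /eqP fq]]] pe] ->.
  by exists p, q.
exists p => //; rewrite mem_filter x0 pe /= andbT; apply/hasP; exists q => //.
by rewrite pq fq eqxx.
Qed.

(** By [f_same] identified points have equal or opposite positions; conversely a glued pair comes
    from two identified ends, and [f_inj] transfers this to any points at those positions. *)
Lemma gluedP p q : in_dom p -> in_dom q -> glued glue_points (f p) (f q) = same_pt p q.
Proof.
move=> pd qd; apply/idP/idP.
  case/orP => [/eqP|/hasP[x /glue_pointsP[a [b [/ends_dom ad /ends_dom bd ab fa [fb _]]]]]].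
    exact: f_inj.
  case/orP => /andP[/eqP fp /eqP fq].
    have pa : same_pt p a by apply: f_inj => //; rewrite fp fa.
    have bq : same_pt b q by apply: f_inj => //; rewrite fq fb.
    exact: same_pt_trans (same_pt_trans pa ab) bq.
  have pb : same_pt p b by apply: f_inj => //; rewrite fp fb.
  have aq : same_pt a q by apply: f_inj => //; rewrite fq fa.
  exact: same_pt_trans (same_pt_trans pb (same_pt_sym ab)) aq.
move=> pq; have fpq := f_same pd qd pq; rewrite /glued.
case/orP: (pq) => [/eqP->|/andP[+ /eqP vpq]]; first by rewrite eqxx.
case E : (vtx_of p) vpq => [v|//] vpq _.
have pe := vtx_ends E; have qe := vtx_ends (esym vpq).
have [->|fne] := eqVneq (f p) (f q); first by [].
have fqN : f q = - f p.
  move/eqP: fpq; rewrite eqr_norm2 (negPf fne) /= => /eqP ->; by rewrite opprK.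
apply/orP; right; apply/hasP.
have [fp0|fp0|fp0] := ltgtP (f p) 0; last by move: fne; rewrite fqN fp0 oppr0 eqxx.
  exists (f q); last by rewrite fqN opprK !eqxx orbT.
  apply/glue_pointsP; exists q, p; split => //; first exact: same_pt_sym.
  by rewrite fqN opprK oppr_gt0.
exists (f p); last by rewrite fqN !eqxx.
by apply/glue_pointsP; exists p, q.
Qed.

(** Chains correspond with equal cost: a jump on the line is realised in the graph by [f_reach], a
    segment of an edge on the line by [f_edge], and identifications match by [gluedP]. The infima
    are over the same set. *)
Lemma glue_dist_coordinate p q : in_dom p -> in_dom q ->
  glue_dist glue_points (f p) (f q) = gdist p q.
Proof.
move=> pd qd; rewrite glue_distE gdistE; congr inf; apply/seteqP; split => c /=.
  suff H s t r : glue_reach glue_points s t r -> forall p q, in_dom p -> in_dom q ->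
      f p = s -> f q = t -> reach p q r.
    by move=> h; exact: (H _ _ _ h).
  move: s t r; apply: (chain_ind (P := fun s t r => forall p q, in_dom p -> in_dom q ->
      f p = s -> f q = t -> reach p q r)).
    move=> s t _ a b ad bd <- <- /=; exact: f_reach.
  move=> s t t' r d _ tt' _ IH a b ad bd <- fb /=.
  have [x xd fx] := f_surj t; have [y yd fy] := f_surj t'.
  rewrite -fx; apply: (@reach_cat _ _ a x y); first exact: f_reach.
    by rewrite -gluedP// fx fy.
  exact: IH.
move=> h; suff : [/\ in_dom p, in_dom q & glue_reach glue_points (f p) (f q) c] by case.
move: p q c {pd qd} h; apply: (chain_ind (P := fun p q c =>
  [/\ in_dom p, in_dom q & glue_reach glue_points (f p) (f q) c])) => [[e x] [e' y]|[e x] [e' y] b d r].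
  rewrite /gok /gcst /= => /andP[/andP[/eqP<- xd] yd]; split => //.
  rewrite -(f_edge e).
  exact: (@chain_step R _ (fun=> true) (fun c : R * R => `|c.1 - c.2|) _ (f (e, x)) (f (e, y))).
rewrite /gok /gcst /= => /andP[/andP[/eqP<- xd] yd] yb _ [bd dd IH]; split => //.
rewrite -(f_edge e).
apply: (chain_cat (t := f (e, y)) _ _ IH); last by rewrite gluedP.
exact: (@chain_step R _ (fun=> true) (fun c : R * R => `|c.1 - c.2|) _ (f (e, x)) (f (e, y))).
Qed.

Lemma isometric_of_coordinate : is_R G \/ is_bubble_tower G.
Proof.
have [E|ne] := eqVneq glue_points [::].
  left; exists f; split => [p q pd qd|t].
    by rewrite -glue_dist_coordinate// E glue_dist_nil.
  by have [p pd <-] := f_surj t; exists p; rewrite subrr normr0.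
right; exists glue_points; split => //; first exact: undup_uniq.
  by apply/allP => x /glue_pointsP[p [q [_ _ _ _ []]]].
exists f; split; first exact: glue_dist_coordinate.
by move=> t; have [p pd <-] := f_surj t; exists p; rewrite glue_distxx.
Qed.

End CoordinateIsometry.

(** * Comparison of profiles with the hyperbolic secant *)

Section ProfileFacts.
Context {R : realType}.
Notation mu := (@lebesgue_measure R).

(** With E = e ^ a, the hypothesis makes (E T - 1) ^ 2 - P ^ 2 nonnegative, and this equals E T (T
    (E + 1 / E) - 2). *)
Lemma profile_ge_sech (T a : R) : 0 < T -> T <= 1 ->
  1 + Num.sqrt (1 - T ^+ 2) <= expR a * T -> sech a <= T.
Proof.
move=> T0 T1; set P := Num.sqrt _ => le_.
have P0 : 0 <= P by exact: sqrtr_ge0.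
have P2 : P ^+ 2 = 1 - T ^+ 2 by rewrite sqr_sqrtr// subr_ge0 expr_le1// ltW.
rewrite /sech ler_pdivrMr ?addr_gt0 ?expR_gt0//.
have := expRxMexpNx_1 a; have := expR_gt0 a; have := expR_gt0 (- a).
move: (expR a) (expR (- a)) le_ => E F le_ F0 E0 EF.
have : 0 <= (E * T - 1 - P) * (E * T - 1 + P) by rewrite mulr_ge0//; lra.
have -> : (E * T - 1 - P) * (E * T - 1 + P) = (E * T) ^+ 2 - 2 * (E * T) + 1 - P ^+ 2 by ring.
rewrite P2.
have -> : (E * T) ^+ 2 - 2 * (E * T) + 1 - (1 - T ^+ 2) = E * T * (T * (E + F) - 2) by ring: EF.
by rewrite pmulr_rge0 ?mulr_gt0// subr_ge0.
Qed.

Lemma sech_inj_norm (a b : R) : sech a = sech b -> `|a| = `|b|.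
Proof.
wlog [a0 b0] : a b / 0 <= a /\ 0 <= b.
  move=> H ab; have := H `|a| `|b|; rewrite !normr_id; apply => //.
  have N (x : R) : sech `|x| = sech x by case: (ger0P x) => // _; rewrite sechN.
  by rewrite !N.
move=> ab; rewrite !ger0_norm//.
have : expR a + expR (- a) = expR b + expR (- b).
  apply: invr_inj; apply: (@mulfI _ 2) => //.
have := expRxMexpNx_1 a; have := expRxMexpNx_1 b.
move=> eb ea E.
have : (expR a - expR b) * (1 - expR (- a) * expR (- b)) = 0.
  have -> : (expR a - expR b) * (1 - expR (- a) * expR (- b)) =
    expR a - expR b - expR a * expR (- a) * expR (- b) + expR b * expR (- b) * expR (- a) by ring.
  by rewrite ea eb !mul1r -[X in X = _]addrA; move: E; lra.
move/eqP; rewrite mulf_eq0 !subr_eq0 => /orP[/eqP/expR_inj//|].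
rewrite -expRD -[X in X == _]expR0 => /eqP/expR_inj h.
by move: h a0 b0; lra.
Qed.

Lemma integral0_continuous (l : option R) (h : R -> R) :
  (if l is Some l then 0 < l else true) ->
  (forall y, edge_dom l y -> {within `[0, y], continuous h}) ->
  (forall x, edge_dom l x -> 0 <= h x) ->
  mu.-integrable (edge_dom l) (EFin \o h) -> \int[mu]_(x in edge_dom l) h x = 0 ->
  forall x, edge_dom l x -> h x = 0.
Proof.
move=> l0 ch h0 ih i0 x Dx; apply/eqP; rewrite eq_le h0// andbT leNgt; apply/negP => hx.
have x0 := edge_dom_ge0 Dx.
have [X [DX X0 xX]] : exists X, [/\ edge_dom l X, 0 < X & x <= X].
  case: l l0 Dx {ch h0 ih i0} => [l|] l0; rewrite edge_domE => /andP[_ xl].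
    by exists l; rewrite edge_domE lexx andbT ltW.
  by exists (x + 1); rewrite edge_domE andbT addr_ge0// ltr_wpDl// lerDl.
have hx2 : 0 < h x / 2 by rewrite divr_gt0.
have xX' : 0 <= x <= X by rewrite x0.
have [d d0 hd] := (within_continuousP 0 X h).1 (ch X DX) x _ xX' hx2.
have [a [b [a0 ab bX near_]]] : exists a b, [/\ 0 <= a, a < b, b <= X &
    forall z, a <= z <= b -> `|z - x| < d].
  move: xX; rewrite le_eqVlt => /predU1P[xX|xX].
    exists (Num.max 0 (x - d / 2)), x; split; rewrite ?le_max ?lexx ?xX//.
      by rewrite gt_max X0 -xX; lra.
    move=> z /andP[]; rewrite ge_max => /andP[_ z1] z2.
    by rewrite ler0_norm; lra.
  exists x, (Num.min X (x + d / 2)); split => //.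
  - by rewrite lt_min xX; lra.
  - by rewrite ge_min lexx.
  - by move=> z /andP[z1]; rewrite le_min => /andP[_ z2]; rewrite ger0_norm; lra.
have sub : `[a, b] `<=` edge_dom l.
  by apply: edge_dom_sub => //; apply: (edge_dom_le DX) => //; exact: le_trans (ltW ab).
have iab : mu.-integrable `[a, b] (EFin \o h).
  by apply: integrableS ih => //; exact: measurable_edge_dom.
have : \int[mu]_(z in `[a, b]) (h x / 2) <= 0.
  apply: (@le_trans _ _ (\int[mu]_(z in `[a, b]) h z)).
    apply: le_Rintegral => //.
      by apply: integrable_continuous_itv => z; exact: cvg_cst.
    move=> z /=; rewrite in_itv/= => zab.
    have z0X : 0 <= z <= X.
      by case/andP: zab => az zb; rewrite (le_trans a0 az) (le_trans zb).
    have := hd z z0X (near_ z zab); rewrite ltr_distl => /andP[? _].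
    by apply: ltW; lra.
  rewrite -i0 /Rintegral fine_le//.
  - exact: integrable_fin_num.
  - by apply: integrable_fin_num => //; exact: measurable_edge_dom.
  - apply: ge0_subset_integral => //.
    + exact: measurable_edge_dom.
    + exact: (measurable_int mu ih).
rewrite Rintegral_cst_itv; last exact: ltW.
by rewrite leNgt mulr_gt0// subr_gt0.
Qed.

End ProfileFacts.

(** * The structure of a graph carrying an optimizer *)

Section Optimizer.
Context {R : realType}.
Notation mu := (@lebesgue_measure R).
Variables (G : mgraph R) (u g : 'I_(nE G) -> R -> R).
Hypotheses (cG : gconnected G) (ncG : noncompact G) (HG : assumptionH G).
Hypotheses (Hu : H1 u g) (m0 : 0 < normk 2 u).
Hypothesis opt : pi ^+ 2 * normk 6 u = 4 * normk 2 u ^+ 2 * normk 2 g.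

Let c := pi / normk 2 u.

Let c0 : 0 < c. Proof. by rewrite divr_gt0 ?pi_gt0. Qed.

Variables (M : R) (p0 : gpoint G).
Hypotheses (M0 : 0 < M) (p0d : in_dom p0) (p0M : `|u p0.1 p0.2| = M).
Hypothesis uM : forall q : gpoint G, in_dom q -> `|u q.1 q.2| <= M.
Hypothesis defect : \sum_(e < nE G) \int[mu]_(x in edge_dom (edge_len e))
        (2 * `|g e x| - c * gn_weight M (u e x)) ^+ 2
      <= 4 * normk 2 g - c ^+ 2 * normk 6 u.

Let uMe e x : edge_dom (edge_len e) x -> `|u e x| <= M.
Proof. by move=> Dx; apply: (uM (q := (e, x))); rewrite in_domE. Qed.

Let mD e : measurable (edge_dom (@edge_len R G e)). Proof. exact: measurable_edge_dom. Qed.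

(** Equality makes the right side of [defect] zero, while every summand on the left is
    nonnegative. *)
Let defect0 e : \int[mu]_(x in edge_dom (edge_len e))
  (2 * `|g e x| - c * gn_weight M (u e x)) ^+ 2 = 0.
Proof.
have d0 i : 0 <= \int[mu]_(x in edge_dom (edge_len i)) (2 * `|g i x| - c * gn_weight M (u i x)) ^+ 2.
  by apply: Rintegral_ge0 => x _; exact: sqr_ge0.
have E : 4 * normk 2 g - c ^+ 2 * normk 6 u = 0.
  rewrite /c exprMn mulrAC exprVn opt; field; by rewrite gt_eqF.
have s0 : \sum_(i < nE G) \int[mu]_(x in edge_dom (edge_len i))
    (2 * `|g i x| - c * gn_weight M (u i x)) ^+ 2 == 0.
  rewrite eq_le; apply/andP; split; last by rewrite sumr_ge0.
  by apply: le_trans defect _; rewrite E.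
by move: s0; rewrite psumr_eq0// => /allP /(_ e (mem_index_enum _)) /eqP.
Qed.

Let T (p : gpoint G) := u p.1 p.2 ^+ 2 / M ^+ 2.
Let P (p : gpoint G) := Num.sqrt (1 - T p ^+ 2).
Let k := c * M ^+ 2.

Let k0 : 0 < k. Proof. by rewrite mulr_gt0// exprn_gt0. Qed.

Let profile e x y : in_dom (e, x) -> in_dom (e, y) ->
  (1 + P (e, x)) * T (e, y) <= expR (k * `|x - y|) * ((1 + P (e, y)) * T (e, x)).
Proof.
rewrite !in_domE /= => Dx Dy.
apply: (edge_profile_le (H1_edgeP Hu e) M0 (ltW c0) (@uMe e) _ (defect0 e) Dx Dy).
by have [] := gn_defect_edge Hu M0 uM c e.
Qed.

Let T_le1 p : in_dom p -> 0 <= T p <= 1.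
Proof.
move=> /uM up; rewrite /T divr_ge0 ?sqr_ge0//= ler_pdivrMr ?exprn_gt0// mul1r.
by rewrite -(real_normK (num_real (u _ _))) lerXn2r ?nnegrE ?(ltW M0).
Qed.

Let P1_gt0 p : 0 < 1 + P p.
Proof. by rewrite ltr_pwDl// sqrtr_ge0. Qed.

Let T_same p q : same_pt p q -> T p = T q.
Proof. by rewrite /T => /(H1_same_pt Hu) ->. Qed.

Let Tp0 : T p0 = 1.
Proof.
by rewrite /T -(real_normK (num_real (u _ _))) p0M divff// expf_neq0// gt_eqF.
Qed.

(** Positivity spreads along a chain from [p0]: on an edge, a zero of [T] would by [profile] force
    [T] to vanish on the whole edge. Only now can the logarithm in [r] be taken. *)
Let T_gt0 p : in_dom p -> 0 < T p.
Proof.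
move=> pd; have [r] := gconnected_reach cG p0d pd.
suff H a b d : reach a b d -> 0 < T a -> 0 < T b by move=> /H; apply; rewrite Tp0.
have edge e x y : in_dom (e, x) -> in_dom (e, y) -> 0 < T (e, x) -> 0 < T (e, y).
  move=> xd yd Tx; rewrite lt0r; have /andP[-> _] := T_le1 yd; rewrite andbT.
  apply/negP => /eqP Ty; have := profile yd xd; rewrite Ty !mulr0 leNgt => /negP; apply.
  by rewrite mulr_gt0.
move: a b d; apply: (chain_ind (P := fun a b _ => 0 < T a -> 0 < T b)).
  by move=> [e x] [e' y] /andP[/andP[/= /eqP <- xd] yd]; exact: edge.
move=> [e x] [e' y] b d r' /andP[/andP[/= /eqP <- xd] yd] /T_same yb _ IH Tx.
by apply: IH; rewrite -yb; exact: edge Tx.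
Qed.

(** This is arcosh (1 / T) / k, the distance from the maximum at which a soliton of rate [k] has the
    value [T p]. *)
Let r p := ln ((1 + P p) / T p) / k.

Let r_le (p q : gpoint G) d : in_dom p -> in_dom q -> reach p q d -> `|r p - r q| <= d.
Proof.
move=> pd qd pq.
have half e x y : in_dom (e, x) -> in_dom (e, y) -> r (e, x) - r (e, y) <= `|x - y|.
  move=> xd yd; have Tx := T_gt0 xd; have Ty := T_gt0 yd.
  have Zx : 0 < (1 + P (e, x)) / T (e, x) by rewrite divr_gt0.
  have Zy : 0 < (1 + P (e, y)) / T (e, y) by rewrite divr_gt0.
  have -> : r (e, x) - r (e, y) = ln ((1 + P (e, x)) / T (e, x) / ((1 + P (e, y)) / T (e, y))) / k.
    by rewrite /r -mulrBl [in RHS]ln_div ?posrE.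
  rewrite ler_pdivrMr// [leRHS]mulrC -ler_expR lnK ?posrE; last exact: divr_gt0.
  move: Tx Ty (P1_gt0 (e, x)) (P1_gt0 (e, y)) (profile xd yd).
  move: (expR _) (1 + P (e, x)) (1 + P (e, y)) (T (e, x)) (T (e, y)) => E X Y a b a0 b0 X0 Y0 le_.
  have -> : X / a / (Y / b) = X * b / (Y * a) by field; rewrite !gt_eqF.
  by rewrite ler_pdivrMr ?mulr_gt0.
apply: (reach_potential _ _ pq).
  move=> e x y xd yd; rewrite ler_norml; apply/andP; split; last exact: half.
  by have := half e y x yd xd; rewrite distrC; lra.
by move=> a b ad bd ab; rewrite /r /P (T_same ab).
Qed.

Let rp0 : r p0 = 0.
Proof. by rewrite /r /P Tp0 expr1n subrr sqrtr0 addr0 divr1 ln1 mul0r. Qed.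

Lemma optimizer_structure : is_R G \/ is_bubble_tower G.
Proof.
have [s0 [ss [tr onp]]] := HG p0d.
have [p1 [p1d p01 p1in]] := on_trailP p0d onp.
have [t_reach t_inj t_surj] := trail_posP tr.
pose A := map fst (s0 :: ss).
(* Position measured from the maximum, which [p1] represents on an edge of the trail. *)
pose f p := trail_pos s0 ss p - trail_pos s0 ss p1.
have fB p q : f p - f q = trail_pos s0 ss p - trail_pos s0 ss q by rewrite /f; ring.
have on p : in_dom p -> p.1 \in A -> in_dom p && (p.1 \in A) by move=> -> ->.
have f_aff e : e \in A -> exists a b : R, (a = 1 \/ a = -1) /\ forall x, f (e, x) = a * x + b.
  move=> eA; have [a [b [a1 h]]] := trail_pos_affine eA.
  by exists a, (b - trail_pos s0 ss p1); split => // x; rewrite /f h addrA.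
have T_ge q : in_dom q -> q.1 \in A -> sech (k * f q) <= T q.
  move=> qd qA; have := t_reach p1 q (on p1 p1d p1in) (on q qd qA).
  move=> /(r_le p1d qd).
  have -> : r p1 = 0 by rewrite -rp0 /r /P (T_same p01).
  rewrite sub0r normrN.
  have -> : `|trail_pos s0 ss p1 - trail_pos s0 ss q| = `|f q| by rewrite distrC.
  move=> /(le_trans (ler_norm _)) rq.
  have Tq := T_gt0 qd; have /andP[_ Tq1] := T_le1 qd.
  have Z0 : 0 < (1 + P q) / T q by exact: divr_gt0.
  have le_ : 1 + P q <= expR (k * `|f q|) * T q.
    by rewrite -ler_pdivrMr// -[leLHS]lnK ?posrE// ler_expR [leRHS]mulrC -ler_pdivrMr.
  have -> : sech (k * f q) = sech (k * `|f q|).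
    by case: (ger0P (f q)) => // _; rewrite mulrN sechN.
  exact: profile_ge_sech.
have csech : continuous (fun x => sech (k * x)).
  move=> x; apply: (@continuous_comp _ _ _ (fun x : R => k * x) sech); last exact: continuous_sech.
  exact: mulrl_continuous.
have cf e x : e \in A -> {for x, continuous (fun x => sech (k * f (e, x)))}.
  move=> eA; have [a [b [_ h]]] := f_aff e eA.
  apply: (@continuous_comp _ _ _ (fun x => f (e, x)) (fun x => sech (k * x))); last exact: csech.
  rewrite (_ : (fun x => f (e, x)) = (fun x => a * x + b)); last by apply/funext => z.
  by apply: cvgD; [exact: mulrl_continuous|exact: cvg_cst].
(* The finitely many positions that may fail to be reached from the interior of an edge. *)
pose ends := [seq f (e, 0) | e <- enum 'I_(nE G)] ++ [seq f (e, glen G e) | e <- enum 'I_(nE G)].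
have int_dom (e : 'I_(nE G)) (x : R) : punctured 0 (edge_len e) [::] x -> in_dom (e, x).
  rewrite puncturedE in_domE edge_domE => /and3P[x0 xl _]; rewrite (ltW x0) /=.
  by case: (edge_len e) xl => // a /ltW.
have [isech sumsech] : (forall e, e \in A -> mu.-integrable (edge_dom (edge_len e))
     (EFin \o (fun x => sech (k * f (e, x))))) /\
   \sum_(e in A) \int[mu]_(x in edge_dom (edge_len e)) sech (k * f (e, x)) = pi / k.
  apply: (@change_of_variables_fin R _ (mem A) (@edge_len R G) (fun e x => f (e, x)) (fun=> [::]) ends
    _ _ _ (fun x => sech (k * x))) => //.
  - move=> e x eA _; have [a [b [a1 h]]] := f_aff e eA; exists 1 => // y z _ _.
    rewrite !h (_ : a * y + b - _ = a * (y - z)); last by ring.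
    by rewrite normrM; case: a1 => ->; rewrite ?normrN normr1 mul1r.
  - move=> e e' x x' eA e'A xp xp' ff.
    have := t_inj (e, x) (e', x') (on (e, x) (int_dom _ _ xp) eA) (on (e', x') (int_dom _ _ xp') e'A).
    have -> : trail_pos s0 ss (e, x) = trail_pos s0 ss (e', x') by apply/eqP; rewrite -subr_eq0 -fB ff subrr.
    move=> /(_ erefl); rewrite /same_pt => /orP[/eqP[]//|/andP[+ _]].
    move: xp; rewrite puncturedE /vtx_of /= /edge_len => /and3P[x0 xl _].
    by rewrite gt_eqF//; case: (gtl G e) xl => [w|//] xl; rewrite lt_eqF.
  - move=> t tn; have [[e x] /andP[pd pA] pt] := t_surj (t + trail_pos s0 ss p1).
    have ft : f (e, x) = t by rewrite /f pt addrK.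
    exists e, x; split => //; rewrite puncturedE andbT.
    have xn0 : x != 0.
      apply: contraNneq tn => x0; rewrite mem_cat; apply/orP; left; apply/mapP.
      by exists e; rewrite ?mem_enum// -x0.
    move: pd; rewrite /in_dom /= => /andP[x0 xl]; rewrite lt0r xn0 x0 /= /edge_len.
    case E : (gtl G e) xl => [w|//] xl; rewrite lt_neqAle xl andbT.
    apply: contraNneq tn => xl'; rewrite mem_cat; apply/orP; right; apply/mapP.
    by exists e; rewrite ?mem_enum// -xl'.
  - by move=> x; rewrite ltW ?sech_gt0.
  - move=> e eA; apply: measurable_funTS; apply: continuous_measurable_fun => x; exact: cf.
  - exact: integral_sech.
have iu e : mu.-integrable (edge_dom (edge_len e)) (EFin \o (fun x => u e x ^+ 2)).
  by case: (H1_edgeP Hu e).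
(* The excess of [u ^+ 2] over the soliton, nonnegative on the trail by [T_ge]. *)
pose h e x := u e x ^+ 2 + - M ^+ 2 * sech (k * f (e, x)).
have ih e : e \in A -> mu.-integrable (edge_dom (edge_len e)) (EFin \o h e).
  by move=> eA; apply: integrable_add => //; apply: integrable_scale => //; exact: isech.
have h0 e x : e \in A -> edge_dom (edge_len e) x -> 0 <= h e x.
  move=> eA Dx; rewrite /h mulNr subr_ge0 mulrC -ler_pdivlMr ?exprn_gt0//.
  by apply: (T_ge (e, x)) => //; rewrite in_domE.
have Ih0 e : e \in A -> 0 <= \int[mu]_(x in edge_dom (edge_len e)) h e x.
  by move=> eA; apply: Rintegral_ge0 => x Dx; exact: h0.
have Iu0 e : 0 <= \int[mu]_(x in edge_dom (edge_len e)) (u e x ^+ 2).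
  by apply: Rintegral_ge0 => x _; exact: sqr_ge0.
(* The soliton has mass [M ^+ 2 * (pi / k)], which is [normk 2 u] because
   [k = pi / normk 2 u * M ^+ 2]. No mass is left for the excess or for edges off the trail. *)
have sum0 : \sum_(e in A) \int[mu]_(x in edge_dom (edge_len e)) h e x +
  \sum_(e | e \notin A) \int[mu]_(x in edge_dom (edge_len e)) (u e x ^+ 2) = 0.
  have -> : \sum_(e in A) \int[mu]_(x in edge_dom (edge_len e)) h e x =
     \sum_(e in A) \int[mu]_(x in edge_dom (edge_len e)) (u e x ^+ 2) - M ^+ 2 * (pi / k).
    rewrite -sumsech mulr_sumr -sumrB; apply: eq_bigr => e eA.
    rewrite RintegralD//; last by apply: integrable_scale => //; exact: isech.
    by rewrite RintegralZl ?mulNr//; exact: isech.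
  rewrite addrAC -(bigID (mem A) predT (fun e => \int[mu]_(x in edge_dom (edge_len e)) (u e x ^+ 2))) /=.
  rewrite -normk2E /k /c.
  have := lt0r_neq0 (pi_gt0 R); move: (pi : R) => p p0'.
  by field; rewrite p0' !gt_eqF.
move/eqP: sum0; rewrite paddr_eq0 ?sumr_ge0// => /andP[/eqP sA /eqP sN].
(* On an edge off the trail [u] would vanish, against [T_gt0]. *)
have allA e : e \in A.
  apply: contraT => eN.
  have : \int[mu]_(x in edge_dom (edge_len e)) (u e x ^+ 2) = 0.
    by move/eqP: sN; rewrite psumr_eq0// => /allP /(_ e (mem_index_enum _)); rewrite eN => /eqP.
  move=> i0; have D0 : edge_dom (edge_len e) 0 by have := in_dom0 e; rewrite in_domE.
  have := integral0_continuous (edge_len_gt0 e) _ _ (iu e) i0 D0.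
  have -> : u e 0 ^+ 2 = T (e, 0) * M ^+ 2 by rewrite /T divfK// expf_neq0// gt_eqF.
  have Tp := T_gt0 (in_dom0 e).
  move=> H; suff : T (e, 0) * M ^+ 2 = 0 by move/eqP; rewrite gt_eqF// mulr_gt0// exprn_gt0.
  apply: H => [y Dy z|x _]; last exact: sqr_ge0.
  apply: (@continuous_comp (subspace `[0, y]) _ _ (u e) (fun s => s ^+ 2)); last exact: exprn_continuous.
  exact: (H1_edge_continuous (H1_edgeP Hu e) (lexx 0) (edge_dom_ge0 Dy) Dy).
have TE q : in_dom q -> T q = sech (k * f q).
  case: q => e x; rewrite in_domE /= => Dx.
  have i0 : \int[mu]_(x in edge_dom (edge_len e)) h e x = 0.
    by move/eqP: sA; rewrite psumr_eq0// => /allP /(_ e (mem_index_enum _)); rewrite allA => /eqP.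
  have := integral0_continuous (edge_len_gt0 e) _ _ (ih e (allA e)) i0 Dx.
  move=> H; have : h e x = 0.
    apply: H => [y Dy z|z Dz]; last exact: h0.
    apply: cvgD.
      apply: (@continuous_comp (subspace `[0, y]) _ _ (u e) (fun s => s ^+ 2)); last exact: exprn_continuous.
      exact: (H1_edge_continuous (H1_edgeP Hu e) (lexx 0) (edge_dom_ge0 Dy) Dy).
    apply: cvgM; first exact: cvg_cst.
    have cs : {within `[0, y], continuous (fun x => sech (k * f (e, x)))}.
      by apply: continuous_subspaceT => w; exact: cf.
    exact: cs.
  move=> /eqP; rewrite /h mulNr subr_eq0 => /eqP E.
  by rewrite /T /= E mulrAC divff ?mul1r// expf_neq0// gt_eqF.
apply: (@isometric_of_coordinate R G f).
- by move=> p q pd qd; rewrite fB; apply: t_reach; apply: on.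
- move=> e x y; have [a [b [a1 hf]]] := f_aff e (allA e).
  rewrite !hf (_ : a * x + b - _ = a * (x - y)); last by ring.
  by rewrite normrM; case: a1 => ->; rewrite ?normrN normr1 mul1r.
- move=> p q pd qd /eqP; rewrite -subr_eq0 fB subr_eq0 => /eqP.
  by apply: t_inj; apply: on.
- move=> t; have [p /andP[pd pA] pt] := t_surj (t + trail_pos s0 ss p1).
  by exists p => //; rewrite /f pt addrK.
(* Identified points carry the same value of [T], now a [sech] of the position, so their positions
   agree up to sign. *)
- move=> p q pd qd /T_same; rewrite !TE// => /sech_inj_norm.
  by rewrite 2!(normrM k) (gtr0_norm k0); apply: mulfI; rewrite gt_eqF.
Qed.

End Optimizer.

Lemma attained_structure (R : realType) (G : mgraph R) :
  gconnected G -> noncompact G -> assumptionH G ->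
  attained G (@mass_crit R) -> is_R G \/ is_bubble_tower G.
Proof.
move=> cG ncG HG /(attained_crit ncG HG)[u [g [Hu m0 opt]]].
have [M [p0 [M0 p0d p0M uM defect]]] := gn_defect Hu ncG HG m0.
exact: (optimizer_structure cG HG Hu m0 opt M0 p0d p0M uM defect).
Qed.

(** * Transplanting the soliton *)

Section PiecewisePrimitive.
Context {R : realType}.
Notation mu := (@lebesgue_measure R).
Implicit Types (f v w : R -> R) (a b x y k : R) (Q : seq R).

(** Serves as the derivative of [f]; the default 0 is taken where [f] is not locally affine with
    slope 1 or -1. *)
Definition isom_slope f x : R := xget 0 [set k | (k = 1 \/ k = -1) /\
  exists2 d, 0 < d & forall y, `|y - x| < d -> f y = f x + k * (y - x)].

Lemma isom_slopeE f x k d : k = 1 \/ k = -1 -> 0 < d ->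
  (forall y, `|y - x| < d -> f y = f x + k * (y - x)) -> isom_slope f x = k.
Proof.
move=> k1 d0 fE; rewrite /isom_slope; case: xgetP => [k' _ /= [_ [d' d'0 fE']]|/(_ k)]; last first.
  by move=> h; exfalso; apply: h; split => //; exists d.
pose e := Num.min d d' / 2.
have m0 : 0 < Num.min d d' by rewrite lt_min d0.
have e0 : 0 < e by rewrite divr_gt0.
have : e < Num.min d d' by rewrite ltr_pdivrMr// ltr_pMr// ltr1n.
rewrite lt_min => /andP[ed ed'].
have := fE (x + e); have := fE' (x + e); rewrite addrAC subrr add0r gtr0_norm//.
move=> /(_ ed') -> /(_ ed) /addrI /mulIf; apply.
by rewrite gt_eqF.
Qed.

Lemma isom_slope_le1 f x : `|isom_slope f x| <= 1.
Proof.
rewrite /isom_slope; case: xgetP => [k _ /= [[] -> _]|_]; rewrite ?normrN ?normr1 ?normr0//.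
Qed.

Lemma isom_slope_sqr f x : local_isom f x -> isom_slope f x ^+ 2 = 1.
Proof.
move=> /local_isom_affine[k [d [k1 d0 fE]]]; rewrite (isom_slopeE k1 d0 fE).
by case: k1 => ->; rewrite ?sqrrN expr1n.
Qed.

Lemma isom_slope_itv f a (b : option R) k c : k = 1 \/ k = -1 ->
  (forall x, x \in open_itv a b -> f x = k * x + c) ->
  forall x, x \in open_itv a b -> isom_slope f x = k.
Proof.
move=> k1 fE x xi.
have [d d0 hd] : exists2 d, 0 < d & forall y, `|y - x| < d -> y \in open_itv a b.
  move: (xi); rewrite in_open_itv => /andP[ax xb].
  case: b xb {fE xi} => [b|] xb.
    exists (Num.min (x - a) (b - x)); first by rewrite lt_min !subr_gt0 ax.
    move=> y; rewrite lt_min in_open_itv => /andP[]; rewrite !ltr_distl.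
    by move=> /andP[h1 _] /andP[_ h2]; apply/andP; split; lra.
  exists (x - a); first by rewrite subr_gt0.
  by move=> y; rewrite in_open_itv andbT ltr_distl => /andP[h1 _]; lra.
apply: (isom_slopeE k1 d0) => y yx.
by rewrite fE ?hd// fE//; ring.
Qed.

Lemma measurable_isom_slope Q a (b : option R) f :
  (forall x, punctured a b Q x -> local_isom f x) ->
  measurable (punctured a b Q) /\ measurable_fun (punctured a b Q) (isom_slope f).
Proof.
elim: Q a b => [|q Q IH] a b hloc.
  have pE : punctured a b [::] = [set` open_itv a b].
    by apply/seteqP; split => [x []//|x xi]; split.
  rewrite pE in hloc *.
  have [k [c [k1 fE]]] := local_isom_itv hloc.
  split; first exact: measurable_itv.
  apply: (eq_measurable_fun (fun=> k)); last exact: measurable_cst.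
  by move=> x; rewrite inE => xi; rewrite (isom_slope_itv k1 fE).
have [qi|qi] := boolP (q \in open_itv a b); last first.
  by rewrite punctured_notin// in hloc *; exact: IH.
rewrite (punctured_split Q qi) in hloc *.
have [m1 f1] := IH a (Some q) (fun x h => hloc x (or_introl h)).
have [m2 f2] := IH q b (fun x h => hloc x (or_intror h)).
by split; [exact: measurableU|exact/measurable_funU].
Qed.

(** Used with [v] the composite of an even function and the position: the position itself may jump
    at an end point, so the value there is recovered by continuity of the composite. *)
Lemma eq_at_ends a b (v V : R -> R) : a < b -> {within `[a, b], continuous v} -> continuous V ->
  (forall x, a < x < b -> v x = V x) -> v a = V a /\ v b = V b.
Proof.
move=> ab cv cV vV.
have cV' : {within `[a, b], continuous V} by exact: continuous_subspaceT.
have key x : a <= x <= b -> (forall d, 0 < d -> exists2 z, a < z < b & `|z - x| < d) -> v x = V x.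
  move=> xab near_; apply/eqP; rewrite -subr_eq0 -normr_le0; apply/ler_addgt0Pr => e e0; rewrite add0r.
  have e20 : 0 < e / 2 by rewrite divr_gt0.
  have [d d0 hd] := (within_continuousP a b v).1 cv x _ xab e20.
  have [d' d'0 hd'] := (within_continuousP a b V).1 cV' x _ xab e20.
  have m0 : 0 < Num.min d d' by rewrite lt_min d0.
  have [z zab] := near_ _ m0.
  rewrite lt_min => /andP[zd zd'].
  have zab' : a <= z <= b by case/andP: zab => az zb; rewrite !ltW.
  have h1 := hd z zab' zd; have h2 := hd' z zab' zd'.
  have -> : v x - V x = - (v z - v x) + (V z - V x) by rewrite (vV z zab); ring.
  apply: (le_trans (ler_normD _ _)); rewrite normrN [e]splitr.
  by apply: lerD; exact: ltW.
have [h1 h2] : a <= a <= b /\ a <= b <= b by rewrite !lexx !ltW.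
split; apply: key => // d d0.
  pose z := a + Num.min d (b - a) / 2.
  have m0 : 0 < Num.min d (b - a) by rewrite lt_min d0 subr_gt0.
  have [m1 m2] : Num.min d (b - a) <= d /\ Num.min d (b - a) <= b - a by rewrite !ge_min !lexx orbT.
  exists z; rewrite /z; first by apply/andP; split; lra.
  by rewrite addrAC subrr add0r gtr0_norm ?divr_gt0//; lra.
pose z := b - Num.min d (b - a) / 2.
have m0 : 0 < Num.min d (b - a) by rewrite lt_min d0 subr_gt0.
have [m1 m2] : Num.min d (b - a) <= d /\ Num.min d (b - a) <= b - a by rewrite !ge_min !lexx orbT.
exists z; rewrite /z; first by apply/andP; split; lra.
by rewrite addrAC subrr add0r normrN gtr0_norm ?divr_gt0//; lra.
Qed.

(** Continuity is asked of [V \o f] only, and this joins the affine pieces across the points of [Q]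
    even when [f] jumps there. *)
Lemma piecewise_primitive (V V' : R -> R) Q a b f w : a < b ->
  (forall x : R, is_derive x 1 V (V' x)) -> continuous V' ->
  (forall x, punctured a (Some b) Q x -> local_isom f x) ->
  {within `[a, b], continuous (V \o f)} ->
  mu.-integrable `[a, b] (EFin \o w) ->
  (forall x, punctured a (Some b) Q x -> w x = isom_slope f x * V' (f x)) ->
  V (f b) - V (f a) = \int[mu]_(x in `[a, b]) w x.
Proof.
move=> ab dV cV'; elim: Q a b ab => [|q Q IH] a b ab hloc cVf iw wE.
  have pE x : a < x < b -> punctured a (Some b) [::] x by rewrite puncturedE andbT.
  have [k [c [k1 fE]]] : exists k c : R, (k = 1 \/ k = -1) /\
      forall x, x \in open_itv a (Some b) -> f x = k * x + c.
    by apply: local_isom_itv => x; rewrite in_open_itv => /pE; exact: hloc.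
  have fE' x : a < x < b -> f x = k * x + c by move=> xab; apply: fE; rewrite in_open_itv.
  have daff x : is_derive x 1 (fun y => k * y + c) k.
    have := is_derive_addf (is_derive_scalef k (is_derive_id x 1)) (is_derive_constf c x).
    by move=> /is_derive_eq; apply; rewrite mulr1 addr0.
  have dU x : is_derive x 1 (fun y => V (k * y + c)) (V' (k * x + c) * k).
    exact: (is_derive_compf (f := V) (g := fun y => k * y + c) (dV _) (daff x)).
  have cU' : continuous (fun x => V' (k * x + c) * k).
    move=> x; apply: cvgM; last exact: cvg_cst.
    apply: (@continuous_comp _ _ _ (fun y => k * y + c) V'); last exact: cV'.
    exact: is_derive_continuous (daff x).
  have cU : continuous (fun y => V (k * y + c)) by move=> x; exact: is_derive_continuous (dU x).
  have [ea eb] := eq_at_ends ab cVf cU (fun x xab => congr1 V (fE' x xab)).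
  rewrite /= in ea eb; rewrite ea eb -(Rintegral_FTC (ltW ab) dU cU').
  have eqo : {in `]a, b[%classic, (fun x => V' (k * x + c) * k) =1 w}.
    move=> x; rewrite inE /= in_itv/= => xab; rewrite (wE x (pE x xab)) (fE' x xab) mulrC.
    by rewrite (isom_slope_itv k1 fE)// in_open_itv.
  have iU := integrable_continuous_itv a b cU'.
  have opn (h : R -> R) : mu.-integrable `[a, b] (EFin \o h) ->
      \int[mu]_(x in `[a, b]) h x = \int[mu]_(x in `]a, b[) h x.
    move=> ih; rewrite -Rintegral_itv_obnd_cbnd; last first.
      by apply: integrableS ih => //; exact: subset_itv_oc_cc.
    rewrite -Rintegral_itv_bndo_bndc//.
    by apply: integrableS ih => //; exact: subset_itv_oo_cc.
  by rewrite (opn _ iU) (opn _ iw); exact: eq_Rintegral.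
have [qi|qi] := boolP (q \in open_itv a (Some b)); last first.
  by rewrite punctured_notin// in hloc wE; exact: IH.
move: (qi); rewrite in_open_itv => /andP[aq qb].
rewrite (punctured_split Q qi) in hloc wE.
have sub1 : `[a, q] `<=` `[a, b] by apply: subset_itvScc; rewrite bnd_simp// ltW.
have sub2 : `[q, b] `<=` `[a, b] by apply: subset_itvScc; rewrite bnd_simp// ltW.
rewrite (Rintegral_itv_cat (ltW aq) (ltW qb) iw).
rewrite -(IH a q aq (fun x h => hloc x (or_introl h))).
- rewrite -(IH q b qb (fun x h => hloc x (or_intror h))).
  + by ring.
  + exact: continuous_subspaceW cVf.
  + exact: integrableS iw.
  + by move=> x h; apply: wE; right.
- exact: continuous_subspaceW cVf.
- exact: integrableS iw.
- by move=> x h; apply: wE; left.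
Qed.

End PiecewisePrimitive.

(** * Lower bounds for glued distances *)

Section TentPotential.
Context {R : realType}.
Implicit Types (d r s t w x y z : R).

Definition tent s d r : R := Num.max 0 (d - `|r - s|).

Lemma tent_lip s d x y : `|tent s d x - tent s d y| <= `|x - y|.
Proof.
rewrite /tent !maxEle.
have h : `|x - s| <= `|x - y| + `|y - s| by exact: ler_distD.
have h' : `|y - s| <= `|x - y| + `|x - s| by rewrite (distrC x); exact: ler_distD.
move: `|x - s| `|y - s| h h' (normr_ge0 (x - y)) => a b; move: `|x - y| => c h h' c0.
rewrite ler_norml; apply/andP.
by case: (leP 0 (d - a)) => ?; case: (leP 0 (d - b)) => ?; split; lra.
Qed.

Lemma tent_out s d r : d <= `|r - s| -> tent s d r = 0.
Proof. by move=> h; rewrite /tent max_l// subr_le0. Qed.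

Lemma tent_gap s d t : 0 <= d -> `|tent s d s - tent s d t| = Num.min d `|s - t|.
Proof.
move=> d0; rewrite /tent subrr normr0 subr0 (max_r d0) (distrC t).
rewrite maxEle minEle; move: `|s - t| (normr_ge0 (s - t)) => a a0.
case: (leP 0 (d - a)) => h; case: (leP d a) => h'.
- by rewrite ger0_norm; lra.
- by rewrite ger0_norm; lra.
- by rewrite subr0 ger0_norm.
- by lra.
Qed.

(** A tent of radius [d] at [s] vanishes at all glued points, hence is an admissible potential: at
    distances below [d] gluing gives no shortcut. *)
Lemma glue_dist_ge_min (xs : seq R) s t d : 0 <= d ->
  (forall x, x \in xs -> d <= `|x - s| /\ d <= `|x + s|) ->
  Num.min d `|s - t| <= glue_dist xs s t /\ Num.min d `|s - t| <= glue_dist xs t s.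
Proof.
move=> d0 far; rewrite -tent_gap//.
have inv x : x \in xs -> tent s d x = tent s d (- x).
  move=> /far[h1 h2]; rewrite !tent_out//.
  by rewrite -opprD normrN.
split; last rewrite distrC; apply: (@glue_dist_potential R (tent s d)) => // x y; exact: tent_lip.
Qed.

(** Opposite points have the same absolute value, so it is an admissible potential whatever is
    glued. *)
Lemma glue_dist_norm (xs : seq R) s t : `| `|s| - `|t| | <= glue_dist xs s t.
Proof.
apply: (@glue_dist_potential R (fun r => `|r|)) => [x y|x _]; last by rewrite normrN.
exact: ler_dist_dist.
Qed.

Lemma seq_gap (P : seq R) s : s \notin P -> exists2 d, 0 < d & forall x, x \in P -> d <= `|x - s|.
Proof.
elim: P => [|p P IH]; first by exists 1.
rewrite inE negb_or => /andP[sp /IH[d d0 hd]].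
exists (Num.min d `|p - s|); first by rewrite lt_min d0 normr_gt0 subr_eq0 eq_sym.
move=> x; rewrite inE => /orP[/eqP->|/hd h]; first by rewrite ge_min lexx orbT.
by rewrite ge_min h.
Qed.

Lemma glue_gap (xs : seq R) s : s \notin xs -> - s \notin xs ->
  exists2 d, 0 < d & forall x, x \in xs -> d <= `|x - s| /\ d <= `|x + s|.
Proof.
move=> /seq_gap[d d0 hd] /seq_gap[d' d'0 hd'].
exists (Num.min d d'); first by rewrite lt_min d0.
move=> x xin; rewrite !ge_min hd//; split => //.
by have := hd' x xin; rewrite opprK => ->; rewrite orbT.
Qed.

End TentPotential.

(** * The graph metric near an interior point of an edge *)

Section InteriorMetric.
Context {R : realType}.
Variable G : mgraph R.
Hypothesis cG : gconnected G.
Implicit Types (e : 'I_(nE G)) (p q : gpoint G).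

Definition interior_pt e (x : R) := x \in open_itv 0 (edge_len e).

Lemma interior_dom e x : interior_pt e x -> in_dom (e, x).
Proof.
rewrite /interior_pt in_open_itv in_domE edge_domE => /andP[x0 xl]; rewrite (ltW x0)/=.
by case: (edge_len e) xl => // l /ltW.
Qed.

Lemma interior_radius e x : interior_pt e x -> exists2 d, 0 < d &
  (d <= x) && (if edge_len e is Some l then x + d <= l else true).
Proof.
rewrite /interior_pt in_open_itv => /andP[x0]; case: (edge_len e) => [l|] xl.
  exists (Num.min x (l - x)); first by rewrite lt_min x0 subr_gt0.
  rewrite ge_min lexx /=.
  by rewrite -lerBrDl ge_min lexx orbT.
by exists x; rewrite ?lexx.
Qed.

(** The potential is a tent on the edge [e], extended by zero; it vanishes at the ends of [e]
    because both are at distance at least [d] from [w]. *)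
Lemma gdist_interior e w d q : 0 <= d -> d <= w ->
  (if edge_len e is Some l then w + d <= l else true) -> in_dom (e, w) -> in_dom q ->
  (if q.1 == e then Num.min d `|w - q.2| else d) <= gdist (e, w) q.
Proof.
move=> d0 dw wl wd qd.
pose h p := if p.1 == e then tent w d p.2 else 0.
have := @gdist_potential R G h (e, w) q cG wd qd.
have -> : `|h (e, w) - h q| = if q.1 == e then Num.min d `|w - q.2| else d.
  rewrite /h /= eqxx; case: ifP => // _; first exact: tent_gap.
  by rewrite subr0 /tent subrr normr0 subr0 (max_r d0) ger0_norm.
apply.
  move=> e' x y _ _; rewrite /h /=; case: ifP => // _; first exact: tent_lip.
  by rewrite subrr normr0.
have vtx0 p v : vtx_of p = Some v -> h p = 0.
  case: p => e' x /vtx_ofP /= vx; rewrite /h /=; case: eqP => // ee; apply: tent_out.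
  case: vx => -[-> vx]; first by rewrite sub0r normrN ger0_norm// (le_trans d0).
  move: wl; rewrite /edge_len -ee vx => wl.
  by rewrite ger0_norm; lra.
move=> a b _ _ /orP[/eqP->//|/andP[+ /eqP ab]].
case E : (vtx_of a) ab => [v|//] ab _.
by rewrite (vtx0 a v)// (vtx0 b v).
Qed.

Lemma gdist_eq0_interior e x q : interior_pt e x -> in_dom q -> gdist (e, x) q = 0 -> q = (e, x).
Proof.
move=> xi qd h0; have [d d0 /andP[dx xl]] := interior_radius xi.
have := gdist_interior (ltW d0) dx xl (interior_dom xi) qd; rewrite h0.
case: q qd h0 => e' y qd _ /=; case: eqP => [->|_]; last by rewrite leNgt d0.
rewrite ge_min leNgt d0 /= normr_le0 subr_eq0 => /eqP ->; by [].
Qed.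

Lemma gdist_same p q : in_dom p -> in_dom q -> same_pt p q -> gdist p q <= 0.
Proof.
move=> pd qd pq; apply: gdist_le.
rewrite -[0]addr0; apply: (@reach_cat _ _ p p q) => //.
  by have := reach_edge pd pd erefl; rewrite subrr normr0.
by have := reach_edge qd qd erefl; rewrite subrr normr0.
Qed.

End InteriorMetric.

(** * The soliton on a graph isometric to a glued line *)

Section Soliton.
Context {R : realType}.
Notation mu := (@lebesgue_measure R).
Variables (G : mgraph R) (f : gpoint G -> R) (xs : seq R).
Hypothesis cG : gconnected G.
Hypothesis f_dist : forall p q, in_dom p -> in_dom q -> glue_dist xs (f p) (f q) = gdist p q.
Hypothesis f_surj : forall t, exists p, in_dom p /\ glue_dist xs (f p) t = 0.
Implicit Types (e : 'I_(nE G)) (p q : gpoint G).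

(** The position may switch between glued values, but its absolute value is 1-Lipschitz. *)
Let f_norm p q : in_dom p -> in_dom q -> `| `|f p| - `|f q| | <= gdist p q.
Proof. by move=> pd qd; rewrite -f_dist//; exact: glue_dist_norm. Qed.

Let f_edge e x y : in_dom (e, x) -> in_dom (e, y) -> `| `|f (e, x)| - `|f (e, y)| | <= `|x - y|.
Proof. by move=> xd yd; apply: (le_trans (f_norm xd yd)); apply: gdist_le; exact: reach_edge. Qed.

Let f_same p q : in_dom p -> in_dom q -> same_pt p q -> `|f p| = `|f q|.
Proof.
move=> pd qd pq; apply/eqP; rewrite -subr_eq0 -normr_le0.
exact: le_trans (f_norm pd qd) (gdist_same pd qd pq).
Qed.

Let f_inj e x q : interior_pt e x -> in_dom q -> f (e, x) = f q -> q = (e, x).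
Proof.
move=> xi qd fq; apply: gdist_eq0_interior => //.
by rewrite -f_dist ?interior_dom// -fq glue_distxx.
Qed.

(** Near such a point neither the vertices of the graph nor the gluing of the line offers a
    shortcut, so both distances reduce to differences of coordinates. *)
Lemma isometry_local_isom e x : interior_pt e x -> f (e, x) \notin xs -> - f (e, x) \notin xs ->
  local_isom (fun y => f (e, y)) x.
Proof.
move=> xi f1 f2; have [r r0 /andP[rx xl]] := interior_radius xi.
have [d0 d00 far] := glue_gap f1 f2.
set s := f (e, x) in f1 f2 far.
(* Points within [d] of [x], and their images, keep a distance of at least [3 * d] from the vertices
   and the glued points, while two such points are less than [2 * d] apart; each minimum below is
   therefore attained by the difference. *)
pose d := Num.min r d0 / 4.
have m0 : 0 < Num.min r d0 by rewrite lt_min r0.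
have d_gt0 : 0 < d by rewrite divr_gt0.
have [dr dd0] : 4 * d <= r /\ 4 * d <= d0.
  have -> : 4 * d = Num.min r d0 by rewrite /d; field.
  by rewrite !ge_min !lexx orbT.
have dom y : `|y - x| < d -> in_dom (e, y).
  rewrite ltr_distl => /andP[h1 h2]; rewrite in_domE edge_domE /=; apply/andP; split; first by lra.
  by case: (edge_len e) xl => // l xl; lra.
have close y : `|y - x| < d -> `|f (e, y) - s| < d.
  move=> yx; have yd := dom y yx; have xd := interior_dom xi.
  have [h _] := glue_dist_ge_min (f (e, y)) (ltW d00) far.
  have : Num.min d0 `|s - f (e, y)| < d.
    apply: (le_lt_trans h); rewrite f_dist//; apply: (le_lt_trans _ yx).
    by rewrite distrC; apply: gdist_le; exact: reach_edge.
  rewrite gt_min => /orP[h'|]; last by rewrite distrC.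
  by exfalso; move: h' dd0 d_gt0; lra.
exists d => // y z yx zx; have yd := dom y yx; have zd := dom z zx.
have yz : `|y - z| < 2 * d.
  apply: (le_lt_trans (ler_distD x _ _)); rewrite (distrC x).
  by move: yx zx; move: `|y - x| `|z - x| => a b; lra.
have gle : gdist (e, y) (e, z) <= `|y - z| by apply: gdist_le; exact: reach_edge.
apply/eqP; rewrite eq_le; apply/andP; split.
  have far' x' : x' \in xs -> 3 * d <= `|x' - f (e, y)| /\ 3 * d <= `|x' + f (e, y)|.
    move=> /far[h1 h2]; have cy := close y yx.
    have h3 : `|x' - s| <= `|x' - f (e, y)| + `|f (e, y) - s| by exact: ler_distD.
    have h4 : `|x' + s| <= `|x' + f (e, y)| + `|f (e, y) - s|.
      have -> : x' + s = (x' + f (e, y)) - (f (e, y) - s) by ring.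
      by apply: (le_trans (ler_normB _ _)).
    by move: h1 h2 h3 h4 cy dd0 {far}; move: `|x' - s| `|x' + s| `|x' - f (e, y)| `|x' + f (e, y)| `|f (e, y) - s| => {}*; split; lra.
  have d3 : 0 <= 3 * d by rewrite mulr_ge0// ltW.
  have [+ _] := glue_dist_ge_min (f (e, z)) d3 far'.
  rewrite f_dist// => /le_trans /(_ gle); rewrite ge_min => /orP[h|//].
  by exfalso; move: h yz d_gt0; move: `|y - z| => a; lra.
have d3 : 0 <= 3 * d by rewrite mulr_ge0// ltW.
have dy : 3 * d <= y by move: yx; rewrite ltr_distl => /andP[h1 h2]; lra.
have yl : (if edge_len e is Some l then y + 3 * d <= l else true) : bool.
  by move: yx; rewrite ltr_distl => /andP[h1 h2]; case: (edge_len e) xl => // l xl; lra.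
have := gdist_interior cG d3 dy yl yd zd; rewrite /= eqxx => h.
have : Num.min (3 * d) `|y - z| <= `|f (e, y) - f (e, z)|.
  by apply: (le_trans h); rewrite -f_dist//; exact: glue_dist_le.
rewrite ge_min => /orP[h'|//]; apply: le_trans h'.
by move: yz d_gt0; move: `|y - z| => a; lra.
Qed.

Let vals : seq R := [seq f (e, 0) | e <- enum 'I_(nE G)] ++ [seq f (e, glen G e) | e <- enum 'I_(nE G)].
(** Exceptional positions: the glued ones with both signs, and those of the ends of edges. *)
Let P : seq R := (xs ++ map -%R xs) ++ vals.
(** Each exceptional position has at most one interior preimage on [e], by [f_inj]. The default 0 is
    an end of the edge, so it removes no interior point. *)
Let Q e : seq R := [seq xget 0 [set x | interior_pt e x /\ f (e, x) = t] | t <- P].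

Let puncturedP e x : punctured 0 (edge_len e) (Q e) x <-> interior_pt e x /\ f (e, x) \notin P.
Proof.
rewrite puncturedE andbA -in_open_itv -/(interior_pt e x); split => [/andP[xi xQ]|[xi xP]].
  split => //; apply/negP => fP; move/negP : xQ; apply; apply/mapP; exists (f (e, x)) => //.
  case: xgetP => [y _ /= [yi fy]|/(_ x)]; last by move=> h; exfalso; apply: h.
  by have [] : (e, y) = (e, x) by apply: f_inj => //; exact: interior_dom.
rewrite xi /=; apply/negP => /mapP[t tP]; case: xgetP => [y _ /= [yi fy] xy|_ x0].
  by move: xP; rewrite xy fy tP.
by move: xi; rewrite /interior_pt in_open_itv x0 ltxx.
Qed.

Let P_xs t : t \notin P -> t \notin xs /\ - t \notin xs.
Proof.
rewrite !mem_cat !negb_or => /andP[/andP[-> tN] _]; split => //.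
by apply: contra tN => txs; apply/mapP; exists (- t); rewrite ?opprK.
Qed.

Let isom e x : e \in predT -> punctured 0 (edge_len e) (Q e) x -> local_isom (fun y => f (e, y)) x.
Proof. by move=> _ /puncturedP[xi /P_xs[h1 h2]]; exact: isometry_local_isom. Qed.

Let inj e e' x x' : e \in predT -> e' \in predT -> punctured 0 (edge_len e) (Q e) x ->
  punctured 0 (edge_len e') (Q e') x' -> f (e, x) = f (e', x') -> e = e' /\ x = x'.
Proof.
move=> _ _ /puncturedP[xi _] /puncturedP[xi' _] /(f_inj xi (interior_dom xi')).
by case.
Qed.

(** Surjectivity of [f] holds only up to glued distance 0; away from the glued points this distance
    vanishes only for equal positions. *)
Let cover t : t \notin P -> exists e x, [/\ e \in predT, punctured 0 (edge_len e) (Q e) x & f (e, x) = t].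
Proof.
move=> tP; have [t1 t2] := P_xs tP.
have [d d0 far] := glue_gap t1 t2.
have [[e x] [pd h0]] := f_surj t.
have ft : f (e, x) = t.
  have [_] := glue_dist_ge_min (f (e, x)) (ltW d0) far; rewrite h0 ge_min leNgt d0 /=.
  by rewrite normr_le0 subr_eq0 => /eqP.
exists e, x; split => //; apply/puncturedP; rewrite ft; split => //.
have : t \notin vals by move: tP; rewrite mem_cat negb_or => /andP[].
rewrite mem_cat negb_or => /andP[n1 n2].
rewrite /interior_pt in_open_itv.
move: pd; rewrite /in_dom /= => /andP[x0 xl]; apply/andP; split.
  rewrite lt0r x0 andbT; apply: contraNneq n1 => xe; apply/mapP; exists e; rewrite ?mem_enum//.
  by rewrite -ft xe.
rewrite /edge_len; case E : (gtl G e) xl => [w|//] xl; rewrite lt_neqAle xl andbT.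
apply: contraNneq n2 => xe; apply/mapP; exists e; rewrite ?mem_enum//.
by rewrite -ft xe.
Qed.

Let fnorm_continuous e (F : R -> R) y : continuous F -> (forall r, F (- r) = F r) -> in_dom (e, y) ->
  {within `[0, y], continuous (fun x => F (f (e, x)))}.
Proof.
move=> cF Fe yd.
have dom x : 0 <= x <= y -> in_dom (e, x).
  by move: yd; rewrite !in_domE /= => yd /andP[x0 xy]; exact: edge_dom_le xy.
have -> : (fun x => F (f (e, x))) = F \o (fun x => `|f (e, x)|).
  by apply/funext => x /=; case: (ger0P (f (e, x))).
have cn : {within `[0, y], continuous (fun x => `|f (e, x)|)}.
  apply/within_continuousP => x d xy d0; exists d => // z zy zx.
  by apply: le_lt_trans zx; apply: f_edge; exact: dom.
by move=> x; apply: (@continuous_comp (subspace `[0, y]) _ _ (fun x => `|f (e, x)|) F); [exact: cn|exact: cF].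
Qed.

Let fnorm_measurable e (F : R -> R) : continuous F -> (forall r, F (- r) = F r) ->
  measurable_fun (edge_dom (edge_len e)) (fun x => F (f (e, x))).
Proof.
move=> cF Fe; apply: measurable_fun_edge_dom => y Dy.
by apply: subspace_continuous_measurable_fun => //; apply: fnorm_continuous => //; rewrite in_domE.
Qed.

Let transport (F : R -> R) (I : R) : continuous F -> (forall r, F (- r) = F r) ->
  (forall r, 0 <= F r) -> (\int[mu]_x (F x)%:E = I%:E)%E ->
  (forall e, mu.-integrable (edge_dom (edge_len e)) (EFin \o (fun x => F (f (e, x))))) /\
  \sum_(e < nE G) \int[mu]_(x in edge_dom (edge_len e)) F (f (e, x)) = I.
Proof.
move=> cF Fe F0 FI.
have [i s] := change_of_variables_fin isom inj cover cF F0 (fun e _ => @fnorm_measurable e F cF Fe) FI.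
by split => // e; exact: i.
Qed.

Let u e x := soliton (f (e, x)).
(** The chain rule derivative of [u], set to 0 at the excluded points, finitely many on the edge,
    and outside it. *)
Let g e x := if `[< punctured 0 (edge_len e) (Q e) x >]
  then isom_slope (fun y => f (e, y)) x * dsoliton (f (e, x)) else 0.

Let mD e : measurable (edge_dom (@edge_len R G e)). Proof. exact: measurable_edge_dom. Qed.

Let dsoliton_sqrN (r : R) : dsoliton (- r) ^+ 2 = dsoliton r ^+ 2.
Proof. by rewrite !dsoliton_sqr sechN. Qed.

Let continuous_dsoliton_sqr : continuous (fun r : R => dsoliton r ^+ 2).
Proof.
move=> r; apply: (@continuous_comp _ _ _ (@dsoliton R) (fun y => y ^+ 2)).
  exact: continuous_dsoliton.
exact: exprn_continuous.
Qed.

Let dsoliton_bound (r : R) : `|dsoliton r| <= 1.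
Proof.
rewrite -(@ler_pXn2r _ 2) ?nnegrE// expr1n real_normK ?num_real// dsoliton_sqr.
have := sech_le1 r; have := ltW (sech_gt0 r); move: (sech r) => a a0 a1.
have : 0 <= a ^+ 3 by rewrite exprn_ge0.
by move: (a ^+ 3) => b; lra.
Qed.

Let g_sqr e x : g e x ^+ 2 = if `[< punctured 0 (edge_len e) (Q e) x >] then dsoliton (f (e, x)) ^+ 2 else 0.
Proof.
rewrite /g; case: ifPn => [/asboolP xp|_]; last by rewrite expr0n.
by rewrite exprMn (isom_slope_sqr (isom isT xp)) mul1r.
Qed.

Let g_bound e x : `|g e x| <= 1.
Proof.
rewrite /g; case: ifP => _; last by rewrite normr0.
by rewrite normrM -[leRHS]mulr1 ler_pM// isom_slope_le1.
Qed.

Let g_measurable e : measurable_fun [set: measurableTypeR R] (g e).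
Proof.
have ie x : punctured 0 (edge_len e) (Q e) x -> local_isom (fun y => f (e, y)) x by exact: isom.
have [mp ms] := measurable_isom_slope ie.
have [|_ _ mf _] := punctured_integral ie.
  by move=> x y hx hy /(inj isT isT hx hy)[].
have -> : g e = (fun x => isom_slope (fun y => f (e, y)) x * dsoliton (f (e, x)))
    \_ (punctured 0 (edge_len e) (Q e)).
  by apply/funext => x; rewrite /g /patch /in_mem /= /mem_set.
apply/(measurable_restrict _ mp measurableT); rewrite setTI.
apply: measurable_funM => //.
by apply: (measurableT_comp (f := @dsoliton R)) => //; apply: continuous_measurable_fun; exact: continuous_dsoliton.
Qed.

Let integral_dsoliton : (\int[mu]_x (dsoliton x ^+ 2)%:E = (pi / 8)%:E)%E.
Proof.
have i1 : (\int[mu]_x (@sech R x)%:E = (pi)%:E)%E.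
  have := integral_sech (ltr01 : 0 < 1 :> R); rewrite divr1 => <-.
  by apply: eq_integral => x _; rewrite mul1r.
have cs : continuous (@sech R) by exact: continuous_sech.
have cs3 : continuous (fun x : R => sech x ^+ 3).
  move=> x; apply: (@continuous_comp _ _ _ (@sech R) (fun y => y ^+ 3)); first exact: cs.
  exact: exprn_continuous.
have fin (F : R -> R) I : continuous F -> (forall x, 0 <= F x) -> (\int[mu]_x (F x)%:E = I%:E)%E ->
    mu.-integrable [set: measurableTypeR R] (EFin \o F).
  move=> cF F0 FI; apply/integrableP; split.
    by apply/measurable_EFinP; exact: continuous_measurable_fun.
  under eq_integral do rewrite /= ger0_norm//.
  by rewrite FI ltry.
have is1 := fin _ _ cs (fun x => ltW (sech_gt0 x)) i1.
have is3 := fin _ _ cs3 (fun x => exprn_ge0 3 (ltW (sech_gt0 x))) integral_sech3.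
under eq_integral do rewrite dsoliton_sqr mulrBr EFinB (EFinM _ (sech _)) (EFinM _ (sech _ ^+ 3)).
rewrite integralB//; [|exact: integrableZl|exact: integrableZl].
by rewrite !integralZl// i1 integral_sech3 -!EFinM -EFinB; congr EFin; field.
Qed.

(** The densities [sech], [sech ^+ 3] and [dsoliton ^+ 2] are even, so [transport] applies to each
    and the three norms are those of the soliton on the line. *)
Lemma soliton_optimizer : exists u g : 'I_(nE G) -> R -> R,
  [/\ H1 u g, 0 < normk 2 u & pi ^+ 2 * normk 6 u = 4 * normk 2 u ^+ 2 * normk 2 g].
Proof.
have i1 : (\int[mu]_x (@sech R x)%:E = (pi)%:E)%E.
  have := integral_sech (ltr01 : 0 < 1 :> R); rewrite divr1 => <-.
  by apply: eq_integral => x _; rewrite mul1r.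
have cs3 : continuous (fun x : R => sech x ^+ 3).
  move=> x; apply: (@continuous_comp _ _ _ (@sech R) (fun y => y ^+ 3)); first exact: continuous_sech.
  exact: exprn_continuous.
have [iu nu] := transport (@continuous_sech R) (@sechN R) (fun r => ltW (sech_gt0 r)) i1.
have [_ nu6] := transport cs3 (fun r => congr1 (fun s => s ^+ 3) (sechN r))
  (fun r => exprn_ge0 3 (ltW (sech_gt0 r))) integral_sech3.
have [id nd] := transport continuous_dsoliton_sqr dsoliton_sqrN
  (fun r => sqr_ge0 (dsoliton r)) integral_dsoliton.
have u2 : normk 2 u = pi.
  rewrite -nu normk2E; apply: eq_bigr => e _; apply: eq_Rintegral => x _.
  by rewrite soliton_sqr.
have u6 : normk 6 u = pi / 2.
  rewrite -nu6 normk6E; apply: eq_bigr => e _; apply: eq_Rintegral => x _.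
  by rewrite soliton6.
have mg2 e : measurable_fun (edge_dom (edge_len e)) (fun x => g e x ^+ 2).
  by apply: measurable_funX; apply: measurable_funTS; exact: g_measurable.
have g2 : normk 2 g = pi / 8.
  rewrite -nd normk2E; apply: eq_bigr => e _; congr fine.
  pose N : set (measurableTypeR R) := [set` [:: 0, odflt 0 (edge_len e) & Q e]].
  have mN : measurable N by exact: measurable_seq.
  have N0 : mu N = 0%E by exact: measure0_seq.
  rewrite (@ge0_negligible_integral _ _ _ mu _ N)//; last 2 first.
  - exact/measurable_EFinP.
  - by move=> x _; rewrite lee_fin sqr_ge0.
  rewrite [RHS](@ge0_negligible_integral _ _ _ mu _ N)//; last 2 first.
  - apply/measurable_EFinP; exact: (@fnorm_measurable e (fun r => dsoliton r ^+ 2)).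
  - by move=> x _; rewrite lee_fin sqr_ge0.
  apply: eq_integral => x; rewrite edge_dom_punctured inE => -[xp _].
  by rewrite g_sqr; move/asboolP : xp => ->.
exists u, g; split; last first.
- rewrite u2 u6 g2; have := pi_gt0 R; move: (pi : R) => q q0; by field.
- by rewrite u2 pi_gt0.
split=> [e|].
  rewrite edomE; have -> : (fun x => ((u e x) ^+ 2)%:E) = EFin \o (fun x => sech (f (e, x))).
    by apply/funext => x /=; rewrite soliton_sqr.
  exact: iu.
split=> [e|].
  rewrite edomE; apply: (@le_integrable _ _ _ mu _ (mD e) _ _ _ _ (id e)).
    by apply/measurable_EFinP; exact: mg2.
  move=> x _ /=; rewrite lee_fin !ger0_norm ?sqr_ge0// g_sqr; case: ifP => // _.
  exact: sqr_ge0.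
split=> [e y|].
  rewrite edomE => Dy; have y0 := edge_dom_ge0 Dy.
  have yd : in_dom (e, y) by rewrite in_domE.
  have ig : mu.-integrable `[0, y] (EFin \o g e).
    apply: (@le_integrable _ _ _ mu _ _ _ (EFin \o (fun=> 1 : R))) => //.
    - by apply/measurable_EFinP; apply: measurable_funTS; exact: g_measurable.
    - by move=> x _ /=; rewrite lee_fin normr1 g_bound.
    - by apply: integrable_continuous_itv => x; exact: cvg_cst.
  split => //; move: y0; rewrite le_eqVlt => /predU1P[<-|y0].
    by rewrite set_itv1 integral_set1 addr0.
  have sub x : punctured 0 (Some y) (Q e) x -> punctured 0 (edge_len e) (Q e) x.
    rewrite !puncturedE => /and3P[x0 xy ->]; rewrite x0 andbT /=.
    move: Dy; rewrite edge_domE => /andP[_].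
    by case: (edge_len e) => // l'; exact: lt_le_trans.
  have := @piecewise_primitive R soliton dsoliton (Q e) 0 y (fun x => f (e, x)) (g e) y0
    is_derive_soliton continuous_dsoliton (fun x h => isom isT (sub x h)).
  move=> /(_ (fnorm_continuous continuous_soliton solitonN yd) ig) h.
  rewrite /u -[fine _]/(\int[mu]_(x in `[0, y]) g e x) -h; first by ring.
  by move=> x /sub /asboolP xp; rewrite /g xp.
have u_same p q : in_dom p -> in_dom q -> same_pt p q -> u p.1 p.2 = u q.1 q.2.
  move=> pd qd pq; rewrite /u -!surjective_pairing.
  have N (r : R) : soliton r = soliton `|r| by case: (ger0P r) => // _; rewrite solitonN.
  by rewrite N (N (f q)) (f_same pd qd pq).
(* By [u_same] this set has at most one element, the value of [u] at the vertex. *)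
pose S v := [set r | exists p, [/\ in_dom p, vtx_of p = Some v & r = u p.1 p.2]].
have SE p v : in_dom p -> vtx_of p = Some v -> u p.1 p.2 = xget 0 (S v).
  move=> pd pv; case: xgetP => [r _ [q [qd qv ->]]|/(_ (u p.1 p.2))].
    by apply: u_same => //; exact: same_pt_vtx pv qv.
  by move=> h; exfalso; apply: h; exists p.
exists (fun v => xget 0 (S v)) => e; split.
  exact: (SE (e, 0) _ (in_dom0 e) (vtx_of0 e)).
by move=> w ew; exact: (SE (e, glen G e) _ (in_dom_len e) (vtx_of_len ew)).
Qed.

End Soliton.

Theorem theorem7p2 (R : realType) (G : mgraph R) :
  gconnected G -> noncompact G -> assumptionH G ->
  [/\ mucrit G = mucrit (Rline R),
      Elevel G (mucrit (Rline R)) = 0%E &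
      (attained G (mucrit (Rline R)) <-> is_R G \/ is_bubble_tower G)].
Proof.
move=> cG ncG HG; rewrite !(mucritE (@noncompact_Rline R) (@assumptionH_Rline R)).
split; [exact: mucritE|exact: Elevel_crit|split; first exact: attained_structure].
move=> h; apply/attained_crit => //.
(* The line is the case of an empty list of glued points, so one construction serves both
   alternatives. *)
have [xs [f [f_dist f_surj]]] : exists xs : seq R, isometric_to G (glue_dist xs).
  case: h => [[f [f_dist f_surj]]|[xs [_ _ _ h]]]; last by exists xs.
  exists [::], f; split=> [p q pd qd|t]; first by rewrite glue_dist_nil f_dist.
  by have [p [pd ft]] := f_surj t; exists p; rewrite glue_dist_nil.
exact: soliton_optimizer f_dist f_surj.
Qed.
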